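(* Let $a\in\{1,2,4,8\}$. The numbers of general and of special $\mathbb P^a$'s in $Y_a$ passing through a point of the codimension $i$ orbit $Y_a^i$ of $Y_a$ are as follows: - through a point of $Y_a^0$: $3$ general and $0$ special; - through a point of $Y_a^1$: $1$ general and $1$ special; - through a point of $Y_a^2$: $0$ general and $1$ special; - through a point of $Y_a^4$ (empty when $a=1$): $0$ general, and a one-parameter family ($\infty^1$) of special ones.
   Context: For $a=1,2,4,8$, $\mathbb A$ is the complexification of $\mathbf R,\mathbf C,\mathbf H,\mathbf O$ respectively: a complex composition algebra of dimension $a$ with conjugation $x\mapsto\bar x$ and quadratic form $q$, $x\bar x=q(x)1$. $\mathcal J_3(\mathbb A)$ is the complex vector space (dimension $3a+3$) of $3\times3$ $\mathbb A$-Hermitian matrices (diagonal entries in $\mathbf C$, off-diagonal entries in $\mathbb A$), a Jordan algebra for $A\circ B=\frac12(AB+BA)$. $\mathcal J_3(\mathbb A)_0$ is the subspace of traceless matrices; $Q(X)=\operatorname{trace}(X^2)$, and $\perp$ denotes orthogonality in $\mathcal J_3(\mathbb A)_0$ with respect to $Q$. $SO_3(\mathbb A):=\operatorname{Aut}(\mathcal J_3(\mathbb A))$ and $\mathfrak{so}_3(\mathbb A)=\operatorname{Der}(\mathcal J_3(\mathbb A))$. The Severi variety is $X_a=\{[X]: X^2=\operatorname{trace}(X)X\}\subset\mathbb P\mathcal J_3(\mathbb A)$, smooth of dimension $2a$; $X_a^0=X_a\cap\mathbb P\mathcal J_3(\mathbb A)_0$. $I$ is the identity matrix, and $\overline{X_a}\subset\mathbb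 P\mathcal J_3(\mathbb A)_0$ is the (isomorphic) image of $X_a$ under the projection from $[I]$, $X\mapsto X-\frac13\operatorname{trace}(X)I$; it contains $X_a^0$. $G(2,V)$ is the Grassmannian of $2$-dimensional subspaces of $V$ (lines in $\mathbb P(V)$). A plane is simply $3$-secant to $X_a$ if it meets $X_a$ in exactly three points, each a simple contact. The variety of reductions $Y_a\subset G(2,\mathcal J_3(\mathbb A)_0)$ is the Zariski closure of the set of lines that are images, under the projection from $[I]$, of planes through $[I]$ which are simply $3$-secant to $X_a$. It is the union of four $SO_3(\mathbb A)$-orbits $Y_a^0,Y_a^1,Y_a^2,Y_a^4$, of codimensions $0,1,2,4$ in $Y_a$ (with $Y_1^4=\emptyset$). The maximal linear spaces in $Y_a$ (in the Plücker embedding) are the $\mathbb P^a_x$, $x=[X]\in\overline{X_a}$, where $\mathbb P^a_x$ is the set of lines $L$ with $x\in L\subset\mathbb P\big((\mathfrak{so}_3(\mathbb A)X)^\perp\big)$. Such a $\mathbb P^a_x$ is called special if $x\in X_a^0$ and general if $x\in\overline{X_a}\setminus X_a^0$. *)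

(* Defs.v *)
From HB Require Import structures.
From mathcomp Require Import all_boot all_order all_algebra.
From mathcomp Require Import boolp classical_sets functions cardinality reals.
From mathcomp Require Import complex.
From mathcomp Require Import mpoly.

Set Implicit Arguments.
Unset Strict Implicit.
Unset Printing Implicit Defensive.

Import GRing.Theory.
Local Open Scope classical_set_scope.
Local Open Scope ring_scope.

(* Everything is defined over a field F; the statement takes F = R[i], the
   complex numbers.  Projective subspaces of P(V) are represented by the
   corresponding vector subspaces of V: a point is a [{vspace V}] of dimension
   1, a projective line one of dimension 2, a projective plane one of
   dimension 3. *)

(******************************************************************************)
(*                     Zariski topology and dimension                         *)
(******************************************************************************)

Section Zariski.
Variables (F : fieldType) (V : vectType F).

Local Notation dimV := (\dim {:V}).

Definition coords (v : V) (i : 'I_dimV) : F := coord (vbasis {:V}) i v.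

Definition evalp (p : {mpoly F[dimV]}) (v : V) : F := p.@[coords v].

Definition vanishes_on (p : {mpoly F[dimV]}) (K : set V) : Prop :=
  forall v, K v -> evalp p v = 0.

Definition zariski_closure (K : set V) : set V :=
  [set v | forall p, vanishes_on p K -> evalp p v = 0].

(* Zariski tangent space at v of the closure of K, as a subspace of V. *)
Definition tangent_space (K : set V) (v : V) : set V :=
  [set w | forall p, vanishes_on p K ->
     \sum_(i < dimV) p^`M(i).@[coords v] * coords w i = 0].

Definition alg_indep_on (K : set V) n (f : 'I_n -> {mpoly F[dimV]}) : Prop :=
  forall P : {mpoly F[n]},
    (forall v, K v -> P.@[fun i => evalp (f i) v] = 0) -> P = 0.

(* The ring of polynomial functions on K, i.e. the coordinate ring of the
   Zariski closure of K, has transcendence degree n over F. *)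
Definition coordinate_trdeg (K : set V) (n : nat) : Prop :=
  (exists f : 'I_n -> {mpoly F[dimV]}, alg_indep_on K f) /\
  (forall m (f : 'I_m -> {mpoly F[dimV]}), alg_indep_on K f -> (m <= n)%N).

(* For a cone K, the dimension of the image of K in P(V): the transcendence
   degree of the homogeneous coordinate ring, minus 1. *)
Definition proj_dim (K : set V) (d : nat) : Prop := coordinate_trdeg K d.+1.

Definition cone_of_points (S : set {vspace V}) : set V :=
  [set v | v != 0 /\ S <[v]>%VS].

Definition points_dim (S : set {vspace V}) (d : nat) : Prop :=
  proj_dim (cone_of_points S) d.

End Zariski.

Section Grassmannian.
Variables (F : fieldType) (V : vectType F).

(* The bivector u /\ v, encoded by the skew-symmetric matrix of its Pluecker
   coordinates u_i v_j - u_j v_i. *)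
Definition plucker (u v : V) : 'M[F]_(\dim {:V}) :=
  \matrix_(i, j) (coords u i * coords v j - coords u j * coords v i).

(* Cone over the image of a set of lines under the Pluecker embedding. *)
Definition plucker_cone (S : set {vspace V}) : set 'M[F]_(\dim {:V}) :=
  [set w | exists u v : V,
     [/\ \dim <<[:: u; v]>> = 2%N, S <<[:: u; v]>>%VS & w = plucker u v]].

(* Zariski closure of S in G(2, V).  The Pluecker cone of S is stable under
   nonzero scalars, so that its ideal is homogeneous and it is equivalent to
   take the closure of the cone. *)
Definition lines_closure (S : set {vspace V}) : set {vspace V} :=
  [set L | \dim L = 2%N /\
     plucker_cone [set L] `<=` zariski_closure (plucker_cone S)].

Definition lines_dim (S : set {vspace V}) (d : nat) : Prop :=
  proj_dim (plucker_cone S) d.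

Definition lines_codim (S T : set {vspace V}) (i : nat) : Prop :=
  exists d, lines_dim S d /\ lines_dim T (d + i).

End Grassmannian.

(******************************************************************************)
(*                      Complex composition algebras                          *)
(******************************************************************************)

(* Cayley-Dickson doublings of F; cd F k has dimension a = 2 ^ k.  When F is the
   field of complex numbers, cd F k is for k = 0, 1, 2, 3 the complexification
   of the real, complex, quaternion, octonion numbers: the formulas are the
   usual ones over the reals, extended bilinearly; in particular the
   conjugation is F-linear. *)
Fixpoint cd (F : fieldType) (k : nat) : vectType F :=
  if k is k'.+1 then (cd F k' * cd F k')%type else F^o.

Section CayleyDickson.
Variable F : fieldType.

Fixpoint cd_of_scalar k : F -> cd F k :=
  match k return F -> cd F k with
  | 0 => fun c => c
  | k'.+1 => fun c => (cd_of_scalar k' c, 0)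
  end.

(* The coefficient of the unit. *)
Fixpoint cd_scalar k : cd F k -> F :=
  match k return cd F k -> F with
  | 0 => fun x => x
  | k'.+1 => fun x => cd_scalar x.1
  end.

Fixpoint cd_conj k : cd F k -> cd F k :=
  match k return cd F k -> cd F k with
  | 0 => fun x => x
  | k'.+1 => fun x => (cd_conj x.1, - x.2)
  end.

Fixpoint cd_mul k : cd F k -> cd F k -> cd F k :=
  match k return cd F k -> cd F k -> cd F k with
  | 0 => fun x y => (x : F) * (y : F)
  | k'.+1 => fun x y =>
      (cd_mul x.1 y.1 - cd_mul (cd_conj y.2) x.2,
       cd_mul y.2 x.1 + cd_mul x.2 (cd_conj y.1))
  end.

End CayleyDickson.

(******************************************************************************)
(*                 The Jordan algebra of Hermitian matrices                   *)
(******************************************************************************)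

(* A 3 x 3 Hermitian matrix X over cd F k is stored as its diagonal (X i i)_i
   and its off-diagonal entries (X i (i+1))_i, with i + 1 modulo 3. *)
Definition J3 (F : fieldType) (k : nat) : vectType F :=
  ({ffun 'I_3 -> F^o} * {ffun 'I_3 -> cd F k})%type.

Section Jordan.
Variables (F : fieldType) (k : nat).

Local Notation A := (cd F k).
Local Notation J := (J3 F k).

Definition entry (X : J) (i j : 'I_3) : A :=
  if i == j then @cd_of_scalar F k (X.1 i)
  else if j == ordS i then X.2 i else cd_conj (X.2 j).

Definition mat_mul (M N : 'I_3 -> 'I_3 -> A) (i j : 'I_3) : A :=
  \sum_l cd_mul (M i l) (N l j).

(* (XY + YX) / 2.  This matrix is Hermitian, so nothing is lost when it is
   stored in J. *)
Definition jordan_mul (X Y : J) : J :=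
  let P i j := 2%:R^-1 *:
    (mat_mul (entry X) (entry Y) i j + mat_mul (entry Y) (entry X) i j) in
  ([ffun i => cd_scalar (P i i)], [ffun i => P i (ordS i)]).

Definition jordan_one : J := ([ffun => 1], 0).

Definition trace (X : J) : F := \sum_i X.1 i.

Definition traceless : set J := [set X | trace X = 0].

(* The polarization of the quadratic form Q(X) = trace (X^2). *)
Definition polarQ (X Y : J) : F := trace (jordan_mul X Y).

Definition automorphism (g : 'End(J)) : Prop :=
  lker g = 0%VS /\
  forall X Y, g (jordan_mul X Y) = jordan_mul (g X) (g Y).

Definition derivation (D : 'End(J)) : Prop :=
  forall X Y, D (jordan_mul X Y) = jordan_mul (D X) Y + jordan_mul X (D Y).

Definition proj_one (X : J) : J := X - (trace X / 3%:R) *: jordan_one.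

Fact proj_one_is_linear : linear proj_one.
Proof.
move=> c X Y; rewrite /proj_one.
have -> : trace (c *: X + Y) = c * trace X + trace Y.
  rewrite /trace mulr_sumr -big_split; apply: eq_bigr => i _.
  by rewrite /= !ffunE.
by rewrite mulrDl scalerDl -mulrA -scalerA scalerBr opprD addrACA.
Qed.

HB.instance Definition _ :=
  GRing.isLinear.Build F J J *:%R proj_one proj_one_is_linear.

Definition severi_cone : set J :=
  [set X | X != 0 /\ jordan_mul X X = trace X *: X].

Definition severi : set {vspace J} := [set <[X]>%VS | X in severi_cone].

Definition severi0 : set {vspace J} :=
  [set <[X]>%VS | X in severi_cone `&` traceless].

Definition severi_bar : set {vspace J} :=
  [set <[proj_one X]>%VS | X in severi_cone].

(* The contact of the plane P with the Severi variety at [X] is simple when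
   their scheme-theoretic intersection is reduced at the point [X], i.e. when
   P meets the tangent space of the cone at X only along the line F X. *)
Definition simple_contact (P : {vspace J}) (X : J) : Prop :=
  forall Y, Y \in P -> tangent_space severi_cone X Y -> Y \in <[X]>%VS.

Definition simply_3secant (P : {vspace J}) : Prop :=
  ([set x | severi x /\ (x <= P)%VS] #= `I_3)%card /\
  forall X, severi_cone X -> X \in P -> simple_contact P X.

Definition reduction_lines : set {vspace J} :=
  [set L | exists P : {vspace J},
     [/\ \dim P = 3%N, jordan_one \in P, simply_3secant P
       & L = (linfun proj_one @: P)%VS]].

(* All these lines lie in the Zariski closed subset of lines of traceless
   matrices, so that the closure may be taken in G(2, J) as well. *)
Definition reductions : set {vspace J} := lines_closure reduction_lines.

Definition aut_orbit (L : {vspace J}) : set {vspace J} :=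
  [set (g @: L)%VS | g in automorphism].

(* The codimension i orbit: the lines in Y_a whose orbit under SO_3(A) has
   codimension i in Y_a. *)
Definition reductions_orbit (i : nat) : set {vspace J} :=
  [set L | reductions L /\ lines_codim (aut_orbit L) reductions i].

(* The orthogonal in the traceless matrices of so_3(A) X, where x = [X]. *)
Definition so3_orth (x : {vspace J}) : set J :=
  [set Y | traceless Y /\
     forall D X, derivation D -> X \in x -> polarQ (D X) Y = 0].

(* The linear space P^a_x, a set of lines. *)
Definition Pspace (x : {vspace J}) : set {vspace J} :=
  [set L | [/\ \dim L = 2%N, (x <= L)%VS & [set` L] `<=` so3_orth x]].

Definition general_spaces : set (set {vspace J}) :=
  [set Pspace x | x in severi_bar `\` severi0].

Definition special_spaces : set (set {vspace J}) :=
  [set Pspace x | x in severi0].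

Definition general_through (L : {vspace J}) : set (set {vspace J}) :=
  [set S | general_spaces S /\ S L].

Definition special_through (L : {vspace J}) : set (set {vspace J}) :=
  [set S | special_spaces S /\ S L].

Definition special_parameters (L : {vspace J}) : set {vspace J} :=
  [set x | severi0 x /\ Pspace x L].

(* The special spaces through L form a one-parameter family: they are
   parametrized bijectively by a variety of dimension 1. *)
Definition one_parameter_special_through (L : {vspace J}) : Prop :=
  points_dim (special_parameters L) 1 /\
  set_bij (special_parameters L) (special_through L) Pspace.

End Jordan.

(* Main.v *)
Require Import Defs.
From HB Require Import structures.
From mathcomp Require Import all_boot all_order all_algebra.
From mathcomp Require Import boolp classical_sets functions cardinality reals.
From mathcomp Require Import complex.
From mathcomp Require Import mpoly.
From mathcomp Require Import ring zify.

Set Implicit Arguments.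
Unset Strict Implicit.
Unset Printing Implicit Defensive.

Import Order.TTheory GRing.Theory Num.Theory.
Local Open Scope classical_set_scope.
Local Open Scope ring_scope.

(** Write [hat] for the projection from the unit of the cubic Jordan algebra J and T for
    the trace.  A simply 3-secant plane through the unit is spanned by a frame of primitive
    idempotents, so the lines of reductions are the [<hat e, v>] with e a primitive
    idempotent and v traceless, [e v = 0], [T(v^2) <> 0].  The following conditions on a
    line L are closed, hence hold for all L in the closure Y: L is traceless, it spans a
    subalgebra together with the unit, the multiplications by its elements commute, and
    [T(D(x) y) = 0] for x, y in L and every derivation D.  According to whether the
    characteristic polynomial of some element of L has a simple root or all elements are
    nilpotent, they put L in one of four normal forms: as above with [T(v^2) <> 0] (type 0)
    or [T(v^2) = 0] (type 1), or [<X, p>] with [X^2 = X p = 0] and p^2 a nonzero multiple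
    of X (type 2) or zero (type 4).  Each type lies in the closure of the previous one and
    is cut out there by polynomials; together with tangent vectors to the orbits this
    determines the dimensions sufficiently to identify the orbit of codimension i with
    type i.  Finally, since the derivation condition holds on L, a linear space P_x contains
    L exactly when x is a point of L, and the points of L which are special or images of
    rank one elements are read off from the normal form. *)

(** * Polynomials in several variables *)

(** The geometry takes place in an abstract [cubicAlgebra], where nonassociativity is handled by one
    identity: most product formulas are instances of the polarized characteristic equation [jchar].
    The obstacle is the dimension count, because a codimension is a difference of transcendence
    degrees and no transitivity of the automorphism group on a type is established. Three estimates
    on cones replace it. The cone of type 0 is covered by finitely many polynomial images of spaces
    of dimension 3a + 1, which bounds its rank. Each specialization of type costs at least one,
    since finitely many polynomials vanish on the smaller cone and have no common zero on the larger
    one. Injective families of tangent vectors bound the orbits from below by 3a + 1, 3a and 3a - 2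
    for the types 0, 1 and 2. The tangent vectors come from composites of two Peirce reflections,
    which are automorphisms given by explicit formulas, and from scaling. No derivation is
    constructed: two spaces P_x are told apart by a line that lies in one of them and misses the
    base point of the other. *)

Section MPolySlice.
Variables (R : comNzRingType) (n : nat).
Implicit Types (P : {mpoly R[n.+1]}) (v : 'I_n.+1 -> R).

Definition drop_last (m : 'X_{1..n.+1}) : 'X_{1..n} :=
  [multinom m (widen_ord (leqnSn n) i) | i < n].

(* The coefficient of the k-th power of the last variable. *)
Definition mslice P (k : nat) : {mpoly R[n]} :=
  \sum_(m <- msupp P | m ord_max == k) P@_m *: 'X_[drop_last m].

Lemma drop_last_inj (m m' : 'X_{1..n.+1}) :
  m ord_max = m' ord_max -> drop_last m = drop_last m' -> m = m'.
Proof.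
move=> emax /mnmP edrop; apply/mnmP => i.
case: (unliftP ord_max i) => [j ->|-> //].
have := edrop j; rewrite !mnmE => e.
by have -> : lift ord_max j = widen_ord (leqnSn n) j by apply/val_inj; rewrite /= /bump leqNgt ltn_ord.
Qed.

Lemma mcoeff_slice P (m : 'X_{1..n.+1}) :
  (mslice P (m ord_max))@_(drop_last m) = P@_m.
Proof.
rewrite /mslice raddf_sum /=; have [mP|mP] := boolP (m \in msupp P).
  rewrite (big_rem m) //= eqxx mcoeffZ mcoeffX eqxx mulr1.
  rewrite big_seq_cond big1 ?addr0 // => m' /andP[m'P /eqP e].
  rewrite mcoeffZ mcoeffX; case: eqP => [e'|]; last by rewrite mulr0.
  have em : m' = m by apply: drop_last_inj.
  by move: m'P; rewrite em (rem_filter _ (msupp_uniq P)) mem_filter /= eqxx.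
rewrite (memN_msupp_eq0 mP) big_seq_cond big1 // => m' /andP[m'P /eqP e].
rewrite mcoeffZ mcoeffX; case: eqP => [e'|]; last by rewrite mulr0.
have em : m' = m by apply: drop_last_inj.
by move: mP; rewrite -em m'P.
Qed.

Lemma mslice_eq0 P : (forall k, mslice P k = 0) -> P = 0.
Proof. by move=> P0; apply/mpolyP => m; rewrite -mcoeff_slice P0 !mcoeff0. Qed.

Lemma meval_slice P v N : (msize P <= N)%N ->
  P.@[v] = \sum_(k < N)
    (mslice P k).@[fun i => v (widen_ord (leqnSn n) i)] * v ord_max ^+ k.
Proof.
move=> leN; rewrite mevalE; pose G (m : 'X_{1..n.+1}) := P@_m * \prod_i v i ^+ m i.
transitivity (\sum_(k < N) \sum_(m <- msupp P | m ord_max == k) G m).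
  rewrite (exchange_big_dep predT) //= big_seq [RHS]big_seq; apply: eq_bigr => m mP.
  have mN : (m ord_max < N)%N.
    apply: leq_trans leN; apply: leq_ltn_trans (msize_mdeg_lt mP).
    by rewrite mdegE (bigD1 ord_max) //= leq_addr.
  rewrite [RHS](bigD1 (Ordinal mN)) //= [X in _ + X]big1 ?addr0 // => k /andP[/eqP e] /eqP[].
  by apply/val_inj; rewrite /= e.
apply: eq_bigr => k _; rewrite /mslice raddf_sum mulr_suml; apply: eq_bigr => m /eqP e.
rewrite /= mevalZ mevalX /G big_ord_recr /= e mulrA; congr (_ * _ * _).
by apply: eq_bigr => i _; rewrite mnmE.
Qed.

End MPolySlice.

Lemma poly_eq0_fun (F : numDomainType) (p : {poly F}) : (forall t, p.[t] = 0) -> p = 0.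
Proof.
move=> p0; apply/eqP/negPn/negP => pn0.
pose rs : seq F := [seq i%:R | i <- iota 0 (size p)].
have roots : all (root p) rs by apply/allP => x _; rewrite /root p0.
have urs : uniq rs.
  by rewrite map_inj_uniq ?iota_uniq // => i j /eqP; rewrite eqr_nat => /eqP.
by have := max_poly_roots pn0 roots urs; rewrite size_map size_iota ltnn.
Qed.

(** The form in which a generic parameter occurs below: an identity checked off the roots of [h]
    holds identically. *)
Lemma poly_eq0_nz (F : numDomainType) (h p : {poly F}) :
  h != 0 -> (forall t, h.[t] != 0 -> p.[t] = 0) -> p = 0.
Proof.
move=> h0 hp; apply/eqP; suff : h * p == 0 by rewrite mulf_eq0 (negPf h0).
apply/eqP/poly_eq0_fun => t; rewrite hornerM.
by have [->|/hp ->] := eqVneq h.[t] 0; rewrite ?mul0r ?mulr0.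
Qed.

(** Induction on the number of variables: at a fixed [v] the values of the slices are the
    coefficients of a polynomial in the last variable that vanishes everywhere. *)
Lemma mpoly_eq0_fun (F : numDomainType) n (P : {mpoly F[n]}) :
  (forall v, P.@[v] = 0) -> P = 0.
Proof.
elim: n P => [|n IHn] P P0.
  apply/mpolyP => m; have -> : m = 0%MM by apply/mnmP => -[].
  have := P0 (fun=> 0); rewrite mevalE mcoeff0.
  have [mP|mP _] := boolP (0%MM \in msupp P); last by rewrite memN_msupp_eq0.
  rewrite (big_rem 0%MM) //= big_ord0 mulr1 big_seq big1 ?addr0 // => m'.
  have -> : m' = 0%MM by apply/mnmP => -[].
  by rewrite (rem_filter _ (msupp_uniq P)) mem_filter /= eqxx.
apply: mslice_eq0 => k; apply: IHn => v.
pose N := (msize P + k.+1)%N.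
pose q := \poly_(i < N) (mslice P i).@[v].
suff q0 : q = 0.
  by have := coef_poly N (fun i => (mslice P i).@[v]) k; rewrite -/q q0 coef0 /N addnS ltnS leq_addl.
apply: poly_eq0_fun => t.
pose v' (i : 'I_n.+1) := if unlift ord_max i is Some j then v j else t.
have := meval_slice v' (leq_addr k.+1 (msize P)); rewrite P0 horner_poly [X in _ = X -> _]/= => e; rewrite [RHS]e -/N.
apply: eq_bigr => i _; rewrite {2}/v' unlift_none; congr (_ * _).
apply: meval_eq => j; rewrite /v'.
have -> : widen_ord (leqnSn n) j = lift ord_max j by apply/val_inj; rewrite /= /bump leqNgt ltn_ord.
by rewrite liftK.
Qed.

(** * Polynomial functions and maps *)

Section PolyFun.
Variable F : numFieldType.
Implicit Types U V W X : vectType F.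

(** A predicate on functions rather than polynomials, so that compositions with vector-valued maps
    need no explicit coordinates. *)
Definition polyfun V (f : V -> F) : Prop :=
  exists p : {mpoly F[\dim {:V}]}, forall v, f v = evalp p v.

Definition polymap U V (phi : U -> V) : Prop :=
  forall i, polyfun (fun u => coords (phi u) i).

Lemma polyfun_ext V (f g : V -> F) : f =1 g -> polyfun f -> polyfun g.
Proof. by move=> fg [p fp]; exists p => v; rewrite -fg. Qed.

Lemma polyfunC V (c : F) : polyfun (fun _ : V => c).
Proof. by exists c%:MP => v; rewrite /evalp mevalC. Qed.

Lemma polyfun_coord V i : polyfun (fun v : V => coords v i).
Proof. by exists 'X_i => v; rewrite /evalp mevalXU. Qed.

Lemma polyfunD V (f g : V -> F) :
  polyfun f -> polyfun g -> polyfun (fun v => f v + g v).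
Proof. by move=> [p fp] [q gq]; exists (p + q) => v; rewrite /evalp mevalD fp gq. Qed.

Lemma polyfunM V (f g : V -> F) :
  polyfun f -> polyfun g -> polyfun (fun v => f v * g v).
Proof. by move=> [p fp] [q gq]; exists (p * q) => v; rewrite /evalp mevalM fp gq. Qed.

Lemma polyfunX V (f : V -> F) n : polyfun f -> polyfun (fun v => f v ^+ n).
Proof. by move=> [p fp]; exists (p ^+ n) => v; rewrite /evalp rmorphXn /= fp. Qed.

Lemma polyfunN V (f : V -> F) : polyfun f -> polyfun (fun v => - f v).
Proof. by move=> [p fp]; exists (- p) => v; rewrite /evalp mevalN fp. Qed.

Lemma polyfun_sum V I (r : seq I) (f : I -> V -> F) :
  (forall i, polyfun (f i)) -> polyfun (fun v => \sum_(i <- r) f i v).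
Proof.
move=> fP; elim: r => [|i r IH].
  by apply: polyfun_ext (polyfunC V 0) => v; rewrite big_nil.
by apply: polyfun_ext (polyfunD (fP i) IH) => v; rewrite big_cons.
Qed.

Lemma polyfun_prod V I (r : seq I) (f : I -> V -> F) :
  (forall i, polyfun (f i)) -> polyfun (fun v => \prod_(i <- r) f i v).
Proof.
move=> fP; elim: r => [|i r IH].
  by apply: polyfun_ext (polyfunC V 1) => v; rewrite big_nil.
by apply: polyfun_ext (polyfunM (fP i) IH) => v; rewrite big_cons.
Qed.

Lemma polyfun_meval V n (P : {mpoly F[n]}) (f : 'I_n -> V -> F) :
  (forall i, polyfun (f i)) -> polyfun (fun v => P.@[fun i => f i v]).
Proof.
move=> fP; have := @polyfun_sum V _ (msupp P)
  (fun m v => P@_m * \prod_(i < n) f i v ^+ m i).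
move=> h; apply: polyfun_ext (h _) => [v|m]; first by rewrite mevalE.
apply: polyfunM; first exact: polyfunC.
by apply: polyfun_prod => i; apply: polyfunX.
Qed.

Lemma polyfun_comp U V (f : V -> F) (phi : U -> V) :
  polyfun f -> polymap phi -> polyfun (fun u => f (phi u)).
Proof.
by move=> [p fp] phiP; apply: polyfun_ext (polyfun_meval p phiP) => u; rewrite fp.
Qed.

Lemma polymap_comp U V W (psi : V -> W) (phi : U -> V) :
  polymap psi -> polymap phi -> polymap (fun u => psi (phi u)).
Proof. by move=> psiP phiP i; apply: (polyfun_comp (psiP i)). Qed.

Lemma polymap_ext U V (f g : U -> V) : f =1 g -> polymap f -> polymap g.
Proof. by move=> fg fP i; apply: polyfun_ext (fP i) => u; rewrite fg. Qed.

Lemma coords_sum V (v : V) : v = \sum_i coords v i *: (vbasis {:V})`_i.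
Proof. by rewrite {1}(coord_vbasis (memvf v)). Qed.

Lemma coords_is_linear V i a (x y : V) :
  coords (a *: x + y) i = a * coords x i + coords y i.
Proof. by rewrite /coords linearP. Qed.

Lemma coords_inj V (x y : V) : (forall i, coords x i = coords y i) -> x = y.
Proof.
by move=> xy; rewrite (coords_sum x) (coords_sum y); apply: eq_bigr => i _; rewrite xy.
Qed.

Lemma polymapC U V (v : V) : polymap (fun _ : U => v).
Proof. by move=> i; apply: polyfunC. Qed.

Lemma polymap_id V : polymap (fun v : V => v).
Proof. by move=> i; apply: polyfun_coord. Qed.

Lemma polymapD U V (f g : U -> V) :
  polymap f -> polymap g -> polymap (fun u => f u + g u).
Proof.
move=> fP gP i; apply: polyfun_ext (polyfunD (fP i) (gP i)) => u.
by rewrite /coords linearD.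
Qed.

Lemma polymapZ U V (c : U -> F) (f : U -> V) :
  polyfun c -> polymap f -> polymap (fun u => c u *: f u).
Proof.
move=> cP fP i; apply: polyfun_ext (polyfunM cP (fP i)) => u.
by rewrite /coords linearZ.
Qed.

Lemma polymap_sum U V I (r : seq I) (f : I -> U -> V) :
  (forall i, polymap (f i)) -> polymap (fun u => \sum_(i <- r) f i u).
Proof.
move=> fP; elim: r => [|i r IH].
  by apply: polymap_ext (polymapC U 0) => v; rewrite big_nil.
by apply: polymap_ext (polymapD (fP i) IH) => v; rewrite big_cons.
Qed.

Lemma polymap_linear U V (f : U -> V) :
  (forall a x y, f (a *: x + y) = a *: f x + f y) -> polymap f.
Proof.
move=> fP; pose g : {linear U -> V} := HB.pack f (GRing.isLinear.Build _ _ _ _ f fP).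
have := polymap_sum (index_enum 'I_(\dim {:U}))
  (fun i => polymapZ (polyfun_coord i) (polymapC U (f (vbasis {:U})`_i))).
apply: polymap_ext => u /=; rewrite {2}(coords_sum u) -[f]/(g : _ -> _) linear_sum.
by apply: eq_bigr => i _; rewrite linearZ.
Qed.

Lemma polymap_bilinear U V W X (B : V -> W -> X) (f : U -> V) (g : U -> W) :
  (forall a x x' y, B (a *: x + x') y = a *: B x y + B x' y) ->
  (forall a x y y', B x (a *: y + y') = a *: B x y + B x y') ->
  polymap f -> polymap g -> polymap (fun u => B (f u) (g u)).
Proof.
move=> Bl Br fP gP.
have := polymap_sum (index_enum 'I_(\dim {:V})) (fun i =>
  polymapZ (fP i) (polymap_comp (polymap_linear (fun a => Br a (vbasis {:V})`_i)) gP)).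
apply: polymap_ext => u /=; rewrite {2}(coords_sum (f u)); move: (g u) => y.
pose g' : {linear V -> X} := HB.pack (B^~ y)
  (GRing.isLinear.Build _ _ _ _ (B^~ y) (fun a x x' => Bl a x x' y)).
rewrite -[RHS]/(g' _) linear_sum.
by apply: eq_bigr => i _; rewrite linearZ.
Qed.

Lemma polymap_polyfun V (f : V -> F) : polymap (f : V -> F^o) -> polyfun f.
Proof.
move=> fP; have := polyfun_sum (index_enum 'I_(\dim {:F^o}))
  (fun i => polyfunM (fP i) (polyfunC V ((vbasis {:F^o})`_i : F))).
by apply: polyfun_ext => v /=; rewrite [RHS](@coords_sum F^o).
Qed.

Lemma polyfun_polymap V (f : V -> F) : polyfun f -> polymap (f : V -> F^o).
Proof.
move=> fP; have := polymapZ fP (polymapC V (1 : F^o)).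
by apply: polymap_ext => v; rewrite /GRing.scale /= mulr1.
Qed.

Lemma polyfun_linear V (f : V -> F) :
  (forall a x y, f (a *: x + y) = a * f x + f y) -> polyfun f.
Proof. by move=> fP; apply: polymap_polyfun; apply: polymap_linear. Qed.

Lemma horner_mmap n (h : 'I_n -> {poly F}) (P : {mpoly F[n]}) s :
  (mmap polyC h P).[s] = P.@[fun i => (h i).[s]].
Proof.
rewrite /mmap mevalE horner_sum; apply: eq_bigr => m _.
rewrite hornerM hornerC /mmap1 horner_prod; congr (_ * _).
by apply: eq_bigr => i _; rewrite horner_exp.
Qed.

Lemma polyfun_poly (f : F^o -> F) :
  polyfun f -> exists p : {poly F}, forall s, f s = p.[s].
Proof.
(* The basis vector chosen for [F^o] need not be 1, so the coordinate of [s] is [s] times that of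
   1. *)
move=> [P fP]; pose h i : {poly F} := coords (1 : F^o) i *: 'X.
exists (mmap polyC h P) => s; rewrite fP horner_mmap /evalp.
apply: meval_eq => i; rewrite /h hornerZ hornerX mulrC.
rewrite {1}(_ : s = s *: (1 : F^o)); last by rewrite /GRing.scale /= mulr1.
by rewrite /coords linearZ.
Qed.

Lemma zariski_closure_polyfun V (K : set V) (f : V -> F) v :
  polyfun f -> (forall w, K w -> f w = 0) -> zariski_closure K v -> f v = 0.
Proof. by move=> [p fp] fK clv; rewrite fp; apply: clv => w /fK; rewrite fp. Qed.

Lemma sub_zariski_closure V (K : set V) : K `<=` zariski_closure K.
Proof. by move=> v Kv p pK; apply: pK. Qed.

(** Along the curve a polynomial vanishing on [K] is a polynomial in [s] that vanishes off the roots
    of [h], hence everywhere. The degenerations between types of lines are instances of this at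
    [s = 0]. *)
Lemma curve_closure V (K : set V) (gamma : F^o -> V) (h : {poly F}) :
  polymap gamma -> h != 0 -> (forall s, h.[s] != 0 -> K (gamma s)) ->
  forall s, zariski_closure K (gamma s).
Proof.
move=> gP h0 hK s p pK.
have pP : polyfun (evalp p) by exists p.
have [q qP] := polyfun_poly (polyfun_comp pP gP).
rewrite qP (poly_eq0_nz h0 (p := q)) ?horner0 // => t ht.
by rewrite -qP; apply: pK; apply: hK.
Qed.

End PolyFun.

(** * Transcendence degree of cones *)

Section Rank.
Variable F : numFieldType.
Implicit Types U V : vectType F.

(** The lower half of [coordinate_trdeg]. Upper bounds are stated as implications from it, so that
    no exact transcendence degree has to be known. *)
Definition rank_ge V (K : set V) n : Prop :=
  exists f : 'I_n -> {mpoly F[\dim {:V}]}, alg_indep_on K f.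

Lemma rank_geP V (K : set V) n (f : 'I_n -> V -> F) :
  (forall i, polyfun (f i)) ->
  (forall P : {mpoly F[n]}, (forall v, K v -> P.@[fun i => f i v] = 0) -> P = 0) ->
  rank_ge K n.
Proof.
move=> /choice[p fp] indep; exists p => P P0; apply: indep => v Kv.
by rewrite -(P0 v Kv); apply: meval_eq => i; rewrite fp.
Qed.

Lemma rank_ge_closure V (K K' : set V) n :
  K `<=` zariski_closure K' -> rank_ge K n -> rank_ge K' n.
Proof.
move=> KK' [f fK]; exists f => P P0; apply: fK => v /KK' clv.
apply: (zariski_closure_polyfun (f := fun v => P.@[fun i => evalp (f i) v])) clv => //.
by apply: polyfun_meval => i; exists (f i).
Qed.

Lemma rank_ge_sub V (K K' : set V) n : K `<=` K' -> rank_ge K n -> rank_ge K' n.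
Proof. by move=> KK'; apply: rank_ge_closure => v /KK' /sub_zariski_closure. Qed.

(* If no coordinate function could be added to f, then on each locus
   [h j != 0] some relation P0(f) + h j * P1(f, h j) = 0 would hold with
   P0 nonzero; their product vanishes on K', hence on K, where h j = 0. *)
Lemma rank_ge_strict V (K K' : set V) n (I : finType) (h : I -> V -> F) :
  K `<=` zariski_closure K' -> (forall j, polyfun (h j)) ->
  (forall j v, K v -> h j v = 0) -> (forall v, K' v -> exists j, h j v != 0) ->
  rank_ge K n -> rank_ge K' n.+1.
Proof.
move=> KK' hP hK hK' [f fK]; apply: contrapT => notK'.
have rel j : exists P : {mpoly F[n]}, exists R : V -> F,
    [/\ P != 0, polyfun R, forall v, K' v -> h j v != 0 -> R v = 0
      & forall v, h j v = 0 -> R v = P.@[fun i => evalp (f i) v]].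
  pose g (i : 'I_n.+1) v := if unlift ord_max i is Some i' then evalp (f i') v else h j v.
  have gP i : polyfun (g i).
    by rewrite /g; case: (unlift _ _) => [i'|]; [exists (f i')|exact: hP].
  have : ~ (forall P : {mpoly F[n.+1]}, (forall v, K' v -> P.@[fun i => g i v] = 0) -> P = 0).
    by move=> indep; apply: notK'; apply: rank_geP indep.
  move/existsNP => [P /not_implyP[P0 /eqP Pn0]].
  have exk : exists k, mslice P k != 0.
    apply: contrapT => nk; move/eqP: Pn0; apply; apply: mslice_eq0 => k.
    by apply/eqP/negPn/negP => ?; apply: nk; exists k.
  (* Dividing the relation by [h j ^+ k0] makes its constant term nonzero, and the quotient still
     vanishes on [K'] where [h j] does not. *)
  pose k0 := ex_minn exk.
  have [sk0 k0min] : mslice P k0 != 0 /\ forall k, (k < k0)%N -> mslice P k = 0.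
    rewrite /k0; case: ex_minnP => k sk kmin; split=> // k' k'k.
    by apply/eqP/negPn/negP => /kmin; rewrite leqNgt k'k.
  pose c k v := (mslice P k).@[fun i => evalp (f i) v].
  have cP k : polyfun (c k) by apply: polyfun_meval => i; exists (f i).
  exists (mslice P k0), (fun v => \sum_(k < msize P) c (k0 + k)%N v * h j v ^+ k).
  have eqR v : P.@[fun i => g i v] = h j v ^+ k0 * \sum_(k < msize P) c (k0 + k)%N v * h j v ^+ k.
    rewrite (meval_slice _ (leq_addl k0 _)).
    have e1 k : (mslice P k).@[fun i => g (widen_ord (leqnSn n) i) v] * g ord_max v ^+ k =
        c k v * h j v ^+ k.
      rewrite /g unlift_none; congr (_ * _); apply: meval_eq => i.
      have -> : widen_ord (leqnSn n) i = lift ord_max i by apply/val_inj; rewrite /= /bump leqNgt ltn_ord.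
      by rewrite liftK.
    under eq_bigr => k _ do rewrite e1.
    rewrite big_split_ord /= big1 ?add0r => [|i _]; last by rewrite /c k0min // meval0 mul0r.
    rewrite mulr_sumr; apply: eq_bigr => k _.
    by rewrite exprD mulrCA.
  split=> //.
  - by apply: polyfun_sum => k; apply: polyfunM => //; apply: polyfunX.
  - move=> v K'v hv; move: (P0 v K'v); rewrite eqR => /eqP.
    by rewrite mulf_eq0 expf_eq0 (negPf hv) andbF => /eqP.
  - move=> v hv; have : (0 < msize P)%N.
      rewrite lt0n; apply/negP => /eqP sP; move/eqP: Pn0; apply.
      by apply/eqP; rewrite -(mmeasure_poly_eq0 mdeg) sP.
    case: (msize P) => // sz _; rewrite big_ord_recl addn0 expr0 mulr1 big1 ?addr0 // => i _.
    by rewrite hv expr0n mulr0.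
have /choice[P /choice[R PR]] := rel.
have : \prod_j P j == 0.
  apply/eqP/fK => v Kv; rewrite rmorph_prod /=.
  have <- : \prod_j R j v = \prod_j (P j).@[fun i => evalp (f i) v].
    by apply: eq_bigr => j _; have [_ _ _ ->] := PR j; rewrite ?hK.
  apply: (zariski_closure_polyfun (f := fun v => \prod_j R j v)) (KK' _ Kv).
    by apply: polyfun_prod => j; have [] := PR j.
  move=> w K'w; have [j hj] := hK' _ K'w.
  by rewrite (bigD1 j) //=; have [_ _ -> // _] := PR j; rewrite mul0r.
by rewrite prodf_seq_eq0 => /hasP[j _ /=]; have [/negPf->] := PR j.
Qed.

(** * Algebraic dependence by counting monomials *)

Definition upd n (t : 'I_n -> F) (i : 'I_n) (s : F) : 'I_n -> F :=
  fun j => if j == i then s else t j.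

(** A bound on the degree in each variable separately, stated for functions: it is additive under
    products and is what vanishing on a grid requires. *)
Definition deg_le n (d : nat) (f : ('I_n -> F) -> F) : Prop :=
  forall i t, exists2 q : {poly F}, (size q <= d.+1)%N & forall s, f (upd t i s) = q.[s].

Lemma deg_leC n d (c : F) : deg_le d (fun _ : 'I_n -> F => c).
Proof. by move=> i t; exists c%:P => [|s]; rewrite ?hornerC // (leq_trans (size_polyC_leq1 _)). Qed.

Lemma deg_le_coord n i : deg_le 1 (fun t : 'I_n -> F => t i).
Proof.
move=> j t; exists (if i == j then 'X else (t i)%:P) => [|s].
  by case: ifP; rewrite ?size_polyX // (leq_trans (size_polyC_leq1 _)).
by rewrite /upd; case: ifP; rewrite ?hornerX ?hornerC.
Qed.

Lemma deg_leW n d d' (f : ('I_n -> F) -> F) : (d <= d')%N -> deg_le d f -> deg_le d' f.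
Proof. by move=> dd' fd i t; have [q sq fq] := fd i t; exists q => //; apply: leq_trans sq _. Qed.

Lemma deg_leD n d (f g : ('I_n -> F) -> F) :
  deg_le d f -> deg_le d g -> deg_le d (fun t => f t + g t).
Proof.
move=> fd gd i t; have [q sq fq] := fd i t; have [r sr gr] := gd i t.
exists (q + r) => [|s]; last by rewrite hornerD fq gr.
by apply: leq_trans (size_polyD _ _) _; rewrite geq_max sq.
Qed.

Lemma deg_leM n d d' (f g : ('I_n -> F) -> F) :
  deg_le d f -> deg_le d' g -> deg_le (d + d') (fun t => f t * g t).
Proof.
move=> fd gd i t; have [q sq fq] := fd i t; have [r sr gr] := gd i t.
exists (q * r) => [|s]; last by rewrite hornerM fq gr.
by apply: leq_trans (size_polyMleq _ _) _; lia.
Qed.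

Lemma deg_leX n d k (f : ('I_n -> F) -> F) :
  deg_le d f -> deg_le (d * k) (fun t => f t ^+ k).
Proof.
move=> fd i t; have [q sq fq] := fd i t.
exists (q ^+ k) => [|s]; last by rewrite horner_exp fq.
by apply: leq_trans (size_poly_exp_leq _ _) _; rewrite ltnS leq_mul2r; apply/orP; right; lia.
Qed.

Lemma deg_le_sum n d I (r : seq I) (f : I -> ('I_n -> F) -> F) :
  (forall i, deg_le d (f i)) -> deg_le d (fun t => \sum_(i <- r) f i t).
Proof.
move=> fd; elim: r => [|i r IH].
  by move=> j t; have [q sq qE] := deg_leC d 0 j t; exists q => // s; rewrite big_nil -qE.
move=> j t; have [q sq eq] := deg_leD (fd i) IH j t.
by exists q => // s; rewrite big_cons eq.
Qed.

Lemma deg_le_prod n d I (r : seq I) (f : I -> ('I_n -> F) -> F) :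
  (forall i, deg_le d (f i)) -> deg_le (d * size r) (fun t => \prod_(i <- r) f i t).
Proof.
move=> fd; elim: r => [|i r IH].
  by move=> j t; have [q sq qE] := deg_leC (d * 0) 1 j t; exists q => // s; rewrite big_nil -qE.
rewrite mulnS => j t; have [q sq eq] := deg_leM (fd i) IH j t.
by exists q => // s; rewrite big_cons eq.
Qed.

Lemma deg_le_mpoly n (P : {mpoly F[n]}) : exists d, deg_le d (fun t => P.@[t]).
Proof.
elim/mpolyind: P => [|c m P _ _ [d Pd]].
  exists 0%N => i t; have [q sq qE] := deg_leC 0 0 i t; exists q => // s.
  by rewrite meval0 -qE.
have mono i : deg_le (mdeg m) (fun t : 'I_n -> F => t i ^+ m i).
  apply: (@deg_leW _ (1 * m i)); last exact/deg_leX/deg_le_coord.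
  by rewrite mul1n mdegE (bigD1 i) //= leq_addr.
pose e := (d + (mdeg m * size (index_enum 'I_n)))%N; exists e => i t.
have [q sq eq] := deg_leD (deg_leW (leq_addl d _)
   (deg_leM (deg_leC 0 c) (deg_le_prod (index_enum 'I_n) mono))) (deg_leW (leq_addr _ d) Pd) i t.
by exists q => // s; rewrite mevalD mevalZ mevalX eq.
Qed.

Lemma deg_le_grid n d (f : ('I_n -> F) -> F) :
  (forall t t', t =1 t' -> f t = f t') -> deg_le d f ->
  (forall b : {ffun 'I_n -> 'I_d.+1}, f (fun i => (b i)%:R) = 0) -> forall t, f t = 0.
Proof.
move=> fext fd grid.
(* Induction on [k]: the first [k] coordinates are arbitrary and the others are grid values. *)
suff H k : (k <= n)%N -> forall t,
    (forall i : 'I_n, (k <= i)%N -> exists b : 'I_d.+1, t i = b%:R) -> f t = 0.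
  by move=> t; apply: (H n) => // i; rewrite leqNgt ltn_ord.
elim: k => [_ t tg|k IH kn t tg].
  have /choice[b tb] : forall i, exists b : 'I_d.+1, t i = b%:R by move=> i; apply: tg.
  by rewrite -(grid [ffun i => b i]); apply: fext => i; rewrite ffunE.
pose i0 := Ordinal kn; have [q sq fq] := fd i0 t.
have fb (b : 'I_d.+1) : q.[b%:R] = 0.
  rewrite -fq; apply: IH => [|i ki]; first exact: ltnW.
  rewrite /upd; case: eqP => [_|/eqP ii0]; first by exists b.
  by apply: tg; rewrite ltn_neqAle ki andbT eq_sym; apply: contra ii0 => /eqP e; apply/eqP/val_inj.
have q0 : q = 0.
  apply/eqP/negPn/negP => qn0.
  pose rs : seq F := [seq (i : 'I_d.+1)%:R | i <- enum 'I_d.+1].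
  have roots : all (root q) rs by apply/allP => _ /mapP[i _ ->]; rewrite /root fb.
  have urs : uniq rs.
    by rewrite map_inj_uniq ?enum_uniq // => i j /eqP; rewrite eqr_nat => /eqP /val_inj.
  by have := max_poly_roots qn0 roots urs; rewrite size_map size_enum_ord ltnNge sq.
rewrite -[LHS](_ : f (upd t i0 (t i0)) = _); first by rewrite fq q0 horner0.
by apply: fext => i; rewrite /upd; case: eqP => [->|].
Qed.

(** A count of monomials: there are [s ^ m] products of powers of the [G i] with exponents below
    [s], and a combination of them vanishes as soon as it does on a grid of [B.+1 ^ n] points. The
    kernel of the evaluation matrix contains the relation. *)
Lemma mpoly_dependent n m (G : 'I_m -> {mpoly F[n]}) : (n < m)%N ->
  exists2 P : {mpoly F[m]}, P != 0 & forall t, P.@[fun i => (G i).@[t]] = 0.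
Proof.
move=> nm; have [d Gd] : exists d, forall i, deg_le d (fun t => (G i).@[t]).
  have /choice[d Gd] := fun i => deg_le_mpoly (G i).
  exists (\max_i d i) => i; exact: deg_leW (leq_bigmax i) (Gd i).
(* [B] bounds the degree of each product in every variable. Since B + 1 is at most s(dm + 1), and s
   exceeds (dm + 1)^n, the grid has fewer than s^(n+1) points. *)
pose s := ((d * m).+1 ^ n).+1; pose B := (d * s * m)%N.
pose mon (a : {ffun 'I_m -> 'I_s}) t := \prod_i (G i).@[t] ^+ a i.
have mond a : deg_le B (mon a).
  have := deg_le_prod (index_enum 'I_m) (fun i => deg_leW (leq_mul (leqnn d) (ltnW (ltn_ord (a i))))
     (deg_leX (a i) (Gd i))).
  by rewrite /B; have -> : size (index_enum 'I_m) = m by rewrite -[RHS]card_ord cardE enumT.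
pose A : 'M[F]_(#|{ffun 'I_m -> 'I_s}|, #|{ffun 'I_n -> 'I_B.+1}|) :=
  \matrix_(a, b) mon (enum_val a : {ffun 'I_m -> 'I_s})
      (fun i => ((enum_val b : {ffun 'I_n -> 'I_B.+1}) i)%:R).
have cards : (#|{ffun 'I_n -> 'I_B.+1}| < #|{ffun 'I_m -> 'I_s}|)%N.
  rewrite !card_ffun !card_ord.
  have leB : (B.+1 <= s * (d * m).+1)%N by rewrite /B /s; nia.
  apply: (@leq_ltn_trans ((s * (d * m).+1) ^ n)); first by case: (n) => // n'; rewrite leq_exp2r.
  rewrite expnMn; apply: (@leq_trans (s ^ n.+1)); last by rewrite leq_pexp2l.
  by rewrite expnS mulnC ltn_pmul2r ?expn_gt0.
have : kermx A != 0.
  apply/negP => /eqP k0; have := mxrank_ker A; rewrite k0 mxrank0 => /esym/eqP.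
  by rewrite subn_eq0 leqNgt (leq_ltn_trans (rank_leq_col A) cards).
case/rowV0Pn => c /sub_kermxP cA cn0.
pose mm (a : {ffun 'I_m -> 'I_s}) : 'X_{1..m} := [multinom (a i : nat) | i < m].
have mm_inj : injective mm.
  by move=> a a' /mnmP e; apply/ffunP => i; have := e i; rewrite !mnmE => /val_inj.
pose P : {mpoly F[m]} := \sum_a c 0 a *: 'X_[mm (enum_val a)].
have evP t : P.@[fun i => (G i).@[t]] = \sum_a c 0 a * mon (enum_val a) t.
  rewrite /P raddf_sum; apply: eq_bigr => a _; rewrite /= mevalZ mevalX; congr (_ * _).
  by apply: eq_bigr => i _; rewrite mnmE.
exists P => [|t].
  have [a ca] : exists a, c 0 a != 0.
    apply/existsP; rewrite -negb_forall; apply: contra cn0 => /forallP c0.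
    by apply/eqP/rowP => a; rewrite mxE; apply/eqP/c0.
  apply: contraNneq ca => P0; have := congr1 (mcoeff (mm (enum_val a))) P0.
  rewrite mcoeff0 raddf_sum (bigD1 a) //= mcoeffZ mcoeffX eqxx mulr1 big1 ?addr0 => [->//|a' a'a].
  rewrite mcoeffZ mcoeffX; case: eqP => [/mm_inj/enum_val_inj e|]; last by rewrite mulr0.
  by rewrite e eqxx in a'a.
apply: (@deg_le_grid _ B (fun t => P.@[fun i => (G i).@[t]])) => [t1 t2 e| |b].
- by apply: meval_eq => i; apply: meval_eq.
- move=> i t1; have [q sq eq] := deg_le_sum (index_enum _)
    (fun a => deg_leM (deg_leC 0 (c 0 a)) (mond (enum_val a))) i t1.
  by exists q => // x; rewrite evP eq.
- rewrite evP; have := congr1 (fun M : 'M_(_, _) => M 0 (enum_rank b)) cA.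
  rewrite !mxE => cA0; rewrite -[RHS]cA0; apply: eq_bigr => a _; rewrite mxE enum_rankK.
  by [].
Qed.

(** On each of the finitely many pieces more than [n] functions satisfy a nonzero relation; the
    product of these relations holds on all of [K]. *)
Lemma rank_ge_leq V (K : set V) n m (I : finType) (U : I -> vectType F) (phi : forall j, U j -> V) :
  (forall j, polymap (@phi j)) -> (forall j, \dim {:U j} <= n)%N ->
  (forall v, K v -> exists j u, v = @phi j u) ->
  rank_ge K m -> (m <= n)%N.
Proof.
move=> phiP dU cover [f fK]; rewrite leqNgt; apply/negP => nm.
have rel j : exists2 P : {mpoly F[m]}, P != 0 & forall u, P.@[fun i => evalp (f i) (@phi j u)] = 0.
  have /choice[G GE] : forall i, polyfun (fun u => evalp (f i) (@phi j u)).
    by move=> i; apply: polyfun_comp (phiP j); exists (f i).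
  have [P P0 PG] := mpoly_dependent G (leq_ltn_trans (dU j) nm).
  by exists P => // u; rewrite -[RHS](PG (coords u)); apply: meval_eq => i; rewrite GE.
have {rel}/choice[P PR] : forall j, exists P : {mpoly F[m]}, P != 0 /\
    forall u, P.@[fun i => evalp (f i) (@phi j u)] = 0.
  by move=> j; have [P] := rel j; exists P.
have : \prod_j P j == 0.
  apply/eqP/fK => v Kv; rewrite rmorph_prod /=; have [j [u ->]] := cover _ Kv.
  by rewrite (bigD1 j) //= (PR j).2 mul0r.
by rewrite prodf_seq_eq0 => /hasP[j _ /=]; rewrite (negPf (PR j).1).
Qed.

(** * Transcendence degree from tangent vectors *)

Lemma linear_lfun U V (f : U -> V) :
  (forall a x y, f (a *: x + y) = a *: f x + f y) -> exists D : 'Hom(U, V), D =1 f.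
Proof.
move=> fP; pose g : {linear U -> V} := HB.pack f (GRing.isLinear.Build _ _ _ _ f fP).
by exists (linfun g) => u; rewrite (lfunE g).
Qed.

(* The lowest homogeneous part of a relation would vanish on all tangent directions. *)
Lemma rank_ge_jets U V (K : set V) (w0 : V) (delta : U -> V) :
  (forall a x y, delta (a *: x + y) = a *: delta x + delta y) ->
  (forall u, delta u = 0 -> u = 0) ->
  (forall u, exists (h : {poly F}) (rho : F^o -> V),
     [/\ h != 0, polymap rho
       & forall s, h.[s] != 0 -> K (w0 + s *: delta u + s ^+ 2 *: rho s)]) ->
  rank_ge K (\dim {:U}).
Proof.
move=> dlin dinj curves.
have [D DE] := linear_lfun dlin; have kD : lker D == 0%VS.
  apply/lker0P => x y /eqP; rewrite -subr_eq0 -(linearB D) /= DE => /eqP/dinj/eqP.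
  by rewrite subr_eq0 => /eqP.
pose f (i : 'I_(\dim {:U})) w := coords ((D^-1)%VF (w - w0)) i.
have fP i : polyfun (f i).
  have := polyfunD (polyfun_linear (f := fun w => coords ((D^-1)%VF w) i)
     (fun a x y => _)) (polyfunC V (- coords ((D^-1)%VF w0) i)).
  move=> h; apply: polyfun_ext (h _) => [w|a x y]; rewrite /f /coords ?linearB //=.
  by rewrite !linearP.
apply: (rank_geP fP) => P PK; apply/eqP/negPn/negP => Pn0.
have exm : exists k, [exists m : 'X_{1..(\dim {:U}) < msize P}, (P@_m != 0) && (mdeg m == k)].
  have /eqP := Pn0; rewrite -[P]/(P) => /eqP; rewrite -msupp_eq0.
  case E : (msupp P) => [//|m ms] _; have mP : m \in msupp P by rewrite E mem_head.
  exists (mdeg m); apply/existsP; exists (BMultinom (msize_mdeg_lt mP)).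
  by rewrite /= -mcoeff_msupp mP eqxx.
pose k0 := ex_minn exm.
have [/existsP[m0 /andP[m0P /eqP dm0]] k0min] : [exists m : 'X_{1..(\dim {:U}) < msize P}, (P@_m != 0) && (mdeg m == k0)]
   /\ forall m, m \in msupp P -> (k0 <= mdeg m)%N.
  rewrite /k0; case: ex_minnP => k ek kmin; split=> // m mP; apply: kmin.
  apply/existsP; exists (BMultinom (msize_mdeg_lt mP)).
  by rewrite /= -mcoeff_msupp mP eqxx.
pose Q : {mpoly F[\dim {:U}]} := \sum_(m <- msupp P | mdeg m == k0) P@_m *: 'X_[m].
suff : Q = 0.
  move/(congr1 (mcoeff (m0 : 'X_{1.._}))); rewrite mcoeff0 /Q -big_filter raddf_sum /=.
  rewrite (big_rem (m0 : 'X_{1.._})) ?mem_filter ?dm0 ?eqxx ?mcoeff_msupp //=.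
  rewrite mcoeffZ mcoeffX eqxx mulr1 big_seq big1 ?addr0 => [/eqP|m]; first by rewrite (negPf m0P).
  rewrite (rem_filter _ (filter_uniq _ (msupp_uniq P))) mem_filter /= => /andP[mm0 _].
  by rewrite mcoeffZ mcoeffX (negPf mm0) mulr0.
apply: mpoly_eq0_fun => tau.
pose u := \sum_i tau i *: (vbasis {:U})`_i.
have cu i : coords u i = tau i.
  by rewrite /coords /u coord_sum_free //; apply: (basis_free (vbasisP _)).
have [h [rho [h0 rhoP curve]]] := curves u.
have /choice[r rE] : forall i, exists r : {poly F}, forall s, coords ((D^-1)%VF (rho s)) i = r.[s].
  move=> i; apply: polyfun_poly.
  apply: (polyfun_comp (f := fun w => coords ((D^-1)%VF w) i)) rhoP.
  by apply: polyfun_linear => a x y; rewrite linearP coords_is_linear.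
have fE i s : f i (w0 + s *: delta u + s ^+ 2 *: rho s) = s * (tau i + s * (r i).[s]).
  rewrite /f addrC !addrA addNr add0r linearD /= !linearZ /=.
  rewrite -DE lker0_lfunK //.
  by rewrite /coords linearD !linearZ /= -!/(coords _ _) cu rE; move: (tau i) (r i).[s] => c1 c2; ring.
pose z i := (tau i)%:P + 'X * r i.
(* The relation along the curve, divided by [s ^+ k0]; its value at 0 is the value of [Q] at
   [tau]. *)
pose T := \sum_(m <- msupp P) (P@_m)%:P * 'X ^+ (mdeg m - k0) * \prod_i z i ^+ m i.
have zE i s : (z i).[s] = tau i + s * (r i).[s] by rewrite /z !hornerE.
have T0 : T = 0.
  apply: (@poly_eq0_nz _ ('X * h)) => [|s]; first by rewrite mulf_neq0 ?polyX_eq0.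
  rewrite hornerM hornerX mulf_eq0 negb_or => /andP[s0 hs].
  apply/eqP; have sk : s ^+ k0 != 0 by rewrite expf_neq0.
  rewrite -(inj_eq (mulfI sk)) mulr0; apply/eqP.
  rewrite -(PK _ (curve s hs)) mevalE /T horner_sum mulr_sumr.
  rewrite big_seq [RHS]big_seq; apply: eq_bigr => m mP.
  rewrite !hornerM hornerC hornerXn horner_prod.
  have -> : \prod_i f i (w0 + s *: delta u + s ^+ 2 *: rho s) ^+ m i =
      s ^+ mdeg m * \prod_i (z i ^+ m i).[s].
    rewrite mdegE -prodrXr -big_split; apply: eq_bigr => i _ /=.
    by rewrite horner_exp fE zE exprMn.
  have -> : s ^+ mdeg m = s ^+ k0 * s ^+ (mdeg m - k0) by rewrite -exprD subnKC ?k0min.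
  move: (s ^+ k0) (s ^+ (mdeg m - k0)) (P@_m) (\prod_i _) => c1 c2 c3 c4.
  by ring.
have := congr1 (horner^~ 0) T0; rewrite horner0 => <-.
rewrite /T horner_sum /Q raddf_sum /= big_mkcond; apply: eq_big_seq => m mP.
rewrite !hornerM hornerC hornerXn horner_prod expr0n subn_eq0.
rewrite [(mdeg m <= k0)%N](_ : _ = (mdeg m == k0)); last by rewrite eqn_leq (k0min _ mP) andbT.
case: eqP => _; rewrite ?mulr1 ?mulr0 ?mul0r // mevalZ mevalX; congr (_ * _).
by apply: eq_bigr => i _; rewrite horner_exp zE mul0r addr0.
Qed.

End Rank.

(** * Cubic Jordan algebras *)

Lemma vec_ext (F : numFieldType) (V : vectType F) (x y : V) :
  (forall l : V -> F, (forall u v, l (u + v) = l u + l v) ->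
     (forall a u, l (a *: u) = a * l u) -> (forall u, l (- u) = - l u) -> l 0 = 0 ->
     l x = l y) -> x = y.
Proof.
move=> xy; apply: coords_inj => i; apply: (xy (fun v => coords v i)) => [u v|a u|u|].
- by rewrite /coords linearD.
- by rewrite /coords linearZ.
- by rewrite /coords linearN.
- by rewrite /coords linear0.
Qed.

(* Reduces an equation between linear combinations of vectors to one in the field. *)
Ltac vec :=
  let l := fresh "l" in let lD := fresh "lD" in let lZ := fresh "lZ" in
  let lN := fresh "lN" in let l0 := fresh "l0" in
  apply: vec_ext => l lD lZ lN l0; rewrite ?(lD, lZ, lN, l0).

(** Certificates by linear combination, here and in [eq_by_scaled] and [eq_byZ]: the constant [c] is
    the factor with which a known equation has to be added, and what remains is an identity for
    [ring] or [field]. *)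
Lemma eq_by (V : zmodType) (p q x y : V) : p = q -> x - y = p - q -> x = y.
Proof. by move=> -> /eqP; rewrite subrr subr_eq0 => /eqP. Qed.

Lemma eq_by_scaled (F : fieldType) (c p q x y : F) : p = q -> x - y = c * (p - q) -> x = y.
Proof. by move=> -> /eqP; rewrite subrr mulr0 subr_eq0 => /eqP. Qed.

Reserved Notation "x ** y" (at level 40, left associativity).

(** The interface hides the composition algebra, whose products are met only when Hermitian matrices
    are shown to satisfy it. [ca_dim] stands for the dimension a of the composition algebra, and
    [ca_dim_half] for the dimension of the Peirce 1/2-space of a diagonal idempotent. *)
Record cubicAlgebra (F : numClosedFieldType) := CubicAlgebra {
  ca_carrier :> vectType F;
  ca_mul : ca_carrier -> ca_carrier -> ca_carrier;
  ca_one : ca_carrier;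
  ca_tr : ca_carrier -> F;
  ca_frame : 'I_3 -> ca_carrier;
  ca_dim : nat;
  ca_mulC : commutative ca_mul;
  ca_mulP : forall a x y z, ca_mul (a *: x + y) z = a *: ca_mul x z + ca_mul y z;
  ca_mul1 : left_id ca_one ca_mul;
  ca_trP : forall a x y, ca_tr (a *: x + y) = a * ca_tr x + ca_tr y;
  ca_tr1 : ca_tr ca_one = 3%:R;
  ca_trA : forall x y z, ca_tr (ca_mul (ca_mul x y) z) = ca_tr (ca_mul x (ca_mul y z));
  ca_nondeg : forall x, (forall y, ca_tr (ca_mul x y) = 0) -> x = 0;
  (* The polarization of the characteristic equation
     x^3 - T(x) x^2 + S(x) x - N(x) = 0. *)
  ca_char : forall x y z, exists nu,
    ca_mul (ca_mul x y) z + ca_mul (ca_mul y z) x + ca_mul (ca_mul z x) y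
    - (ca_tr x *: ca_mul y z + ca_tr y *: ca_mul z x + ca_tr z *: ca_mul x y)
    + 2%:R^-1 *: ((ca_tr x * ca_tr y - ca_tr (ca_mul x y)) *: z
      + (ca_tr y * ca_tr z - ca_tr (ca_mul y z)) *: x
      + (ca_tr z * ca_tr x - ca_tr (ca_mul z x)) *: y) = nu *: ca_one;
  ca_frame_idem : forall i, ca_mul (ca_frame i) (ca_frame i) = ca_frame i;
  ca_frame_tr : forall i, ca_tr (ca_frame i) = 1;
  ca_frame_orth : forall i j, i != j -> ca_mul (ca_frame i) (ca_frame j) = 0;
  ca_frame_sum : \sum_i ca_frame i = ca_one;
  ca_dim_gt0 : (0 < ca_dim)%N;
  ca_dimE : \dim {:ca_carrier} = (3 * ca_dim + 3)%N;
  ca_dim_half : forall i (U : {vspace ca_carrier}),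
    (forall x, (x \in U) = (ca_mul (ca_frame i) x == 2%:R^-1 *: x)) ->
    \dim U = (2 * ca_dim)%N
}.

Section CubicBasics.
Variables (F : numClosedFieldType) (J : cubicAlgebra F).
Implicit Types (x y z : J) (a b c : F).
Local Notation "x ** y" := (ca_mul x y).
Local Notation T := (@ca_tr F J).
Local Notation "1j" := (ca_one J) (at level 0).

Lemma jmulDl x y z : (x + y) ** z = x ** z + y ** z.
Proof. by have := ca_mulP 1 x y z; rewrite !scale1r. Qed.
Lemma jmul0l z : 0 ** z = 0.
Proof. by have := ca_mulP (-1) 0 0 z; rewrite scaler0 addr0 scaleN1r addNr. Qed.
Lemma jmulZl a x z : (a *: x) ** z = a *: (x ** z).
Proof. by have := ca_mulP a x 0 z; rewrite jmul0l !addr0. Qed.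
Lemma jmulNl x z : (- x) ** z = - (x ** z).
Proof. by rewrite -scaleN1r jmulZl scaleN1r. Qed.
Lemma jmulDr x y z : z ** (x + y) = z ** x + z ** y.
Proof. by rewrite ca_mulC jmulDl !(ca_mulC z). Qed.
Lemma jmul0r z : z ** 0 = 0.
Proof. by rewrite ca_mulC jmul0l. Qed.
Lemma jmulZr a x z : z ** (a *: x) = a *: (z ** x).
Proof. by rewrite ca_mulC jmulZl (ca_mulC z). Qed.
Lemma jmulNr x z : z ** (- x) = - (z ** x).
Proof. by rewrite ca_mulC jmulNl (ca_mulC z). Qed.
Lemma jmulr1 x : x ** 1j = x.
Proof. by rewrite ca_mulC ca_mul1. Qed.

Lemma jtrD x y : T (x + y) = T x + T y.
Proof. by have := ca_trP 1 x y; rewrite scale1r mul1r. Qed.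
Lemma jtr0 : T 0 = 0.
Proof. by have := @ca_trP F J (-1) 0 0; rewrite scaler0 addr0 mulN1r addNr. Qed.
Lemma jtrZ a x : T (a *: x) = a * T x.
Proof. by have := ca_trP a x 0; rewrite jtr0 !addr0. Qed.
Lemma jtrN x : T (- x) = - T x.
Proof. by rewrite -scaleN1r jtrZ mulN1r. Qed.

Definition jmulE := (jmulDl, jmulDr, jmulZl, jmulZr, jmulNl, jmulNr, jmul0l, jmul0r,
  @ca_mul1 F J, jmulr1).
Definition jtrE := (jtrD, jtrZ, jtrN, jtr0, @ca_tr1 F J).

Lemma jtrC x y : T (x ** y) = T (y ** x).
Proof. by rewrite ca_mulC. Qed.

Lemma jtrCA x y z : T (x ** (y ** z)) = T (y ** (x ** z)).
Proof. by rewrite -!ca_trA (ca_mulC x). Qed.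

Lemma nondegW x : x != 0 -> exists y, T (x ** y) != 0.
Proof.
move=> x0; apply: contrapT => nx; move/eqP: x0; apply; apply: ca_nondeg => y.
by apply/eqP/negPn/negP => ?; apply: nx; exists y.
Qed.

Lemma n3 : (3%:R : F) != 0. Proof. by rewrite pnatr_eq0. Qed.
Lemma n2 : (2%:R : F) != 0. Proof. by rewrite pnatr_eq0. Qed.

(* The constant of the polarized characteristic equation is determined by the trace. *)
Lemma jchar x y z :
  (x ** y) ** z + (y ** z) ** x + (z ** x) ** y
    = (T x *: (y ** z) + T y *: (z ** x) + T z *: (x ** y))
    - 2%:R^-1 *: ((T x * T y - T (x ** y)) *: z
      + (T y * T z - T (y ** z)) *: x
      + (T z * T x - T (z ** x)) *: y)
    + (T (x ** (y ** z)) - 3%:R^-1 * (T x * T (y ** z) + T y * T (z ** x) + T z * T (x ** y))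
       + 6%:R^-1 * (3%:R * T x * T y * T z - T (x ** y) * T z - T (y ** z) * T x - T (z ** x) * T y))
      *: 1j.
Proof.
have [nu e] := ca_char x y z; have := congr1 T e; rewrite !jtrE.
have -> : T (z ** x ** y) = T (x ** (y ** z)) by rewrite ca_trA jtrCA (ca_mulC z).
rewrite (jtrC (y ** z)) ca_trA => enu.
have nuE : nu = 3%:R^-1 * (nu * 3%:R) by field.
by apply: (eq_by e); rewrite {}nuE -{}enu; vec; field.
Qed.

Lemma eq_byZ (V : lmodType F) c (p q x y : V) : p = q -> x - y = c *: (p - q) -> x = y.
Proof. by move=> -> /eqP; rewrite subrr scaler0 subr_eq0 => /eqP. Qed.

Definition rank1 x := x ** x = T x *: x.
Definition idem1 x := x ** x = x /\ T x = 1.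

Lemma idem1_rank1 e : idem1 e -> rank1 e.
Proof. by case=> ee te; rewrite /rank1 ee te scale1r. Qed.

(** The characteristic equation polarized at [x], [x], [y]. For an idempotent of trace 1 it says
    that multiplication has eigenvalues 0 and 1/2 modulo the idempotent, on which it is 1. *)
Lemma rank1_mul x y : rank1 x ->
  x ** (x ** y) = 2%:R^-1 *: (T x *: (x ** y) + T (x ** y) *: x).
Proof.
move=> rx; have := jchar x x y.
rewrite -(ca_trA x x y) rx !(ca_mulC y x) !(ca_mulC (x ** y) x) !jmulE !jtrE => e.
by apply: (eq_byZ (c := 2%:R^-1) e); vec; field.
Qed.

(** The characteristic equation polarized at [x], [y] and [x ** y], with all other products
    evaluated by [rank1_mul]. *)
Lemma rank1_mul2 x y : rank1 x -> rank1 y ->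
  (x ** y) ** (x ** y)
    = 4%:R^-1 *: (T (x ** y) *: (2%:R *: (x ** y) + T y *: x + T x *: y)).
Proof.
move=> rx ry; set t := T (x ** y).
have tx : T (x ** (x ** y)) = T x * t by rewrite -ca_trA rx jmulE jtrE.
have ty : T (y ** (x ** y)) = T y * t by rewrite (ca_mulC x) -ca_trA ry jmulE jtrE jtrC.
have xxy := rank1_mul y rx; rewrite -/t in xxy.
have yxy : y ** (x ** y) = 2%:R^-1 *: (T y *: (x ** y) + t *: y).
  by rewrite (ca_mulC x) rank1_mul // jtrC.
have t2 : T ((x ** y) ** (x ** y)) = 2%:R^-1 * (T x * (T y * t) + t * t).
  by rewrite ca_trA yxy !jmulE !jtrE xxy !jtrE -/t; field.
have e1 : y ** (x ** y) ** x
    = 2%:R^-1 *: (T y *: (2%:R^-1 *: (T x *: (x ** y) + t *: x)) + t *: (x ** y)).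
  by rewrite yxy ca_mulC !jmulE xxy.
have e2 : x ** y ** x ** y
    = 2%:R^-1 *: (T x *: (2%:R^-1 *: (T y *: (x ** y) + t *: y)) + t *: (x ** y)).
  by rewrite (ca_mulC _ x) xxy (ca_mulC _ y) !jmulE yxy (ca_mulC y x).
have := jchar x y (x ** y).
rewrite e1 e2 -(ca_trA x y) t2 ty (jtrC (x ** y) x) tx (ca_mulC _ x) xxy yxy -/t => e.
by apply: (eq_byZ (c := 1) e); vec; field.
Qed.

End CubicBasics.

(** * The Peirce decomposition of an idempotent of trace one *)

Section Peirce.
Variables (F : numClosedFieldType) (J : cubicAlgebra F).
Implicit Types (x y z e : J) (a b c : F).
Local Notation "x ** y" := (ca_mul x y).
Local Notation T := (@ca_tr F J).
Local Notation "1j" := (ca_one J) (at level 0).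

Variable e : J.
Hypothesis ide : idem1 e.

Let ee : e ** e = e. Proof. by case: ide. Qed.
Let te : T e = 1. Proof. by case: ide. Qed.

Lemma idem_mul y : e ** (e ** y) = 2%:R^-1 *: (e ** y + T (e ** y) *: e).
Proof. by rewrite rank1_mul ?te ?scale1r //; exact: idem1_rank1. Qed.

Definition half z := e ** z = 2%:R^-1 *: z.
Definition null z := e ** z = 0.

(** The Peirce projections as polynomials in the multiplication by [e]. The component for the
    eigenvalue 1 is the multiple [T (e ** y)] of [e]. *)
Definition half_part y : J := 2%:R *: (e ** y - T (e ** y) *: e).
Definition null_part y : J := y - 2%:R *: (e ** y) + T (e ** y) *: e.

Lemma peirce y : y = T (e ** y) *: e + half_part y + null_part y.
Proof. by rewrite /half_part /null_part; vec; ring. Qed.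

Lemma half_partP y : half (half_part y).
Proof. by rewrite /half /half_part !jmulE idem_mul ee; vec; field. Qed.

Lemma null_partP y : null (null_part y).
Proof. by rewrite /null /null_part !jmulE idem_mul ee; vec; field. Qed.

Lemma half_mulC z : half z -> z ** e = 2%:R^-1 *: z.
Proof. by rewrite ca_mulC. Qed.

Lemma null_mulC z : null z -> z ** e = 0.
Proof. by rewrite ca_mulC. Qed.

Lemma tr_e_half z : half z -> T (e ** z) = 0.
Proof.
move=> hz; have := idem_mul z; rewrite hz !jmulE hz => E.
have : T (2%:R^-1 *: (2%:R^-1 *: z)) = T (2%:R^-1 *: (2%:R^-1 *: z + T (2%:R^-1 *: z) *: e)).
  by rewrite -E.
by rewrite !jtrE te => E'; apply: (eq_by_scaled (c := - 2%:R) E'); field.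
Qed.

Lemma tr_half z : half z -> T z = 0.
Proof.
move=> hz; have := tr_e_half hz; rewrite hz jtrE => E.
by apply: (eq_by_scaled (c := 2%:R) E); field.
Qed.

Lemma halfD x y : half x -> half y -> half (x + y).
Proof. by rewrite /half => hx hy; rewrite jmulE hx hy scalerDr. Qed.
Lemma halfZ a x : half x -> half (a *: x).
Proof. by rewrite /half => hx; rewrite jmulE hx !scalerA mulrC. Qed.
Lemma nullD x y : null x -> null y -> null (x + y).
Proof. by rewrite /null => hx hy; rewrite jmulE hx hy addr0. Qed.
Lemma nullZ a x : null x -> null (a *: x).
Proof. by rewrite /null => hx; rewrite jmulE hx scaler0. Qed.

Lemma unit_part y : e ** y = y -> y = T y *: e.
Proof.
move=> ey; have := idem_mul y; rewrite !ey => E.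
by apply: (eq_byZ (c := 2%:R) E); vec; field.
Qed.

(** The characteristic equation at [e], [y], [z] determines the product up to its image under [e],
    and multiplying that equation by [e] shows that this image vanishes. The Peirce 0-space is thus
    the Jordan algebra of a quadratic form, with unit [1j - e]. *)
Lemma null_mul_aux y z : null y -> null z ->
  null (y ** z) /\ y ** z = 2%:R^-1 *: (T y *: z + T z *: y
      - (T y * T z - T (y ** z)) *: (1j - e)).
Proof.
move=> ny nz; have tyz : T (e ** (y ** z)) = 0 by rewrite -ca_trA ny jmulE jtrE.
have := jchar e y z; rewrite ny (null_mulC nz) tyz !jmulE !jtrE te (ca_mulC _ e) => E.
have eyz : e ** (y ** z) = 0.
  have := congr1 (ca_mul e) E; rewrite !jmulE idem_mul tyz ny nz ee => E2.
  by apply: (eq_byZ (c := - 2%:R) E2); vec; field.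
by split=> //; move: E; rewrite eyz => E; apply: (eq_byZ (c := -1) E); vec; field.
Qed.

Lemma null_mul y z : null y -> null z -> null (y ** z).
Proof. by move=> ny nz; case: (null_mul_aux ny nz). Qed.

Lemma null_mulE y z : null y -> null z ->
  y ** z = 2%:R^-1 *: (T y *: z + T z *: y - (T y * T z - T (y ** z)) *: (1j - e)).
Proof. by move=> ny nz; case: (null_mul_aux ny nz). Qed.

Lemma tr_null_half y z : null y -> half z -> T (y ** z) = 0.
Proof.
move=> ny hz; have := ca_trA e y z; rewrite ny jmulE jtrE jtrCA hz jmulE jtrE => /esym/eqP.
by rewrite mulf_eq0 invr_eq0 (negPf (n2 F)) => /eqP.
Qed.

Lemma null_half_mul y z : null y -> half z -> half (y ** z).
Proof.
move=> ny hz; have tyz := tr_null_half ny hz; have := jchar e y z.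
rewrite ny (half_mulC hz) !jmulE !jtrE te tyz (tr_half hz) (ca_mulC _ e) (ca_mulC z y).
have -> : T (e ** (y ** z)) = 0 by rewrite -ca_trA ny jmulE jtrE.
by move=> E; apply: (eq_byZ (c := 1) E); vec; field.
Qed.

Lemma half_mulE y z : half y -> half z -> e ** (y ** z) = (2%:R^-1 * T (y ** z)) *: e.
Proof.
move=> hy hz; have := jchar e y z.
rewrite hy (half_mulC hz) !jmulE !jtrE te (tr_half hz) (tr_half hy) (ca_mulC _ e) (ca_mulC z y).
rewrite -(ca_trA e) hy !jmulE !jtrE => E.
by apply: (eq_byZ (c := 1) E); vec; field.
Qed.

Lemma null_unit : null (1j - e).
Proof. by rewrite /null !jmulE ee subrr. Qed.

(** The characteristic equation at [y], [y'], [z]. Traceless elements of the Peirce 0-space act on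
    the Peirce 1/2-space as generators of a Clifford algebra. *)
Lemma clifford y y' z : null y -> null y' -> T y = 0 -> T y' = 0 -> half z ->
  y ** (y' ** z) + y' ** (y ** z) = (4%:R^-1 * T (y ** y')) *: z.
Proof.
move=> ny ny' ty ty' hz; have := jchar y y' z.
rewrite {1}(null_mulE ny ny') !jmulE hz !(ca_mulC z) !(ca_mulC _ y) !(ca_mulC _ y') ty ty'.
rewrite (tr_half hz) (tr_null_half ny' hz) (tr_null_half ny hz).
rewrite (tr_null_half ny (null_half_mul ny' hz)) (ca_mulC y' y) => E.
by apply: (eq_byZ (c := 1) E); vec; field.
Qed.

Lemma clifford_sq y z : null y -> T y = 0 -> half z ->
  y ** (y ** z) = (8%:R^-1 * T (y ** y)) *: z.
Proof.
move=> ny ty hz; have E := clifford ny ny ty ty hz.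
by apply: (eq_byZ (c := 2%:R^-1) E); vec; field.
Qed.

(** The map that is -1 on the Peirce 1/2-space and the identity on [e] and on the Peirce 0-space. *)
Definition reflection y : J := y - 4%:R *: (e ** y) + (4%:R * T (e ** y)) *: e.

Lemma reflection_linear a x y :
  reflection (a *: x + y) = a *: reflection x + reflection y.
Proof. by rewrite /reflection !jmulE !jtrE; vec; ring. Qed.

Lemma reflection_half z : half z -> reflection z = - z.
Proof. by move=> hz; rewrite /reflection (tr_e_half hz) hz; vec; field. Qed.

Lemma reflection_null z : null z -> reflection z = z.
Proof. by rewrite /reflection /null => ->; rewrite jtrE; vec; field. Qed.

Lemma reflection_e : reflection e = e.
Proof. by rewrite /reflection ee te; vec; field. Qed.

Lemma reflectionD x y : reflection (x + y) = reflection x + reflection y.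
Proof. by have := reflection_linear 1 x y; rewrite !scale1r. Qed.

Lemma reflectionZ a x : reflection (a *: x) = a *: reflection x.
Proof. by rewrite /reflection !jmulE !jtrE; vec; ring. Qed.

Lemma reflectionE y : reflection y = T (e ** y) *: e - half_part y + null_part y.
Proof. by rewrite /reflection /half_part /null_part; vec; ring. Qed.

Lemma reflectionK : involutive reflection.
Proof.
move=> y; rewrite [reflection y]reflectionE [RHS]peirce.
move: (half_partP y) (null_partP y).
move: (T (e ** y)) (half_part y) (null_part y) => a h n hh nn; rewrite -scaleN1r !reflectionD !reflectionZ reflection_e.
by rewrite (reflection_null nn) (reflection_half hh); vec; ring.
Qed.

Lemma reflection_half_half x y : half x -> half y -> reflection (x ** y) = x ** y.
Proof.
by move=> hx hy; rewrite /reflection half_mulE // !jtrE te; vec; field.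
Qed.

(** The Peirce multiplication rules are graded by Z/2, with the 1/2-space as the odd part. *)
Lemma reflectionM x y : reflection (x ** y) = reflection x ** reflection y.
Proof.
rewrite (reflectionE x) (reflectionE y) {1}(peirce x) {1}(peirce y).
move: (half_partP x) (null_partP x) (half_partP y) (null_partP y).
move: (T (e ** x)) (half_part x) (null_part x) (T (e ** y)) (half_part y) (null_part y).
move=> a h n b h' n' hh nn hh' nn'; rewrite -!scaleN1r.
rewrite !jmulE ee hh' nn' (half_mulC hh) (null_mulC nn) !(reflectionD, reflectionZ) reflection_e.
rewrite (reflection_half_half hh hh') (reflection_half hh) (reflection_half hh').
rewrite (reflection_null (null_mul nn nn')) (reflection_half (null_half_mul nn hh')).
rewrite (ca_mulC h n') (reflection_half (null_half_mul nn' hh)).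
have -> : reflection 0 = 0 by rewrite /reflection !jmulE !jtrE; vec; ring.
by vec; ring.
Qed.

(** The rank one element near [e] with coefficient 1 on [e] and component [x] in the 1/2-space; its
    last component has to be the null component of the square of [x]. *)
Definition chart x : J := e + x + x ** x - (2%:R^-1 * T (x ** x)) *: e.

Lemma tr_chart x : half x -> T (chart x) = 1 + 2%:R^-1 * T (x ** x).
Proof. by move=> hx; rewrite /chart !jtrE te (tr_half hx); field. Qed.

(** With [x0] the null component of the square, the characteristic equation at [x], [x], [x] makes
    [x0 ** x] a multiple of [x]. This gives the trace of the square of [x0], and then that square
    itself because [x0] is null. *)
Lemma chart_rank1 x : half x -> rank1 (chart x).
Proof.
move=> hx; rewrite /rank1 tr_chart //; set q := T (x ** x).
pose x0 := x ** x - (2%:R^-1 * q) *: e.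
have n0 : null x0 by rewrite /null /x0 !jmulE half_mulE // ee -/q; vec; ring.
have t0 : T x0 = 2%:R^-1 * q by rewrite /x0 !jtrE te -/q; field.
have xx : x ** x = x0 + (2%:R^-1 * q) *: e by rewrite /x0; vec; ring.
have qE : T (x ** x) = q by [].
clearbody x0 q.
have h0 : half (x0 ** x) by apply: null_half_mul.
have x0x : x0 ** x = (4%:R^-1 * q) *: x.
  have := jchar x x x; rewrite qE xx !jmulE hx (half_mulC hx) (tr_half hx).
  rewrite (ca_mulC x x0) !jtrE (tr_half hx) (tr_half h0) => E.
  by apply: (eq_byZ (c := 3%:R^-1) E); vec; field.
have s0 : T (x0 ** x0) = 4%:R^-1 * q * q.
  have := congr1 (fun w => T (w ** x)) x0x; rewrite ca_trA xx !jmulE !jtrE (null_mulC n0) !jtrE ?qE => E.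
  by apply: (eq_by_scaled (c := 1) E); field.
have x00 : x0 ** x0 = (2%:R^-1 * q) *: x0.
  by rewrite (null_mulE n0 n0) s0 t0; vec; field.
have -> : chart x = e + x + x0 by rewrite /chart qE xx; vec; ring.
rewrite !jmulE ee hx n0 (half_mulC hx) (null_mulC n0) xx (ca_mulC x x0) x0x x00.
by vec; field.
Qed.

End Peirce.

(** * Automorphisms, derivations and dimensions *)

Definition kerv (F : numFieldType) (U V : vectType F) (f : U -> V) : {vspace U} :=
  lker (linfun f).

Lemma memv_kerv (F : numFieldType) (U V : vectType F) (f : U -> V) x :
  (forall a x y, f (a *: x + y) = a *: f x + f y) -> (x \in kerv f) = (f x == 0).
Proof.
move=> fP; pose g : {linear U -> V} := HB.pack f (GRing.isLinear.Build _ _ _ _ f fP).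
by rewrite memv_ker -[f x]/(g x) -[in RHS](lfunE g).
Qed.

Lemma dim_cap_functional (F : numFieldType) (U : vectType F) (A B : {vspace U}) (f : U -> F) :
  (forall a x y, f (a *: x + y) = a * f x + f y) ->
  (forall x, x \in B = (x \in A) && (f x == 0)) ->
  (exists2 x, x \in A & f x != 0) -> \dim A = (\dim B).+1.
Proof.
move=> fP BE [x0 x0A fx0]; have [D DE] := @linear_lfun _ _ F^o f fP.
have -> : B = (A :&: lker D)%VS by apply/vspaceP => x; rewrite BE memv_cap memv_ker DE.
rewrite -(limg_ker_dim D A) -addn1; congr (_ + _)%N; apply/eqP; rewrite eqn_leq.
have -> /= : (\dim (D @: A) <= 1)%N by apply: leq_trans (dimvS (subvf _)) _; rewrite dimvf.
rewrite lt0n dimv_eq0; apply: contra fx0 => /eqP D0.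
by have := memv_img D x0A; rewrite D0 memv0 DE.
Qed.

Lemma ord3_cases (i : 'I_3) : i = 0 \/ i = 1 \/ i = -1.
Proof. by case: i => -[|[|[|//]]] hi; [left|right; left|right; right]; apply/val_inj. Qed.

Section Automorphisms.
Variables (F : numClosedFieldType) (J : cubicAlgebra F).
Implicit Types (x y z e : J) (a b c : F) (g D : 'End(J)).
Local Notation "x ** y" := (ca_mul x y).
Local Notation T := (@ca_tr F J).
Local Notation E := (ca_frame J).
Local Notation "1j" := (ca_one J) (at level 0).

Definition automorph g := lker g = 0%VS /\ forall x y, g (x ** y) = g x ** g y.
Definition derivative D := forall x y, D (x ** y) = D x ** y + x ** D y.

Lemma frame_idem1 i : idem1 (E i).
Proof. by split; [apply: ca_frame_idem|apply: ca_frame_tr]. Qed.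

Lemma frame_null i j : i != j -> null (E i) (E j).
Proof. exact: ca_frame_orth. Qed.

Lemma frame_sum3 : E 0 + E 1 + E (-1) = 1j.
Proof.
rewrite -ca_frame_sum !big_ord_recl big_ord0 addr0 addrA; congr (E _ + E _ + E _); exact/val_inj.
Qed.

(** The Peirce decompositions for two frame elements in succession show that the frame and its
    1/2-spaces span the algebra. *)
Lemma frame_ind (P : J -> Prop) :
  (forall a x y, P x -> P y -> P (a *: x + y)) -> (forall i, P (E i)) ->
  (forall i z, half (E i) z -> P z) -> forall x, P x.
Proof.
move=> Plin PE Ph x.
have PD y z : P y -> P z -> P (y + z) by move=> Py Pz; rewrite -[y]scale1r; apply: Plin.
have P0 : P 0 by apply: (Ph 0); rewrite /half jmulE scaler0.
have PZ a y : P y -> P (a *: y) by move=> Py; rewrite -[_ *: _]addr0; apply: Plin.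
rewrite (peirce (E 0) x); apply: (PD); first apply: (PD).
- exact/PZ/PE.
- exact/(Ph 0)/half_partP/frame_idem1.
have := null_partP (frame_idem1 0) x; move: (null_part _ x) => n nn.
rewrite (peirce (E 1) n); apply: (PD); first apply: (PD).
- exact/PZ/PE.
- exact/(Ph 1)/half_partP/frame_idem1.
have n1 := null_partP (frame_idem1 1) n.
have n0 : null (E 0) (null_part (E 1) n).
  rewrite /null_part; apply: nullD; last by apply: nullZ; apply: frame_null.
  apply: nullD => //; rewrite -scaleNr; apply: nullZ.
  by apply: null_mul; [apply: frame_idem1|apply: frame_null|].
move: n0 n1; move: (null_part _ n) => m n0 n1.
(* In ['I_3] the index -1 is the third one; its idempotent fixes whatever the other two annihilate,
   because the three sum to the unit. *)
have /(unit_part (frame_idem1 (-1))) -> : E (-1) ** m = m.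
  have -> : E (-1) = 1j - E 0 - E 1 by rewrite -frame_sum3; vec; ring.
  by rewrite !jmulE n0 n1; vec; ring.
exact/PZ/PE.
Qed.

Lemma tr_idem x : x ** x = x -> [\/ x = 0, x = 1j, T x = 1 | T x = 2%:R].
Proof.
move=> xx; have := jchar x x x; rewrite !xx; set t := T x => H.
(* This is 3/2 (t - 1)(t - 2): the characteristic equation of an idempotent makes [k *: x] a scalar,
   so either [x] is scalar or its trace is 1 or 2. *)
pose k := 3%:R - 3%:R * t + (3%:R / 2%:R) * (t * t - t).
have [nu e] : exists nu, k *: x = nu *: 1j.
  exists (t - 3%:R^-1 * (t * t + t * t + t * t)
    + 6%:R^-1 * (3%:R * t * t * t - t * t - t * t - t * t)).
  by apply: (eq_byZ (c := 1) H); rewrite /k; vec; field.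
have [k0|k0] := eqVneq k 0.
  have : (t - 1) * (t - 2%:R) = 0.
    by apply: (eq_by_scaled (c := 2%:R / 3%:R) k0); rewrite /k; field.
  by move/eqP; rewrite mulf_eq0 !subr_eq0 => /orP[] /eqP; [constructor 3|constructor 4].
pose mu := k^-1 * nu.
have xE : x = mu *: 1j by rewrite -scalerA -e scalerA mulVf // scale1r.
have : mu *: 1j = (mu * mu) *: 1j by rewrite -xE -{1}xx xE !jmulE scalerA.
move/(congr1 T); rewrite !jtrE => E3.
have : mu * (mu - 1) = 0 by apply: (eq_by_scaled (c := - 3%:R^-1) E3); field.
move/eqP; rewrite mulf_eq0 subr_eq0 => /orP[] /eqP m.
  by constructor 1; rewrite xE m scale0r.
by constructor 2; rewrite xE m scale1r.
Qed.

Section Automorphism.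
Variable g : 'End(J).
Hypothesis ag : automorph g.

Lemma aut_inj : injective g.
Proof. by apply/lker0P; rewrite ag.1. Qed.

Lemma autM x y : g (x ** y) = g x ** g y.
Proof. by rewrite ag.2. Qed.

Lemma aut_surj y : exists x, y = g x.
Proof. by exists (g^-1%VF y); rewrite lker0_lfunVK // ag.1. Qed.

Lemma aut1 : g 1j = 1j.
Proof. by have [x e] := aut_surj 1j; rewrite -[RHS]ca_mul1 {2}e -(jmulr1 (g _)) {2}e -autM ca_mul1 -e jmulr1. Qed.

Lemma aut_tr_idem x : x ** x = x -> x != 0 -> x != 1j -> T (g x) = 1 \/ T (g x) = 2%:R.
Proof.
move=> xx /eqP x0 /eqP x1; have gg : g x ** g x = g x by rewrite -autM xx.
have [/eqP|e|->|->] := tr_idem gg; auto.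
  by rewrite -(linear0 g) (inj_eq aut_inj) => /eqP.
by case: x1; apply: aut_inj; rewrite aut1.
Qed.

(** The three images are idempotents other than 0 and the unit, so their traces are 1 or 2; as the
    traces add up to 3, each is 1. *)
Lemma aut_frame i : T (g (E i)) = 1.
Proof.
have E0 j : E j != 0.
  by apply/eqP => e; have := ca_frame_tr J j; rewrite e jtr0 => /eqP; rewrite eq_sym oner_eq0.
have E1 j : E j != 1j.
  apply/eqP => e; have := ca_frame_tr J j; rewrite e ca_tr1 => /eqP.
  by rewrite -subr_eq0 -(natrB _ (isT : (1 <= 3)%N)) pnatr_eq0.
have t j : exists2 k : nat, (1 <= k <= 2)%N & T (g (E j)) = k%:R.
  have [->|->] := aut_tr_idem (ca_frame_idem J j) (E0 j) (E1 j); first by exists 1%N.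
  by exists 2%N.
have /choice[k kE] : forall j, exists k : nat, (1 <= k <= 2)%N /\ T (g (E j)) = k%:R.
  by move=> j; have [k] := t j; exists k.
have : T (g 1j) = 3%:R by rewrite aut1 ca_tr1.
rewrite -frame_sum3 !linearD /= !jtrD !(fun j => (kE j).2) -!natrD => /eqP.
rewrite eqr_nat => /eqP s.
have -> : k i = 1%N => //.
have := (kE 0).1; have := (kE 1).1; have := (kE (-1)).1.
have [->|[->|->]] := ord3_cases i; lia.
Qed.

Lemma aut_half e z : half e z -> half (g e) (g z).
Proof. by rewrite /half -autM => ->; rewrite linearZ. Qed.

Lemma aut_null e z : null e z -> null (g e) (g z).
Proof. by rewrite /null -autM => ->; rewrite linear0. Qed.

(** An automorphism is only assumed multiplicative, so invariance of the trace is derived on the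
    spanning set: frame elements keep trace 1, and elements of a 1/2-space keep trace 0. *)
Lemma aut_tr x : T (g x) = T x.
Proof.
elim/frame_ind: x => [a x y ex ey|i|i z hz].
- by rewrite linearP /= !jtrE ex ey.
- by rewrite aut_frame ca_frame_tr.
rewrite (tr_half (frame_idem1 i) hz) (@tr_half _ _ (g (E i))) //.
  by split; [rewrite -autM ca_frame_idem|apply: aut_frame].
exact: aut_half.
Qed.

Lemma aut_idem1 e : idem1 e -> idem1 (g e).
Proof. by case=> ee te; split; rewrite ?aut_tr // -autM ee. Qed.

End Automorphism.

Lemma aut_reflection e : idem1 e -> exists2 g, automorph g & g =1 reflection e.
Proof.
move=> ie; have [g gE] := linear_lfun (reflection_linear e); exists g => //; split.
  apply/eqP/lker0P => x y; rewrite !gE => /(congr1 (reflection e)).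
  by rewrite !reflectionK.
by move=> x y; rewrite !gE reflectionM.
Qed.

Lemma aut_comp g g' : automorph g -> automorph g' -> automorph (g \o g')%VF.
Proof.
move=> ag ag'; split=> [|x y]; last by rewrite !comp_lfunE !autM.
by apply/eqP/lker0P => x y; rewrite !comp_lfunE => /(aut_inj ag) /(aut_inj ag').
Qed.

(** A derivation sends a frame idempotent into its 1/2-space, where the trace is 0. For [z] in a
    1/2-space, differentiating [hz] and comparing with [idem_mul] gives two linear equations which
    force the trace of [D z] to vanish. *)
Lemma derivative_tr D x : derivative D -> T (D x) = 0.
Proof.
move=> dD; elim/frame_ind: x => [a x y ex ey|i|i z hz].
- by rewrite linearP /= !jtrE ex ey mulr0 addr0.
- apply: (tr_half (frame_idem1 i)); have := dD (E i) (E i).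
  rewrite ca_frame_idem (ca_mulC _ (E i)) => e.
  by rewrite /half {2}e; vec; field.
have iE := frame_idem1 i; have := dD (E i) z; rewrite hz linearZ /=.
have hD : half (E i) (D (E i)).
  by have := dD (E i) (E i); rewrite ca_frame_idem (ca_mulC _ (E i)) /half => {2}->; vec; field.
set y := D z; set w := D (E i) ** z => e.
have ew : E i ** w = (2%:R^-1 * T w) *: E i by apply: half_mulE.
have ey : E i ** y = 2%:R^-1 *: y - w by rewrite e; vec; ring.
have := etrans (congr1 (ca_mul (E i)) (esym ey)) (idem_mul iE y).
rewrite !jmulE ew => /(congr1 T); rewrite !jtrE ca_frame_tr => e2.
have := congr1 T ey; rewrite !jtrE => e3.
have e4 : T (E i ** y) = - T w by apply: (eq_by_scaled (c := - 2%:R) e2); field.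
by rewrite e4 in e3; apply: (eq_by_scaled (c := - 2%:R) e3); field.
Qed.

(* g is the reflection in the midpoint of e and f. *)
Lemma aut_midpoint e f : idem1 e -> idem1 f -> T (e ** f) != 0 ->
  exists2 g, automorph g & g e = f.
Proof.
move=> ie i_f; set t := T (e ** f) => t0.
(* One of the two square roots of [t] differs from -1. *)
have [c [c2 c1]] : exists c : F, c ^+ 2 = t /\ 1 + c != 0.
  have [h|h] := eqVneq (1 + sqrtC t) 0; last by exists (sqrtC t); rewrite sqrtCK.
  exists (- sqrtC t); rewrite sqrrN sqrtCK; split=> //.
  have -> : sqrtC t = -1 by apply: (eq_by h); ring.
  by rewrite opprK -[1 + 1](natrD _ 1 1) pnatr_eq0.
have c0 : c != 0 by apply: contraNneq t0 => c0; rewrite -c2 c0 expr0n.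
have [ee te] := ie; have [ff tf] := i_f.
have eef : e ** (e ** f) = 2%:R^-1 *: (e ** f + t *: e) by rewrite idem_mul.
have fef : f ** (e ** f) = 2%:R^-1 *: (e ** f + t *: f).
  by rewrite (ca_mulC e) idem_mul // (ca_mulC f) -/t.
have ef2 := rank1_mul2 (idem1_rank1 ie) (idem1_rank1 i_f); rewrite te tf -/t in ef2.
(* For matrices e = u u^t and f = v v^t with u.v = c, this is the projector on u + v: the mixed
   terms are 2/c times the Jordan product, and the norm of u + v is 2(1 + c). *)
pose h := (2%:R * (1 + c))^-1 *: (e + f + (2%:R / c) *: (e ** f)).
have te2 : T (e ** (e ** f)) = t by rewrite eef !jtrE te -/t; field.
have n22 : (2%:R * (1 + c)) != 0 by rewrite mulf_neq0 // pnatr_eq0.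
have ih : idem1 h.
  rewrite /h; split; last by rewrite !jtrE te tf -/t -c2; field; rewrite c0 c1.
  rewrite !jmulE ee ff (ca_mulC f e) (ca_mulC (e ** f) e) (ca_mulC (e ** f) f) eef fef ef2 -c2.
  by vec; field; rewrite c0 c1.
have [g ag gE] := aut_reflection ih; exists g => //; rewrite gE /reflection /h.
rewrite !jmulE ee (ca_mulC f e) (ca_mulC (e ** f) e) eef !jtrE te -/t -c2.
by vec; field; rewrite c0 c1.
Qed.

(** The frame sums to the unit and [e] has trace 1, so [e] pairs nontrivially with some frame
    element. Dimensions known for the frame thereby pass to every idempotent of trace 1. *)
Lemma aut_to_frame e : idem1 e -> exists i g, automorph g /\ g e = E i.
Proof.
move=> ie; have [i ti] : exists i, T (e ** E i) != 0.
  apply: contrapT => /forallNP no; have := jmulr1 e; rewrite -ca_frame_sum => e1.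
  have /eqP : T e = 0.
    rewrite -e1 !big_ord_recl big_ord0 !jmulE !jtrE.
    have z i : T (e ** E i) = 0 by apply/eqP/negPn/negP/no.
    by rewrite !z !addr0.
  by rewrite ie.2 oner_eq0.
by have [g ag ge] := aut_midpoint ie (frame_idem1 i) ti; exists i, g.
Qed.

Definition half_space e : {vspace J} := kerv (fun x => e ** x - 2%:R^-1 *: x).
Definition null_space e : {vspace J} := kerv (fun x => e ** x).
Definition null0_space e : {vspace J} := kerv (fun x => (e ** x, T x : F^o) : (J * F^o)%type).

Lemma memv_half e x : reflect (half e x) (x \in half_space e).
Proof.
rewrite memv_kerv; last by move=> a y z; rewrite !jmulE; vec; ring.
by rewrite subr_eq0; apply: eqP.
Qed.

Lemma memv_null e x : reflect (null e x) (x \in null_space e).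
Proof. by rewrite memv_kerv; [apply: eqP|move=> a y z; rewrite !jmulE]. Qed.

Definition null0 e x := null e x /\ T x = 0.

Lemma memv_null0 e x : reflect (null0 e x) (x \in null0_space e).
Proof.
rewrite memv_kerv; last by move=> a y z; rewrite !jmulE !jtrE.
by rewrite xpair_eqE; apply: (iffP andP) => -[/eqP ? /eqP ?].
Qed.

Lemma dim_half e : idem1 e -> \dim (half_space e) = (2 * ca_dim J)%N.
Proof.
move=> ie; have [i [g [ag ge]]] := aut_to_frame ie.
rewrite -(ca_dim_half (i := i) (U := (g @: half_space e)%VS)).
  by rewrite limg_dim_eq // ag.1 capv0.
move=> x; apply/idP/idP => [/memv_imgP[y /memv_half hy ->]|/eqP hx].
  by apply/eqP; rewrite -/(half _ _) -ge; apply: aut_half.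
have [y xy] := aut_surj ag x; rewrite xy memv_img //; apply/memv_half.
by apply: (aut_inj ag); rewrite autM // ge -xy hx linearZ /= xy.
Qed.

Lemma dim_null e : idem1 e -> \dim (null_space e) = (ca_dim J).+2.
Proof.
move=> ie; have [ee te] := ie.
have e0 : e != 0 by apply/eqP => e0; move: te; rewrite e0 jtr0 => /eqP; rewrite eq_sym oner_eq0.
have full : (<[e]> + half_space e + null_space e)%VS = fullv.
  apply/eqP; rewrite eqEsubv subvf; apply/subvP => x _; rewrite (peirce e x).
  apply: memv_add; first apply: memv_add.
  - by rewrite memvZ ?memv_line.
  - by apply/memv_half; apply: half_partP.
  - by apply/memv_null; apply: null_partP.
have d1 : (<[e]> :&: half_space e)%VS = 0%VS.
  apply/eqP; rewrite -subv0; apply/subvP => x; rewrite memv_cap => /andP[/vlineP[k ->] /memv_half hk].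
  by have := tr_half ie hk; rewrite jtrE te mulr1 => ->; rewrite scale0r mem0v.
have d2 : ((<[e]> + half_space e) :&: null_space e)%VS = 0%VS.
  apply/eqP; rewrite -subv0; apply/subvP => x; rewrite memv_cap.
  case/andP=> /memv_addP[_ /vlineP[k ->] [y /memv_half hy ->]] /memv_null.
  rewrite /null !jmulE ee hy => e1; have := congr1 T e1; rewrite !jtrE te (tr_half ie hy) => e2.
  have k0 : k = 0 by apply: (eq_by e2); ring.
  move: e1; rewrite k0 scale0r !add0r => /eqP; rewrite scaler_eq0 invr_eq0 (negPf (n2 F)) /= => /eqP->.
  by rewrite mem0v.
have := ca_dimE J; rewrite -full dimv_disjoint_sum // dimv_disjoint_sum // dim_half // dim_vline e0 /=.
lia.
Qed.

Lemma dim_null0 e : idem1 e -> \dim (null0_space e) = (ca_dim J).+1.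
Proof.
move=> ie; have := dim_null ie; rewrite (@dim_cap_functional _ _ _ (null0_space e) T) => [[]//|a x y|x|].
- by rewrite !jtrE.
- by apply/memv_null0/andP => [[/memv_null ? /eqP ?]|[/memv_null ? /eqP ?]].
exists (1j - e); first by apply/memv_null; apply: null_unit.
by rewrite !jtrE ie.2 -(natrB _ (isT : (1 <= 3)%N)) pnatr_eq0.
Qed.

(** The Peirce spaces are orthogonal for the trace form, so the form stays nondegenerate on each; a
    multiple of [1j - e], orthogonal to [x], corrects the trace of the partner. *)
Lemma null0_nondeg e x : idem1 e -> null0 e x -> x != 0 ->
  exists2 y, null0 e y & T (x ** y) != 0.
Proof.
move=> ie [nx tx] /nondegW[y txy]; have [ee te] := ie.
move: txy; rewrite (peirce e y); move: (half_partP ie y) (null_partP ie y).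
move: (T (e ** y)) (half_part e y) (null_part e y) => k h n hh nn.
rewrite !jmulE !jtrE (null_mulC nx) jtr0 (tr_null_half nx hh) => txn.
exists (n - (2%:R^-1 * T n) *: (1j - e)).
  split; last by rewrite !jtrE te; field.
  by apply: nullD => //; rewrite -scaleNr; apply: nullZ; apply: null_unit.
rewrite !jmulE !jtrE tx (null_mulC nx) jtr0; apply: contraNneq txn => xn.
by rewrite mulr0 !add0r; apply/eqP; apply: (eq_by xn); ring.
Qed.

Lemma half_nondeg e x : idem1 e -> half e x -> x != 0 ->
  exists2 y, half e y & T (x ** y) != 0.
Proof.
move=> ie hx /nondegW[y txy]; exists (half_part e y); first exact: half_partP.
move: txy; rewrite {1}(peirce e y); move: (null_partP ie y).
move: (T (e ** y)) (half_part e y) (null_part e y) => k h n nn.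
rewrite !jmulE !jtrE (half_mulC hx) (jtrC x n) (tr_null_half nn hx) jtrE (tr_half ie hx).
by rewrite !mulr0 add0r addr0.
Qed.

End Automorphisms.

(** * Lines and Pluecker coordinates *)

Section Pluecker.
Variables (F : numFieldType) (V : vectType F).
Implicit Types (u v x y : V) (L : {vspace V}).

Definition indep2 u v := forall a b : F, a *: u + b *: v = 0 -> a = 0 /\ b = 0.

Lemma mem_span2 x u v : x \in <<[:: u; v]>>%VS <-> exists a b, x = a *: u + b *: v.
Proof.
rewrite span_cons span_seq1; split.
  by case/memv_addP => _ /vlineP[a ->] [_ /vlineP[b ->] ->]; exists a, b.
by case=> a [b ->]; apply: memv_add; rewrite memvZ ?memv_line.
Qed.

Lemma indep2P u v : indep2 u v <-> \dim <<[:: u; v]>> = 2%N.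
Proof.
split=> [uv|d a b e].
  apply/eqP; have : free [:: u; v]; last by rewrite /free.
  rewrite free_cons seq1_free span_seq1; apply/andP; split.
    apply/negP => /vlineP[k e]; have [|/eqP] := uv 1 (- k).
      by rewrite e scale1r scaleNr subrr.
    by rewrite oner_eq0.
  apply/eqP => v0; have [|_ /eqP] := uv 0 1; first by rewrite v0 scaler0 scale0r addr0.
  by rewrite oner_eq0.
have : free [:: u; v] by rewrite /free d.
rewrite free_cons seq1_free span_seq1 => /andP[nu v0].
have a0 : a = 0.
  apply/eqP/negPn/negP => a0; case/negP: nu; apply/vlineP; exists (- (a^-1 * b)).
  have /(congr1 ( *:%R a^-1)) := e; rewrite scalerDr !scalerA mulVf // scale1r scaler0 scaleNr.
  by move/eqP; rewrite addr_eq0 => /eqP.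
by move: e; rewrite a0 scale0r add0r => /eqP; rewrite scaler_eq0 (negPf v0) orbF => /eqP.
Qed.

Lemma line_basis L u v : \dim L = 2%N -> u \in L -> v \in L -> indep2 u v -> L = <<[:: u; v]>>%VS.
Proof.
move=> dL uL vL /indep2P d; apply/eqP; rewrite eq_sym eqEdim d dL leqnn andbT.
by apply/span_subvP => x; rewrite !inE => /orP[] /eqP->.
Qed.

Lemma line_complete L u : \dim L = 2%N -> u \in L -> u != 0 ->
  exists2 v, v \in L & indep2 u v.
Proof.
move=> dL uL u0; have [v vL nv] : exists2 v, v \in L & v \notin <[u]>%VS.
  apply: contrapT => no; have : (L <= <[u]>)%VS.
    by apply/subvP => v vL; apply/negPn/negP => nv; apply: no; exists v.
  by move/dimvS; rewrite dL dim_vline u0.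
exists v => // a b e; have b0 : b = 0.
  apply/eqP/negPn/negP => b0; case/negP: nv; apply/vlineP; exists (- (b^-1 * a)).
  have /(congr1 ( *:%R b^-1)) := e; rewrite scalerDr !scalerA mulVf // scale1r scaler0 scaleNr.
  by move/eqP; rewrite addr_eq0 => /eqP/(congr1 -%R); rewrite opprK => <-.
by move: e; rewrite b0 scale0r addr0 => /eqP; rewrite scaler_eq0 (negPf u0) orbF => /eqP.
Qed.

Lemma plucker_linearl a u u' v : plucker (a *: u + u') v = a *: plucker u v + plucker u' v.
Proof. by apply/matrixP => i j; rewrite !mxE !coords_is_linear; ring. Qed.

Lemma plucker_linearr a u v v' : plucker u (a *: v + v') = a *: plucker u v + plucker u v'.
Proof. by apply/matrixP => i j; rewrite !mxE !coords_is_linear; ring. Qed.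

Lemma polymap_plucker (U : vectType F) (f g : U -> V) :
  polymap f -> polymap g -> polymap (fun t => plucker (f t) (g t)).
Proof. exact: polymap_bilinear plucker_linearl plucker_linearr. Qed.

Lemma plucker_comb a b c d u v :
  plucker (a *: u + b *: v) (c *: u + d *: v) = (a * d - b * c) *: plucker u v.
Proof.
apply/matrixP => i j; rewrite !mxE !coords_is_linear.
have E k (t : F) y : coords (t *: y) k = t * coords y k by rewrite /coords linearZ.
by rewrite !E; ring.
Qed.

Definition lines_of (P : V -> V -> Prop) : set {vspace V} :=
  [set L | exists u v, P u v /\ L = <<[:: u; v]>>%VS].

Definition cone_of (P : V -> V -> Prop) : set 'M[F]_(\dim {:V}) :=
  [set w | exists u v, P u v /\ w = plucker u v].

(** A change of basis of a line multiplies the bivector by a determinant, which the scaling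
    hypothesis lets the second vector absorb. *)
Lemma plucker_cone_of (P : V -> V -> Prop) :
  (forall u v, P u v -> indep2 u v) ->
  (forall k u v, k != 0 -> P u v -> P u (k *: v)) ->
  plucker_cone (lines_of P) = cone_of P.
Proof.
move=> Pi PZ; apply/seteqP; split=> w.
  case=> u [v [d [u' [v' [P' e]]] ->]]; have /mem_span2[a [b ua]] : u \in <<[:: u'; v']>>%VS.
    by rewrite -e; apply/mem_span2; exists 1, 0; rewrite scale1r scale0r addr0.
  have /mem_span2[c [k va]] : v \in <<[:: u'; v']>>%VS.
    by rewrite -e; apply/mem_span2; exists 0, 1; rewrite scale1r scale0r add0r.
  exists u', ((a * k - b * c) *: v'); rewrite ua va plucker_comb; split.
    apply: PZ => //; apply/eqP => det; move/indep2P: d => d.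
    have [|k0 /eqP] := d k (- b).
      have -> : k *: u + (- b) *: v = (a * k - b * c) *: u' by rewrite ua va; vec; ring.
      by rewrite det scale0r.
    rewrite oppr_eq0 => /eqP b0; have [|c0 a0] := d (- c) a.
      have -> : - c *: u + a *: v = (a * k - b * c) *: v' by rewrite ua va; vec; ring.
      by rewrite det scale0r.
    have [|/eqP] := d 1 0; last by rewrite oner_eq0.
    by rewrite ua a0 b0 !scale0r !addr0 scaler0.
  have -> : plucker u' ((a * k - b * c) *: v') = plucker (1 *: u' + 0 *: v') (0 *: u' + (a * k - b * c) *: v').
    by congr plucker; vec; ring.
  by rewrite plucker_comb; congr (_ *: _); ring.
case=> u [v [uv ->]]; exists u, v; split=> //; first by apply/indep2P/Pi.
by exists u, v.
Qed.

Lemma zariski_closure_polymap (W X : vectType F) (K : set W) (f : W -> X) w :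
  polymap f -> (forall w, K w -> f w = 0) -> zariski_closure K w -> f w = 0.
Proof.
move=> fP fK Kw; apply: coords_inj => i; rewrite [RHS]/coords linear0.
apply: (zariski_closure_polyfun (f := fun w => coords (f w) i)) Kw => // v /fK ->.
by rewrite /coords linear0.
Qed.

End Pluecker.

Section Contraction.
Variables (F : numClosedFieldType) (J : cubicAlgebra F).
Implicit Types (u v x y z e : J) (a b c : F) (w : 'M[F]_(\dim {:J})).
Local Notation "x ** y" := (ca_mul x y).
Local Notation T := (@ca_tr F J).

(* The contraction of a bivector with the linear form [T (y ** _)]. *)
Definition ctr w y : J :=
  \sum_i \sum_j (w i j * T (y ** (vbasis {:J})`_i)) *: (vbasis {:J})`_j.

Lemma ctr_linearl a w w' y : ctr (a *: w + w') y = a *: ctr w y + ctr w' y.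
Proof.
rewrite /ctr scaler_sumr -big_split; apply: eq_bigr => i _ /=.
rewrite scaler_sumr -big_split; apply: eq_bigr => j _ /=.
by rewrite !mxE scalerA -scalerDl; congr (_ *: _); ring.
Qed.

Lemma tr_sum I (r : seq I) (f : I -> J) : T (\sum_(i <- r) f i) = \sum_(i <- r) T (f i).
Proof. by elim: r => [|i r IH]; rewrite ?big_nil ?jtr0 // !big_cons jtrD IH. Qed.

Lemma jmul_sumr I (r : seq I) (f : I -> J) y : y ** (\sum_(i <- r) f i) = \sum_(i <- r) y ** f i.
Proof. by elim: r => [|i r IH]; rewrite ?big_nil ?jmul0r // !big_cons jmulDr IH. Qed.

Lemma ctr_plucker u v y : ctr (plucker u v) y = T (y ** u) *: v - T (y ** v) *: u.
Proof.
have TE x : T (y ** x) = \sum_i coords x i * T (y ** (vbasis {:J})`_i).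
  by rewrite {1}(coords_sum x) jmul_sumr tr_sum; apply: eq_bigr => i _; rewrite !jmulE !jtrE.
rewrite !TE [X in _ = _ *: X - _](coords_sum v) [X in _ = _ - _ *: X](coords_sum u) /ctr.
rewrite exchange_big !scaler_sumr -sumrB; apply: eq_bigr => j _.
rewrite !scalerA -scalerBl -scaler_suml; congr (_ *: _).
rewrite !mulr_suml -sumrB; apply: eq_bigr => i _; rewrite mxE.
by move: (T _) (coords u i) (coords v i) (coords u j) (coords v j) => t ui vi uj vj; ring.
Qed.

Lemma polymap_jmul (U : vectType F) (f g : U -> J) :
  polymap f -> polymap g -> polymap (fun t => f t ** g t).
Proof. by apply: polymap_bilinear => a x x' y; rewrite !jmulE. Qed.

Lemma polyfun_tr (U : vectType F) (f : U -> J) : polymap f -> polyfun (fun t => T (f t)).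
Proof. by apply: (polyfun_comp (f := T)); apply: polyfun_linear => a x y; rewrite !jtrE. Qed.

Lemma polymap_ctr (U : vectType F) (f : U -> 'M[F]_(\dim {:J})) y :
  polymap f -> polymap (fun t => ctr (f t) y).
Proof. by apply: (polymap_comp (psi := ctr^~ y)); apply: polymap_linear => a x x'; apply: ctr_linearl. Qed.

Lemma polymapN (U V : vectType F) (f : U -> V) : polymap f -> polymap (fun t => - f t).
Proof.
move=> fP; have := polymapZ (polyfunC U (-1)) fP.
by apply: polymap_ext => x; rewrite scaleN1r.
Qed.

Lemma exists_pairing u v a b : indep2 u v -> exists y, T (y ** u) = a /\ T (y ** v) = b.
Proof.
move=> uv; have [yu0 yv0] : (exists y, T (y ** u) = 1 /\ T (y ** v) = 0) /\
    (exists y, T (y ** u) = 0 /\ T (y ** v) = 1).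
  have key x x' : indep2 x x' -> exists y, T (y ** x) = 1 /\ T (y ** x') = 0.
    move=> xx'; apply: contrapT => no.
    have [x'0|x'0] := eqVneq x' 0.
      have [|_ /eqP] := xx' 0 1; first by rewrite x'0 scaler0 scale0r addr0.
      by rewrite oner_eq0.
    have [y0 y0x'] := nondegW x'0; rewrite jtrC in y0x'.
    pose k := T (y0 ** x) / T (y0 ** x').
    have [|/eqP] := xx' 1 (- k); last by rewrite oner_eq0.
    apply: ca_nondeg => y; apply/eqP/negPn/negP => ty; apply: no.
    pose y' := y - (T (y ** x') / T (y0 ** x')) *: y0.
    have tx : T (y' ** x) = T ((1 *: x + (- k) *: x') ** y).
      rewrite /y' !jmulE !jtrE (jtrC x y) (jtrC x' y) /k; field.
      by [].
    have tx' : T (y' ** x') = 0 by rewrite /y' !jmulE !jtrE; field.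
    clearbody y'; rewrite -tx in ty; exists ((T (y' ** x))^-1 *: y').
    by rewrite !jmulE !jtrE tx' mulr0 mulVf.
  split; first exact: key.
  have [|y [yv yu]] := key v u; last by exists y.
  by move=> p q; rewrite addrC => /uv[].
have [y1 [y1u y1v]] := yu0; have [y2 [y2u y2v]] := yv0.
exists (a *: y1 + b *: y2); rewrite !jmulE !jtrE y1u y1v y2u y2v.
by rewrite !mulr1 !mulr0 addr0 add0r.
Qed.

(** Vectors of the line become linear functions of its bivector, so that conditions on the line
    become polynomial equations in the Pluecker coordinates. *)
Lemma ctr_onto u v x : indep2 u v -> x \in <<[:: u; v]>>%VS -> exists y, x = ctr (plucker u v) y.
Proof.
move=> uv /mem_span2[a [b ->]]; have [y [yu yv]] := exists_pairing b (- a) uv.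
by exists y; rewrite ctr_plucker yu yv; vec; ring.
Qed.

Lemma ctr_mem u v y : ctr (plucker u v) y \in <<[:: u; v]>>%VS.
Proof. by apply/mem_span2; exists (- T (y ** v)), (T (y ** u)); rewrite ctr_plucker; vec; ring. Qed.

End Contraction.

(** * Classification of the reduced lines *)

Section LineTypes.
Variables (F : numClosedFieldType) (J : cubicAlgebra F).
Implicit Types (u v x y z e p X : J) (a b c : F) (L : {vspace J}).
Local Notation "x ** y" := (ca_mul x y).
Local Notation T := (@ca_tr F J).
Local Notation "1j" := (ca_one J) (at level 0).

(* Locked, so that rewriting with jmulE does not expand it. *)
Definition hat : J -> J := locked (fun x => x - (T x / 3%:R) *: 1j).

Lemma hatE x : hat x = x - (T x / 3%:R) *: 1j.
Proof. by rewrite /hat -lock. Qed.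

Lemma hat_linear a x y : hat (a *: x + y) = a *: hat x + hat y.
Proof. by rewrite !hatE !jtrE; vec; field. Qed.

Lemma polymap_hat (U : vectType F) (f : U -> J) : polymap f -> polymap (fun t => hat (f t)).
Proof. by apply: (polymap_comp (psi := hat)); apply: polymap_linear; apply: hat_linear. Qed.

Lemma tr_hat x : T (hat x) = 0.
Proof. by rewrite !hatE !jtrE; field. Qed.

(* Lines spanned by the traceless part of an idempotent e and by a traceless
   element of the Peirce space of e for the eigenvalue 0. *)
Definition pair01 u v := exists e, [/\ idem1 e, u = hat e, null0 e v & v != 0].
Definition pair0 u v := pair01 u v /\ T (v ** v) != 0.
Definition pair1 u v := pair01 u v /\ T (v ** v) = 0.

Definition pair24 X p g := exists e,
  [/\ idem1 e, null0 e X, X ** X = 0 /\ X != 0, half e p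
    & [/\ X ** p = 0, p ** p = g *: X & p != 0]].
Definition pair2 X p := exists2 g, g != 0 & pair24 X p g.
Definition pair4 X p := pair24 X p 0.

Lemma idem1_neq0 e : idem1 e -> e != 0.
Proof. by case=> _ te; apply/eqP => e0; move: te; rewrite e0 jtr0 => /eqP; rewrite eq_sym oner_eq0. Qed.

Lemma hat_e_mul e : idem1 e -> e ** hat e = (2%:R / 3%:R) *: e.
Proof. by case=> ee te; rewrite hatE te !jmulE ee; vec; field. Qed.

Lemma tr_hat_e e : idem1 e -> T (hat e ** e) = 2%:R / 3%:R.
Proof. by move=> ie; rewrite jtrC hat_e_mul // jtrE ie.2 mulr1. Qed.

Lemma hat_mul_null e v : null e v -> hat e ** v = (- (T e / 3%:R)) *: v.
Proof. by rewrite /null => nv; rewrite hatE !jmulE nv; vec; ring. Qed.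

Lemma pair01_indep u v : pair01 u v -> indep2 u v.
Proof.
case=> e [ie -> [nv tv] v0] a b ab; have := congr1 (ca_mul e) ab.
rewrite !jmulE hat_e_mul // nv => /(congr1 T); rewrite !jtrE ie.2 => a0.
have {}a0 : a = 0 by apply: (eq_by_scaled (c := 3%:R / 2%:R) a0); field.
by move: ab; rewrite a0 scale0r add0r => /eqP; rewrite scaler_eq0 (negPf v0) orbF => /eqP.
Qed.

Lemma pair24_indep X p g : pair24 X p g -> indep2 X p.
Proof.
case=> e [ie [nX tX] [_ X0] hp [_ _ p0]] a b ab; have := congr1 (ca_mul e) ab.
rewrite !jmulE nX hp scaler0 add0r scalerA => /eqP.
rewrite scaler_eq0 (negPf p0) orbF mulf_eq0 invr_eq0 (negPf (n2 F)) orbF => /eqP b0.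
by move: ab; rewrite b0 scale0r addr0 => /eqP; rewrite scaler_eq0 (negPf X0) orbF => /eqP.
Qed.

Lemma pair01_scale k u v : k != 0 -> pair01 u v -> pair01 u (k *: v).
Proof.
move=> k0 [e [ie -> [nv tv] v0]]; exists e; split=> //; last by rewrite scaler_eq0 negb_or k0.
by split; [apply: nullZ|rewrite jtrE tv mulr0].
Qed.

Lemma pair24_scale k X p g : k != 0 -> pair24 X p g -> pair24 X (k *: p) (k ^+ 2 * g).
Proof.
move=> k0 [e [ie nX XX hp [Xp pp p0]]]; exists e; split=> //; first exact: halfZ.
by rewrite !jmulE Xp pp scaler0 !scalerA expr2 scaler_eq0 negb_or k0.
Qed.

Lemma cone_pair0 : plucker_cone (lines_of pair0) = cone_of pair0.
Proof.
apply: plucker_cone_of => [u v [/pair01_indep]//|k u v k0 [p0 vv]]; split; first exact: pair01_scale.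
by rewrite !jmulE !jtrE !mulf_neq0.
Qed.

Definition closed_line L :=
  [/\ \dim L = 2%N, forall x, x \in L -> T x = 0,
      forall D x y, derivative D -> x \in L -> y \in L -> T (D x ** y) = 0,
      forall x y z, x \in L -> y \in L -> x ** (y ** z) = y ** (x ** z)
    & forall x y, x \in L -> y \in L -> hat (x ** y) \in L].

Lemma derivative_e_half D e : idem1 e -> derivative D -> half e (D e).
Proof.
move=> [ee _] dD; have := dD e e; rewrite ee (ca_mulC _ e) => De.
by rewrite /half {2}De; vec; field.
Qed.

Lemma derivative1 D : derivative D -> D 1j = 0.
Proof.
by move=> dD; have := dD 1j 1j; rewrite !jmulE => e; apply: (eq_byZ (c := -1) e); vec; ring.
Qed.

Section Pair01.
Variables (e v : J).
Hypotheses (ie : idem1 e) (nv : null e v) (tv : T v = 0).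

Lemma vv_null : v ** v = (2%:R^-1 * T (v ** v)) *: (1j - e).
Proof. by have := null_mulE ie nv nv; rewrite tv => E0; apply: (eq_byZ (c := 1) E0); vec; ring. Qed.

Lemma pair01_mul a b a' b' :
  hat ((a *: hat e + b *: v) ** (a' *: hat e + b' *: v)) =
  (a * a' / 3%:R - 2%:R^-1 * T (v ** v) * b * b') *: hat e + (- 3%:R^-1 * (a * b' + b * a')) *: v.
Proof.
have [ee te] := ie; rewrite !hatE te !jmulE ee nv (null_mulC nv) vv_null.
by rewrite !jtrE te tv; vec; field.
Qed.

(** Multiplication by the null element [v] preserves the Peirce 0-space and 1/2-space of [e], on
    which [e] acts by scalars, and it kills [e]. *)
Lemma pair01_commute z : e ** (v ** z) = v ** (e ** z).
Proof.
rewrite (peirce e z); move: (half_partP ie z) (null_partP ie z).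
move: (T (e ** z)) (half_part e z) (null_part e z) => k h n hh nn.
rewrite !jmulE (null_mulC nv) ie.1 hh nn (null_mul ie nv nn) (null_half_mul ie nv hh).
by rewrite (null_mulC nv) !jmulE.
Qed.

(** The derivative of [e] lies in the 1/2-space, which is orthogonal to the null element [v]. *)
Lemma pair01_derivative D : derivative D -> T (D (hat e) ** v) = 0.
Proof.
move=> dD; rewrite hatE linearB linearZ /= derivative1 // scaler0 subr0 jtrC.
exact: (tr_null_half nv (derivative_e_half ie dD)).
Qed.

End Pair01.

Lemma derivative_tr_anti D x y : derivative D -> T (D x ** y) = - T (D y ** x).
Proof.
move=> dD; have := derivative_tr (x ** y) dD; rewrite dD jtrE (jtrC x) => e.
by apply: (eq_by e); ring.
Qed.

Definition reduced u v :=
  indep2 u v /\ zariski_closure (cone_of pair0) (plucker u v).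

Ltac polym := repeat first [exact: polymapC | exact: polymap_id | apply: polymap_hat | apply: polymap_jmul
  | apply: polymapD | apply: polymapN | apply: polymapZ | apply: polyfun_tr | apply: polymap_ctr
  | apply: polyfunM | apply: polyfunD | apply: polyfunC].

Lemma reduced_closed u v : reduced u v -> closed_line <<[:: u; v]>>%VS.
Proof.
case=> uv cl; set w := plucker u v in cl *.
have onto x : x \in <<[:: u; v]>>%VS -> exists y, x = ctr w y by apply: ctr_onto.
(* A polynomial condition on the bivector has to be checked only on pairs of type 0. *)
have base (W : vectType F) (f : 'M[F]_(\dim {:J}) -> W) : polymap f ->
    (forall e v, idem1 e -> null e v -> T v = 0 -> f (plucker (hat e) v) = 0) -> f w = 0.
  move=> fP f0; apply: zariski_closure_polymap fP _ cl => _ [_ [v' [[[e [ie -> [nv tv] _]] _] ->]]].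
  exact: f0.
have ctrE e v' y : ctr (plucker (hat e) v') y
    = (- T (y ** v')) *: hat e + T (y ** hat e) *: v' by rewrite ctr_plucker; vec; ring.
split.
- by apply/indep2P.
- move=> _ /onto[y ->]; apply: (base F^o (fun w => T (ctr w y))).
    by apply: polyfun_polymap; polym.
  by move=> e v' ie nv tv; rewrite ctrE !jtrE tr_hat tv !mulr0 addr0.
- move=> D _ _ dD /onto[y ->] /onto[y' ->]; apply: (base F^o (fun w => T (D (ctr w y) ** ctr w y'))).
    apply: polyfun_polymap; apply: polyfun_tr; apply: polymap_jmul; last by polym.
    by apply: (polymap_comp (psi := D)); [apply: polymap_linear => a x x'; rewrite linearP|polym].
  move=> e v' ie nv tv; rewrite !ctrE !linearD !linearZ /= !jmulE !jtrE.
  rewrite (derivative_tr_anti v' (hat e) dD) (pair01_derivative ie nv dD).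
  have z x : T (D x ** x) = 0.
    have := derivative_tr_anti x x dD => e1; have e2 : 2%:R * T (D x ** x) = 0 by apply: (eq_by e1); ring.
    by move/eqP: e2; rewrite mulf_eq0 (negPf (n2 F)) => /eqP.
  by rewrite !z; ring.
- move=> _ _ z /onto[y ->] /onto[y' ->]; apply/eqP; rewrite -subr_eq0; apply/eqP.
  apply: (base _ (fun w => ctr w y ** (ctr w y' ** z) - ctr w y' ** (ctr w y ** z))); first by polym.
  move=> e v' ie nv tv; rewrite !ctrE !hatE !jmulE (pair01_commute ie nv).
  by vec; ring.
- move=> _ _ /onto[y ->] /onto[y' ->].
  have [b [d]] : exists b d : J, T (b ** ctr w d) != 0.
    have [d [du dv]] := exists_pairing 0 (-1) uv; have [b [bu bv]] := exists_pairing 1 0 uv.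
    exists b, d; rewrite ctr_plucker du dv scale0r scaleN1r sub0r opprK bu; exact: oner_neq0.
  (* Membership in the line as an equation: a vector z of the line satisfies T(b ctr(w,d)) z = T(b
     z) ctr(w,d) - T(d z) ctr(w,b), and conversely a vector satisfying it lies in the line once T(b
     ctr(w,d)) is nonzero. *)
  set bd := T _ => bd0; pose f w := (T (b ** ctr w d)) *: hat (ctr w y ** ctr w y')
      - (T (b ** hat (ctr w y ** ctr w y'))) *: ctr w d + (T (d ** hat (ctr w y ** ctr w y'))) *: ctr w b.
  have : f w = 0.
    apply: base; first by rewrite /f; polym.
    move=> e v' ie nv tv; rewrite /f !ctrE (pair01_mul ie nv tv) !jmulE !jtrE.
    by vec; ring.
  rewrite /f -/bd => f0.
  have -> : hat (ctr w y ** ctr w y') = (bd^-1 * T (b ** hat (ctr w y ** ctr w y'))) *: ctr w d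
      - (bd^-1 * T (d ** hat (ctr w y ** ctr w y'))) *: ctr w b.
    by apply: (eq_byZ (c := bd^-1) f0); vec; field.
  by rewrite memvB // memvZ // ctr_mem.
Qed.

End LineTypes.

Section Classification.
Variables (F : numClosedFieldType) (J : cubicAlgebra F).
Implicit Types (u v x y z e p X : J) (a b c : F) (L : {vspace J}).
Local Notation "x ** y" := (ca_mul x y).
Local Notation T := (@ca_tr F J).
Local Notation E := (ca_frame J).
Local Notation "1j" := (ca_one J) (at level 0).

(** Rank one idempotents span the algebra. Orthogonality to all of them extends to rank one elements
    of nonzero trace, in particular to the charts at [k *: z] and at [- k *: z], whose difference is
    a multiple of [z]. *)
Lemma exists_idem1_pairing X : X != 0 -> exists2 f, idem1 f & T (f ** X) != 0.
Proof.
move=> X0; apply: contrapT => no; move/eqP: X0; apply; apply: ca_nondeg => y; rewrite jtrC.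
have noE f : idem1 f -> T (f ** X) = 0.
  by move=> i_f; apply/eqP/negPn/negP => t; apply: no; exists f.
have noR r : rank1 r -> T r != 0 -> T (r ** X) = 0.
  move=> rr tr0; have := noE ((T r)^-1 *: r); rewrite !jmulE !jtrE => /(_ _)/eqP.
  rewrite mulf_eq0 invr_eq0 (negPf tr0) => h; apply/eqP/h; split; last by rewrite jtrE mulVf.
  by rewrite !jmulE rr; vec; field.
elim/frame_ind: y => [a x y ex ey|i|i z hz].
- by rewrite !jmulE !jtrE ex ey mulr0 addr0.
- exact/noE/frame_idem1.
have iE := frame_idem1 J i; pose q := T (z ** z).
(* The trace of the chart at [k *: z] must be nonzero; if k = 1 fails then q = -2 and k = 2 gives
   -3. *)
have [k k0 kq] : exists2 k : F, k != 0 & 1 + 2%:R^-1 * (k * k * q) != 0.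
  have [h|h] := eqVneq (1 + 2%:R^-1 * (1 * 1 * q)) 0; last by exists 1; rewrite ?oner_neq0.
  exists 2%:R; first exact: n2.
  rewrite (_ : _ + _ = - 3%:R); first by rewrite oppr_eq0 n3.
  by apply: (eq_by_scaled (c := 4%:R) h); field.
have key t : t * t = k * k -> t * T (z ** X) + (k * k) * (T (z ** z ** X) - 2%:R^-1 * q * T (E i ** X)) = 0.
  move=> tk; have ht := halfZ t hz; have tq c : t * (t * c) = k * k * c by rewrite mulrA tk.
  have := noR _ (chart_rank1 iE ht); rewrite tr_chart // !jmulE !jtrE -/q tq => /(_ kq).
  rewrite ?tq (noE (E i) iE) => e.
  by apply: (eq_by e); ring.
have := key (- k); rewrite mulrNN => /(_ erefl); have := key k erefl => e1 e2.
have : (2%:R * k) * T (z ** X) = 0.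
  by have -> : 2%:R * k * T (z ** X) = 0 - 0; [rewrite -{1}e1 -{1}e2; move: (T _) (T (_ ** _ ** _)) (T _) => *; ring|rewrite subrr].
by move/eqP; rewrite mulf_eq0 mulf_eq0 (negPf (n2 F)) (negPf k0) => /eqP.
Qed.

Lemma exists_idem1_null X : X ** X = 0 -> T X = 0 -> X != 0 -> exists2 e, idem1 e & null e X.
Proof.
move=> XX tX X0; have [f i_f t0] := exists_idem1_pairing X0; set t := T (f ** X) in t0.
have rX : rank1 X by rewrite /rank1 XX tX scale0r.
have [ff tf] := i_f.
have XfX : X ** (f ** X) = (2%:R^-1 * t) *: X.
  by rewrite (ca_mulC f) rank1_mul // tX jtrC -/t; vec; ring.
have ffX : f ** (f ** X) = 2%:R^-1 *: (f ** X + t *: f) by apply: idem_mul.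
have fX2 := rank1_mul2 (idem1_rank1 i_f) rX; rewrite tX tf -/t in fX2.
(* For matrices f = u u^t and X = w w^t with w isotropic, the subtracted term is the projector on
   the plane spanned by u and w. *)
pose e := 1j - t^-1 *: (2%:R *: (f ** X) - X).
exists e; last by rewrite /null /e !jmulE (ca_mulC _ X) XfX XX; vec; field.
split; last by rewrite /e !jtrE -/t tX; field.
rewrite /e !jmulE (ca_mulC (f ** X) X) XfX XX fX2.
by vec; field.
Qed.

Lemma nil_normal e X N : idem1 e -> null0 e X -> X ** X = 0 -> X != 0 -> T N = 0 ->
  X ** N = 0 -> (forall z, X ** (N ** z) = N ** (X ** z)) ->
  exists p k, [/\ half e p, X ** p = 0 & N = p + k *: X].
Proof.
move=> ie [nX tX] XX X0 tN XN comm; rewrite (peirce e N) in tN XN comm *.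
move: (half_partP ie N) (null_partP ie N) tN XN comm.
move: (T (e ** N)) (half_part e N) (null_part e N) => al p v hp nv tN XN comm.
have XvE := null_mulE ie nX nv; rewrite tX in XvE.
have Xv_null := null_mul ie nX nv; have Xp_half := null_half_mul ie nX hp.
have Xpv : X ** p = 0 /\ X ** v = 0.
  have e1 : X ** p + X ** v = 0 by rewrite -XN !jmulE (null_mulC nX); vec; ring.
  have := congr1 (ca_mul e) e1; rewrite !jmulE Xp_half Xv_null addr0 => /eqP.
  rewrite scaler_eq0 invr_eq0 (negPf (n2 F)) /= => /eqP Xp; split=> //.
  by rewrite -e1 Xp add0r.
have [Xp Xv] := Xpv.
have tal : al = - T v.
  by move: tN; rewrite !jtrE ie.2 (tr_half ie hp) => e1; apply: (eq_by e1); ring.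
have tXv : T (X ** v) = 0 by rewrite Xv jtr0.
have tv : T v = 0.
  move: XvE; rewrite Xv jtr0 => e1; have : T v *: X = 0.
    by apply: (eq_byZ (c := - 2%:R) e1); vec; field.
  by move/eqP; rewrite scaler_eq0 (negPf X0) orbF => /eqP.
have [m [nm tm] tXm] := null0_nondeg ie (conj nX tX) X0.
have XmE := null_mulE ie nX nm; rewrite tX tm in XmE.
have vmE := null_mulE ie nv nm; rewrite tv tm in vmE.
have Xpm : X ** (p ** m) = (4%:R^-1 * T (X ** m)) *: p.
  have := clifford ie nX nm tX tm hp; rewrite Xp jmulE addr0 => <-.
  by rewrite (ca_mulC p).
exists p, (T (v ** m) / T (X ** m)); split=> //.
set t := T (X ** m) in tXm XmE Xpm *; set w := T (v ** m) in vmE *; clearbody t w.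
have al0 : al = 0 by rewrite tal tv oppr0.
(* Both sides have the component t/4 p in the 1/2-space; comparing null components gives w X = t
   v. *)
have := comm m; rewrite al0 !jmulE (nm : e ** m = 0) Xpm vmE XmE !jmulE Xv (null_mulC nX).
rewrite (ca_mulC p X) (ca_mulC v X) Xp Xv (half_mulC hp) (null_mulC nv) ie.1 (nX : e ** X = 0).
move=> e1.
by apply: (eq_byZ (c := - 2%:R / t) e1); vec; field.
Qed.

Section OneLine.
Variable L : {vspace J}.
Hypothesis cL : closed_line L.

Let dL : \dim L = 2%N. Proof. by case: cL. Qed.
Let tL x : x \in L -> T x = 0. Proof. by case: cL => _ h _ _ _; apply: h. Qed.
Let commL x y z : x \in L -> y \in L -> x ** (y ** z) = y ** (x ** z).
Proof. by case: cL => _ _ _ h _; apply: h. Qed.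
Let mulL x y : x \in L -> y \in L -> hat (x ** y) \in L.
Proof. by case: cL => _ _ _ _ h; apply: h. Qed.

Lemma cube_traceless y : T y = 0 ->
  (y ** y) ** y = (2%:R^-1 * T (y ** y)) *: y + (3%:R^-1 * T (y ** (y ** y))) *: 1j.
Proof.
move=> ty; have := jchar y y y; rewrite ty => e1.
by apply: (eq_byZ (c := 3%:R^-1) e1); vec; field.
Qed.

(** Without associativity the square of the square needs its own instance of the characteristic
    equation, at [y], [y] and [y ** y]. *)
Lemma fourth_traceless y : T y = 0 ->
  (y ** y) ** (y ** y) = (2%:R^-1 * T (y ** y)) *: (y ** y) + (3%:R^-1 * T (y ** (y ** y))) *: y.
Proof.
move=> ty; have y3 := cube_traceless ty; set s := T (y ** y) in y3 *; set n := T _ in y3 *.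
have t3 : T (y ** y ** y) = n by rewrite jtrC.
have := jchar y y (y ** y); rewrite (ca_mulC y (y ** y)) t3 y3 !jmulE !jtrE ty -/s => e1.
by apply: (eq_byZ (c := 1) e1); vec; field.
Qed.

(* A simple root r of the characteristic polynomial of y gives an idempotent
   q(y) / q(r), where (t - r) q(t) is that polynomial. *)
Lemma simple_root_idem y r : y \in L ->
  r ^+ 3 = 2%:R^-1 * T (y ** y) * r + 3%:R^-1 * T (y ** (y ** y)) ->
  3%:R * r ^+ 2 != 2%:R^-1 * T (y ** y) -> exists2 e, idem1 e & hat e \in L.
Proof.
move=> yL; have ty := tL yL; have y3 := cube_traceless ty; have y4 := fourth_traceless ty.
have y2L := mulL yL yL; rewrite hatE in y2L.
move: y2L y3 y4; set s := T (y ** y); set n := T (y ** (y ** y)); set y2 := y ** y.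
have ts : T y2 = s by [].
move=> y2L y3 y4 root simple; have n3E : n = 3%:R * (r ^+ 3 - 2%:R^-1 * s * r) by rewrite root; field.
(* The derivative of the characteristic polynomial at [r], which is also the value q(r) of the
   cofactor. *)
pose k := 3%:R * r ^+ 2 - 2%:R^-1 * s; have k0 : k != 0 by rewrite subr_eq0.
have k2 : 3%:R * r ^+ 2 * 2%:R - s != 0.
  by apply: contraNneq k0 => h; apply/eqP; rewrite /k; apply: (eq_by_scaled (c := 2%:R^-1) h); field.
have yy : y ** y = y2 by []. clearbody y2 s n.
exists (k^-1 *: (y2 + r *: y + (r ^+ 2 - 2%:R^-1 * s) *: 1j)).
  split; last by rewrite !jtrE ts ty /k; field.
  rewrite !jmulE (ca_mulC y y2) yy y3 y4 n3E.
  by rewrite /k; vec; field.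
rewrite hatE !jtrE ts ty.
have -> : k^-1 *: (y2 + r *: y + (r ^+ 2 - 2%:R^-1 * s) *: 1j)
    - (k^-1 * (s + r * 0 + (r ^+ 2 - 2%:R^-1 * s) * 3%:R) / 3%:R) *: 1j
  = k^-1 *: ((y2 - (s / 3%:R) *: 1j) + r *: y) by vec; field.
by rewrite memvZ // memvD // memvZ.
Qed.

Lemma idem_line e : idem1 e -> hat e \in L -> lines_of (pair0 (J := J)) L \/ lines_of (pair1 (J := J)) L.
Proof.
move=> ie eL; have he0 : hat e != 0.
  apply/eqP => h0; have := tr_hat_e ie; rewrite h0 jmul0l jtr0 => /eqP.
  by rewrite eq_sym mulf_eq0 invr_eq0 (negPf (n2 F)) (negPf (n3 F)).
have [v0 v0L ind] := line_complete dL eL he0.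
(* Commutation applied to [e] gives e(e v0) = e v0, so [v0] has no component in the 1/2-space. *)
have ev0 : e ** v0 = T (e ** v0) *: e.
  have e1 := commL e eL v0L; have := commL 1j eL v0L; rewrite !jmulr1 => e2.
  have {}e1 : e ** (v0 ** e) = v0 ** e.
    move: e1; rewrite hatE !jmulE ie.1 => e1.
    by apply: (eq_by e1); vec; ring.
  rewrite (ca_mulC v0) in e1; have := idem_mul ie v0; rewrite e1 => e3.
  by apply: (eq_byZ (c := 2%:R) e3); vec; field.
(* The factor 3/2 compensates [hat_e_mul], where e times its traceless part is 2/3 e. *)
pose v := v0 - ((3%:R / 2%:R) * T (e ** v0)) *: hat e.
have vL : v \in L by rewrite memvB // memvZ.
have nv : null0 e v.
  split; last by rewrite /v !jtrE tr_hat (tL v0L); ring.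
  by rewrite /null /v !jmulE hat_e_mul // ev0 jtrE ie.2; vec; field.
have indv : indep2 (hat e) v.
  move=> a b; rewrite /v => e1; have [|a0 b0] := ind (a - b * ((3%:R / 2%:R) * T (e ** v0))) b.
    by rewrite -e1; vec; ring.
  by move: a0; rewrite b0 mul0r subr0.
have v_neq0 : v != 0.
  apply/eqP => v00; have [|_ /eqP] := indv 0 1; first by rewrite v00 scaler0 scale0r addr0.
  by rewrite oner_eq0.
have LE := line_basis dL eL vL indv; have p01 : pair01 (hat e) v by exists e.
by have [vv|vv] := eqVneq (T (v ** v)) 0; [right|left]; exists (hat e), v.
Qed.

Lemma nil_line X N : X \in L -> N \in L -> X ** X = 0 -> X != 0 -> X ** N = 0 -> indep2 X N ->
  (exists c, N ** N = c *: X) ->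
  exists g p, [/\ pair24 X p g, L = <<[:: X; p]>>%VS & N ** N = g *: X].
Proof.
move=> XL NL XX X0 XN ind [c NN]; have tX := tL XL.
have [e ie nX] := exists_idem1_null XX tX X0.
have [p [k [hp Xp NE]]] := nil_normal ie (conj nX tX) XX X0 (tL NL) XN (fun z => commL z XL NL).
have pE : p = N - k *: X by rewrite NE; vec; ring.
have pL : p \in L by rewrite pE memvB // memvZ.
have indp : indep2 X p.
  move=> a b; rewrite pE => e1; have [|a0 b0] := ind (a - b * k) b; first by rewrite -e1; vec; ring.
  by move: a0; rewrite b0 mul0r subr0.
exists c, p; split=> //; last exact: line_basis.
exists e; split=> //; split=> //.
  by rewrite pE !jmulE NN XN (ca_mulC N X) XN XX; vec; ring.
apply/eqP => p0; have [|_ /eqP] := indp 0 1; first by rewrite p0 scaler0 scale0r addr0.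
by rewrite oner_eq0.
Qed.

Lemma closed_line_types :
  [\/ lines_of (pair0 (J := J)) L, lines_of (pair1 (J := J)) L,
      lines_of (pair2 (J := J)) L | lines_of (pair4 (J := J)) L].
Proof.
have [[y [r [yL root simple]]]|no] := pselect (exists y r, [/\ y \in L,
  r ^+ 3 = 2%:R^-1 * T (y ** y) * r + 3%:R^-1 * T (y ** (y ** y))
  & 3%:R * r ^+ 2 != 2%:R^-1 * T (y ** y)]).
  have [e ie eL] := simple_root_idem yL root simple.
  by have [] := idem_line ie eL; [constructor 1|constructor 2].
have nil y : y \in L -> T (y ** y) = 0 /\ T (y ** (y ** y)) = 0.
  move=> yL; set s := T (y ** y); set n := T _.
  have dbl r : r ^+ 3 = 2%:R^-1 * s * r + 3%:R^-1 * n -> 3%:R * r ^+ 2 = 2%:R^-1 * s.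
    by move=> root; apply/eqP/negPn/negP => simple; apply: no; exists y, r.
  pose P : {poly F} := 'X^3 - (2%:R^-1 * s) *: 'X - (3%:R^-1 * n)%:P.
  have [r Pr] : exists r, root P r.
    apply: closed_rootP; rewrite /P -addrA size_polyDl size_polyXn //.
    rewrite -opprD size_polyN (leq_ltn_trans (size_polyD _ _)) // gtn_max.
    by rewrite (leq_ltn_trans (size_scale_leq _ _)) ?size_polyX // (leq_ltn_trans (size_polyC_leq1 _)).
  have rE : r ^+ 3 = 2%:R^-1 * s * r + 3%:R^-1 * n.
    by move/rootP: Pr; rewrite /P !hornerE => e1; apply: (eq_by e1); ring.
  have e1 := dbl r rE; have nE : n = 3%:R * (r ^+ 3 - 2%:R^-1 * s * r) by rewrite rE; field.
  have sE : s = 6%:R * r ^+ 2 by apply: (eq_by_scaled (c := - 2%:R) e1); field.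
  (* The roots sum to 0, so a double root [r] has companion -2r, which is simple unless r = 0. *)
  have e2 : 3%:R * (- 2%:R * r) ^+ 2 = 2%:R^-1 * s by apply: dbl; rewrite nE sE; field.
  have : r ^+ 2 = 0 by rewrite sE in e2; apply: (eq_by_scaled (c := 9%:R^-1) e2); field.
  by move/eqP; rewrite expf_eq0 => /eqP r0; rewrite nE sE r0; split; ring.
have sqL y : y \in L -> y ** y \in L.
  by move=> yL; have := mulL yL yL; rewrite hatE (nil y yL).1 mul0r scale0r subr0.
have cube y : y \in L -> (y ** y) ** y = 0.
  by move=> yL; rewrite (cube_traceless (tL yL)) (nil y yL).1 (nil y yL).2 !mulr0 !scale0r addr0.
(* All elements of the line are now nilpotent of order at most three. A nonzero square serves as [X]
   and leads to type 2; if all squares vanish the line has type 4. *)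
have [[N [NL N2]]|no2] := pselect (exists N, N \in L /\ N ** N != 0).
  have XX : (N ** N) ** (N ** N) = 0.
    by rewrite (fourth_traceless (tL NL)) (nil N NL).1 (nil N NL).2 !mulr0 !scale0r addr0.
  have ind : indep2 (N ** N) N.
    move=> a b e1; have := congr1 (ca_mul (N ** N)) e1; rewrite !jmulE XX cube // => _.
    have := congr1 (ca_mul N) e1; rewrite !jmulE (ca_mulC N (N ** N)) cube // scaler0 add0r => /eqP.
    rewrite scaler_eq0 (negPf N2) orbF => /eqP b0; move: e1; rewrite b0 scale0r addr0 => /eqP.
    by rewrite scaler_eq0 (negPf N2) orbF => /eqP.
  have [|g [p [P LE NN]]] := nil_line (sqL N NL) NL XX N2 (cube N NL) ind; first by exists 1; rewrite scale1r.
  constructor 3; exists (N ** N), p; split=> //; exists g => //.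
  by apply: contraNneq N2 => g0; rewrite NN g0 scale0r.
have sq0 y : y \in L -> y ** y = 0.
  by move=> yL; apply/eqP/negPn/negP => ?; apply: no2; exists y.
have [X XL X0] : exists2 X, X \in L & X != 0.
  exists (vpick L); first exact: memv_pick.
  by rewrite vpick0 -dimv_eq0 dL.
have [Y YL ind] := line_complete dL XL X0.
have XY : X ** Y = 0.
  have := sq0 (X + Y) (memvD XL YL); rewrite !jmulE (sq0 X XL) (sq0 Y YL) (ca_mulC Y X) => e1.
  by apply: (eq_byZ (c := 2%:R^-1) e1); vec; field.
have [|g [p [P LE NN]]] := nil_line XL YL (sq0 X XL) X0 XY ind; first by exists 0; rewrite scale0r sq0.
have g0 : g = 0.
  by move/eqP: NN; rewrite (sq0 Y YL) eq_sym scaler_eq0 (negPf X0) orbF => /eqP.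
by constructor 4; exists X, p; rewrite /pair4 -g0.
Qed.

End OneLine.

End Classification.

(** * Degenerations between the types of lines *)

Section Cones.
Variables (F : numClosedFieldType) (J : cubicAlgebra F).
Implicit Types (u v x y z e p X : J) (a b c : F) (L : {vspace J}).
Local Notation "x ** y" := (ca_mul x y).
Local Notation T := (@ca_tr F J).
Local Notation cone0 := (cone_of (pair0 (J := J))).
Local Notation cone1 := (cone_of (pair1 (J := J))).
Local Notation cone2 := (cone_of (pair2 (J := J))).
Local Notation cone4 := (cone_of (pair4 (J := J))).

Lemma polymap_affine (U V : vectType F) (f : V -> U) (x y : V) :
  (forall a r t, f (a *: r + t) = a *: f r + f t) ->
  polymap (fun s : F^o => f (x + s *: y)).
Proof.
move=> fP; apply: (polymap_comp (psi := f)); first exact: polymap_linear.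
apply: polymapD; first exact: polymapC.
apply: (@polymapZ _ _ _ (fun s : F^o => s : F)); last exact: polymapC.
by apply: polyfun_linear.
Qed.

(** Adding [s *: n] with [n] not orthogonal to the isotropic [v] makes T(v^2) a polynomial in [s]
    whose linear coefficient is nonzero. *)
Lemma cone1_closure : cone1 `<=` zariski_closure cone0.
Proof.
move=> _ [_ [v [[[e [ie -> nv v0]] vv] ->]]].
have [n [nn tn] tvn] := null0_nondeg ie nv v0.
pose h : {poly F} := (2%:R * T (v ** n)) *: 'X + T (n ** n) *: 'X^2.
have := @curve_closure _ _ cone0 (fun s : F^o => plucker (hat e) (v + s *: n)) h _ _ _ 0.
rewrite scale0r addr0; apply.
- by apply: polymap_affine => a x y; apply: plucker_linearr.
- apply/eqP => /(congr1 (fun p : {poly F} => p`_1)).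
  rewrite coefD !coefZ coefX coefXn coef0 mulr1 mulr0 addr0 => /eqP.
  by rewrite mulf_eq0 (negPf (n2 F)) (negPf tvn).
move=> s hs; have tt : T ((v + s *: n) ** (v + s *: n)) = h.[s].
  rewrite !jmulE !jtrE vv (jtrC n v) /h hornerD !hornerZ hornerX hornerXn; ring.
exists (hat e), (v + s *: n); split=> //; split; last by rewrite tt.
case: nv => nv tv; exists e; split=> //.
  by split; [apply: nullD => //; apply: nullZ|rewrite !jtrE tv tn mulr0 addr0].
by apply: contraNneq hs => v00; rewrite -tt v00 jmul0l jtr0.
Qed.

Lemma cone24_closure X p g : pair24 X p g -> zariski_closure cone1 (plucker X p).
Proof.
case=> e [ie [nX tX] [XX X0] hp [Xp pp p0]].
have := @curve_closure _ _ cone1 (fun s : F^o => plucker X (p + s *: hat e)) 'X _ _ _ 0.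
rewrite scale0r addr0; apply; first by apply: polymap_affine => a x y; apply: plucker_linearr.
  by rewrite polyX_eq0.
move=> s; rewrite hornerX => s0.
(* For s nonzero the plane of [X] and [p + s *: hat e] contains the traceless part of this
   idempotent, since s times that part is p + s hat(e) + (g/s) X. *)
pose f := e + s^-1 *: p + (s^-1 ^+ 2 * g) *: X.
have i_f : idem1 f.
  split; last by rewrite /f !jtrE ie.2 (tr_half ie hp) tX; ring.
  by rewrite /f !jmulE ie.1 hp (half_mulC hp) nX (null_mulC nX) XX (ca_mulC p X) Xp pp; vec; field.
have fX : null f X by rewrite /null /f !jmulE nX (ca_mulC p X) Xp XX; vec; ring.
exists (hat f), (- s *: X); split.
  split; last by rewrite !jmulE XX !scaler0 jtr0.
  exists f; split=> //; last by rewrite scaler_eq0 oppr_eq0 negb_or s0.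
  by split; [apply: nullZ|rewrite jtrE tX mulr0].
have -> : plucker X (p + s *: hat e)
    = plucker (0 *: hat f + 1 *: X) (s *: hat f + (- (s^-1 * g)) *: X).
  congr plucker; first by vec; ring.
  by rewrite !hatE /f !jtrE ie.2 (tr_half ie hp) tX; vec; field.
have -> : plucker (hat f) (- s *: X) = plucker (1 *: hat f + 0 *: X) (0 *: hat f + (- s) *: X).
  by congr plucker; vec; ring.
by rewrite !plucker_comb; congr (_ *: _); ring.
Qed.

Lemma cone2_closure : cone2 `<=` zariski_closure cone1.
Proof. by move=> _ [X [p [[g _ P] ->]]]; apply: cone24_closure P. Qed.

Section Kernel.
Variables (e X : J).
Hypotheses (ie : idem1 e) (nX : null0 e X) (X0 : X != 0).

(** The product is null because its trace T((X p) z) vanishes; its difference from the multiple of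
    [X] is then tested against traceless null elements with the Clifford relation. *)
Lemma ker_mul p z : half e p -> half e z -> X ** p = 0 ->
  p ** (X ** z) = (4%:R^-1 * T (p ** z)) *: X.
Proof.
case: nX => nX' tX hp hz Xp; set k := 4%:R^-1 * _.
have pX x : T (p ** (X ** x)) = 0 by rewrite -ca_trA (ca_mulC p) Xp jmul0l jtr0.
have hXz := null_half_mul ie nX' hz.
have npz : null e (p ** (X ** z)) by rewrite /null half_mulE // pX mulr0 scale0r.
apply/eqP; rewrite -subr_eq0; apply/eqP/eqP/negPn/negP => d0.
have nd : null0 e (p ** (X ** z) - k *: X).
  split; last by rewrite !jtrE pX tX; ring.
  by apply: nullD => //; rewrite -scaleNr; apply: nullZ.
have [m [nm tm]] := null0_nondeg ie nd d0; rewrite !jmulE !jtrE ca_trA (ca_mulC _ m).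
have -> : m ** (X ** z) = (4%:R^-1 * T (X ** m)) *: z - X ** (m ** z).
  by have cl := clifford ie nX' nm tX tm hz; apply: (eq_byZ (c := 1) cl); vec; ring.
by rewrite !jmulE !jtrE pX => /eqP; apply; rewrite /k; ring.
Qed.

Lemma half_neq0 : exists2 z, half e z & z != 0.
Proof.
have := dim_half ie; case: (eqVneq (half_space e) 0%VS) => [-> d|n0 _].
  by have := ca_dim_gt0 J; move: d; rewrite dimv0; lia.
exists (vpick (half_space e)); last by rewrite vpick0.
exact/memv_half/memv_pick.
Qed.

(** In the Clifford relation for [X] and some [Y] with T(X Y) nonzero, only X(Y p) remains, and it
    is a nonzero multiple of [p]. *)
Lemma ker_preimage p : half e p -> X ** p = 0 -> exists2 z, half e z & p = X ** z.
Proof.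
case: (nX) => nX' tX hp Xp; have [Y [nY tY] tXY] := null0_nondeg ie nX X0.
have hYp := null_half_mul ie nY hp; exists ((4%:R / T (X ** Y)) *: (Y ** p)); first exact: halfZ.
have := clifford ie nX' nY tX tY hp; rewrite Xp jmul0r jmulE => cl.
by apply: (eq_byZ (c := - (4%:R / T (X ** Y))) cl); vec; field.
Qed.

(** If T((X z) z) vanished for all [z] in the 1/2-space, polarization would make [X] act as zero
    there, against the Clifford relation. Otherwise a multiple of [X ** z] has square [X] by
    [ker_mul], with the normalization taken from a square root. *)
Lemma exists_ker_square : X ** X = 0 -> exists p, [/\ half e p, X ** p = 0 & p ** p = X].
Proof.
case: (nX) => nX' tX XX; have XXz z : half e z -> X ** (X ** z) = 0.
  by move=> hz; rewrite (clifford_sq ie nX' tX hz) XX jtr0 mulr0 scale0r.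
have [z hz tz] : exists2 z, half e z & T ((X ** z) ** z) != 0.
  apply: contrapT => no; have Q0 z : half e z -> T ((X ** z) ** z) = 0.
    by move=> hz; apply/eqP/negPn/negP => ?; apply: no; exists z.
  have [z hz z0] := half_neq0; have [Y [nY tY] tXY] := null0_nondeg ie nX X0.
  have hYz := null_half_mul ie nY hz.
  have X0' y : half e y -> X ** y = 0.
    move=> hy; apply/eqP/negPn/negP => Xy; have [y' hy' ty'] := half_nondeg ie (null_half_mul ie nX' hy) Xy.
    have := Q0 _ (halfD hy hy'); rewrite !jmulE !jtrE (Q0 y hy) (Q0 y' hy').
    have -> : T (X ** y' ** y) = T (X ** y ** y') by rewrite !ca_trA (ca_mulC y).
    by move=> e1; case/negP: ty'; apply/eqP; apply: (eq_by_scaled (c := 2%:R^-1) e1); field.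
  have := clifford ie nX' nY tX tY hz; rewrite (X0' _ hz) (X0' _ hYz) jmul0r addr0 => /esym/eqP.
  by rewrite scaler_eq0 (negPf z0) orbF mulf_eq0 invr_eq0 pnatr_eq0 (negPf tXY).
have hXz := null_half_mul ie nX' hz; set k := T _ in tz.
pose s := sqrtC (4%:R^-1 * k); have s2 : s ^+ 2 = 4%:R^-1 * k by rewrite sqrtCK.
have s0 : s != 0 by rewrite sqrtC_eq0 mulf_neq0 // invr_eq0 pnatr_eq0.
exists (s^-1 *: (X ** z)); split; first exact: halfZ.
  by rewrite jmulE XXz // scaler0.
rewrite !jmulE (ker_mul hXz hz (XXz z hz)) -/k -s2.
by vec; field.
Qed.

End Kernel.

(** Moving [p] towards some [p'] with square [X] stays in the kernel of [X] and makes the square a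
    multiple of [X] that is nonzero for generic [s]. *)
Lemma cone4_closure2 : cone4 `<=` zariski_closure cone2.
Proof.
move=> _ [X [p [[e [ie nX [XX X0] hp [Xp pp p0]]] ->]]].
have [p' [hp' Xp' pp']] := exists_ker_square ie nX X0 XX.
have [z hz p'E] := ker_preimage ie nX X0 hp' Xp'.
pose k := 4%:R^-1 * T (p ** z); have pp'k : p ** p' = k *: X by rewrite p'E (ker_mul ie nX hp hz Xp).
pose h : {poly F} := (2%:R * k) *: 'X + 'X^2.
have := @curve_closure _ _ cone2 (fun s : F^o => plucker X (p + s *: p')) h _ _ _ 0.
rewrite scale0r addr0; apply; first by apply: polymap_affine => a x y; apply: plucker_linearr.
  apply/eqP => /(congr1 (fun q : {poly F} => q`_2)).
  by rewrite coefD coefZ coefX coefXn coef0 mulr0 add0r => /eqP; rewrite oner_eq0.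
move=> s hs; have sq : (p + s *: p') ** (p + s *: p') = h.[s] *: X.
  by rewrite !jmulE pp pp' (ca_mulC p' p) pp'k /h hornerD hornerZ hornerX hornerXn; vec; ring.
exists X, (p + s *: p'); split=> //; exists h.[s] => //; exists e; split=> //.
  by apply: halfD => //; apply: halfZ.
split=> //; first by rewrite !jmulE Xp Xp' scaler0 addr0.
apply: contraNneq hs => e0; move/eqP: sq; rewrite e0 jmul0l eq_sym scaler_eq0 (negPf X0) orbF.
by [].
Qed.

Local Notation B := (vbasis {:J}).

Lemma basis_nz (W : vectType F) (f : J -> W) x :
  (forall a x y, f (a *: x + y) = a *: f x + f y) -> f x != 0 -> exists i : 'I_(\dim {:J}), f B`_i != 0.
Proof.
move=> /linear_lfun[g gE]; rewrite -gE => gx; apply: contrapT => no; move/eqP: gx; apply.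
rewrite (coords_sum x) linear_sum big1 // => i _; rewrite linearZ /= gE.
by have [->|/eqP h] := eqVneq (f B`_i) 0; rewrite ?scaler0 //; case: no; exists i; apply/eqP.
Qed.

Lemma basis_tr x : x != 0 -> exists i : 'I_(\dim {:J}), T (B`_i ** x) != 0.
Proof.
move=> /nondegW[y]; rewrite jtrC => ty.
by apply: (basis_nz (W := F^o) (f := fun y => T (y ** x)) (x := y)) => // a y1 y2; rewrite !jmulE !jtrE.
Qed.

Lemma ctr_linearr a w x y : ctr w (a *: x + y) = a *: ctr w x + ctr w y :> J.
Proof.
rewrite /ctr scaler_sumr -big_split; apply: eq_bigr => i _ /=.
rewrite scaler_sumr -big_split; apply: eq_bigr => j _ /=.
by rewrite !jmulE !jtrE scalerA -scalerDl; congr (_ *: _); ring.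
Qed.

Lemma polymap_ctr2 (U : vectType F) (f : U -> 'M[F]_(\dim {:J})) (g : U -> J) :
  polymap f -> polymap g -> polymap (fun t => ctr (f t) (g t)).
Proof.
by apply: polymap_bilinear => [a x x' y|a x y y']; [apply: ctr_linearl|apply: ctr_linearr].
Qed.

Section Pair01Contraction.
Variables (e v : J).
Hypotheses (ie : idem1 e) (nv : null0 e v).
Let w := plucker (hat e) v.

Lemma tr_hat_hat : T (hat e ** hat e) = 2%:R / 3%:R.
Proof. by rewrite {2}hatE !jmulE !jtrE tr_hat_e // tr_hat; ring. Qed.

Lemma tr_hat_null : T (hat e ** v) = 0.
Proof. by rewrite (hat_mul_null nv.1) jtrE nv.2 mulr0. Qed.

(** Contraction acts on the plane as a traceless operator whose square is minus the Gram determinant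
    of the basis, here 2/3 T(v^2). *)
Lemma ctr_cube y : ctr w (ctr w (ctr w y)) = (- (2%:R / 3%:R) * T (v ** v)) *: ctr w y.
Proof.
have := tr_hat_null; have := tr_hat_hat; rewrite /w; move: (hat e) => u uu uv.
rewrite !ctr_plucker !jmulE !jtrE (ca_mulC v u) uu uv.
by vec; ring.
Qed.

Lemma tr_ctr_sq y : T (ctr w y ** ctr w y) =
  (T (y ** hat e)) ^+ 2 * T (v ** v) + (2%:R / 3%:R) * (T (y ** v)) ^+ 2.
Proof.
rewrite /w ctr_plucker !jmulE !jtrE (jtrC v (hat e)) tr_hat_null tr_hat_hat.
by ring.
Qed.

End Pair01Contraction.

Lemma ctr_neq0 u v : indep2 u v -> exists i j : 'I_(\dim {:J}), T (B`_i ** ctr (plucker u v) B`_j) != 0.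
Proof.
move=> uv; have v0 : v != 0.
  apply/eqP => v0; have [|_ /eqP] := uv 0 1; first by rewrite v0 scaler0 scale0r addr0.
  by rewrite oner_eq0.
have [y yE] : exists y, v = ctr (plucker u v) y.
  by apply: ctr_onto => //; apply/mem_span2; exists 0, 1; rewrite scale1r scale0r add0r.
have [|j cj] := basis_nz (f := ctr (plucker u v)) (x := y) (ctr_linearr^~ _); first by rewrite -yE.
by case: (basis_tr cj) => i ti; exists i, j.
Qed.

(** Type 1 is separated from type 0 by degeneracy of the trace form on the line, which is the
    vanishing of the triple contraction. *)
Lemma rank_cone1 n : rank_ge cone1 n -> rank_ge cone0 n.+1.
Proof.
apply: (@rank_ge_strict _ _ _ _ _ ('I_(\dim {:J}) * 'I_(\dim {:J}))%type
  (fun ij w => T (B`_ij.1 ** ctr w (ctr w (ctr w B`_ij.2)))) cone1_closure).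
- move=> ij; apply: polyfun_tr; apply: polymap_jmul; first exact: polymapC.
  by do 3! (apply: polymap_ctr2; first exact: polymap_id); exact: polymapC.
- move=> [i j] _ [_ [v [[[e [ie -> nv _]] vv] ->]]] /=.
  by rewrite ctr_cube // vv mulr0 scale0r jmul0r jtr0.
move=> _ [u [v [[P vv] ->]]]; have [i [j tij]] := ctr_neq0 (pair01_indep P).
case: P => e [ie ue nv _]; exists (i, j); rewrite /= ue ctr_cube // -ue !jmulE !jtrE.
by rewrite !mulf_neq0 ?oppr_eq0 ?invr_eq0 ?pnatr_eq0 // mulf_neq0 ?invr_eq0 ?pnatr_eq0.
Qed.

(** The trace form vanishes identically on a line of type 2, but not on one of type 1. *)
Lemma rank_cone2 n : rank_ge cone2 n -> rank_ge cone1 n.+1.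
Proof.
apply: (@rank_ge_strict _ _ _ _ _ 'I_(\dim {:J}) (fun j w => T (ctr w B`_j ** ctr w B`_j)) cone2_closure).
- by move=> j; apply: polyfun_tr; apply: polymap_jmul; apply: polymap_ctr; exact: polymap_id.
- move=> j _ [X [p [[g _ [e [ie [nX tX] [XX X0] hp [Xp pp p0]]]] ->]]].
  rewrite ctr_plucker !jmulE !jtrE XX pp (ca_mulC p X) Xp !jtrE tX; ring.
move=> _ [_ [v [[[e [ie -> nv v0]] vv] ->]]]; have [j tj] := basis_tr v0; exists j.
by rewrite tr_ctr_sq // vv mulr0 add0r !mulf_neq0 ?invr_eq0 ?pnatr_eq0 ?expf_neq0.
Qed.

(** All squares of elements of the line vanish in type 4, but not in type 2. *)
Lemma rank_cone4 n : rank_ge cone4 n -> rank_ge cone2 n.+1.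
Proof.
apply: (@rank_ge_strict _ _ _ _ _ ('I_(\dim {:J}) * 'I_(\dim {:J}))%type
  (fun ij w => T (B`_ij.1 ** (ctr w B`_ij.2 ** ctr w B`_ij.2))) cone4_closure2).
- move=> ij; apply: polyfun_tr; apply: polymap_jmul; first exact: polymapC.
  by apply: polymap_jmul; apply: polymap_ctr; exact: polymap_id.
- move=> ij _ [X [p [[e [ie [nX tX] [XX X0] hp [Xp pp p0]]] ->]]].
  by rewrite ctr_plucker !jmulE !jtrE XX pp (ca_mulC p X) Xp !jmulE !jtrE; ring.
move=> _ [X [p [[g g0 [e [ie [nX tX] [XX X0] hp [Xp pp p0]]]] ->]]].
have [j tj] := basis_tr X0; exists (j, j) => /=.
rewrite ctr_plucker !jmulE !jtrE XX pp (ca_mulC p X) Xp !jmulE !jtrE.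
rewrite (_ : _ + _ = T (B`_j ** X) ^+ 3 * g); last by ring.
by rewrite mulf_neq0 ?expf_neq0.
Qed.

End Cones.

(** * Dimension of the variety of reductions *)

Section UpperBound.
Variables (F : numClosedFieldType) (J : cubicAlgebra F).
Implicit Types (u v x y z e p X : J) (a b c : F) (L : {vspace J}).
Local Notation "x ** y" := (ca_mul x y).
Local Notation T := (@ca_tr F J).
Local Notation "1j" := (ca_one J) (at level 0).
Local Notation B := (vbasis {:J}).

Definition grid_vec (t : 'I_(\dim {:J}) -> F) : J := \sum_i t i *: B`_i.

Lemma grid_vec_coords x : grid_vec (coords x) = x.
Proof. by rewrite [RHS]coords_sum. Qed.

Lemma deg_le_grid_tr x : deg_le 1 (fun t => T (grid_vec t ** x)).
Proof.
have E t : T (grid_vec t ** x) = \sum_i t i * T (B`_i ** x).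
  by rewrite /grid_vec ca_mulC jmul_sumr tr_sum; apply: eq_bigr => i _; rewrite !jmulE !jtrE ca_mulC.
move=> i t; have [q sq qE] := deg_le_sum (index_enum _)
  (fun j => deg_leM (deg_le_coord j) (deg_leC (n := \dim {:J}) 0 (T (B`_j ** x)))) i t.
by exists q => // s; rewrite E qE.
Qed.

(** The contraction of a bivector of traceless vectors with [y] lands here; two linear conditions
    leave the dimension 3a + 1. *)
Definition section_space y : {vspace J} :=
  (kerv (fun x => T x : F^o) :&: kerv (fun x => T (y ** x) : F^o))%VS.

Lemma memv_section y x : (x \in section_space y) = (T x == 0) && (T (y ** x) == 0).
Proof. by rewrite memv_cap !memv_kerv // => a x1 x2; rewrite ?jmulE !jtrE. Qed.

Lemma dim_section e y : T (y ** hat e) != 0 -> \dim (section_space y) = (3 * ca_dim J + 1)%N.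
Proof.
move=> ty; have d1 : \dim {:J} = (\dim (kerv (fun x : J => T x : F^o))).+1.
  apply: (@dim_cap_functional _ _ _ _ T) => [a x1 x2|x|].
  - by rewrite !jtrE.
  - by rewrite memvf memv_kerv // => a x1 x2; rewrite !jtrE.
  - by exists 1j; rewrite ?memvf // ca_tr1 n3.
have d2 : \dim (kerv (fun x : J => T x : F^o)) = (\dim (section_space y)).+1.
  apply: (@dim_cap_functional _ _ _ _ (fun x => T (y ** x))) => [a x1 x2|x|].
  - by rewrite !jmulE !jtrE.
  - by rewrite memv_section memv_kerv // => a x1 x2; rewrite !jtrE.
  - exists (hat e) => //; rewrite memv_kerv; first by rewrite tr_hat.
    by move=> a x1 x2; rewrite !jtrE.
have := ca_dimE J; lia.
Qed.

(* A point w of the cone is recovered from [c := ctr w y], as [u /\ hat u^2]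
   with u proportional to c, as soon as c generates the subalgebra. *)
Lemma cone0_param e v y : idem1 e -> null0 e v ->
  let D := T (y ** hat e) * (2%:R^-1 * T (v ** v) * T (y ** hat e) ^+ 2 - T (y ** v) ^+ 2) in
  D != 0 -> exists2 x, x \in section_space y & plucker (hat e) v = plucker x (hat (x ** x)).
Proof.
move=> ie [nv tv] D D0; set be := T (y ** hat e) in D D0; set al := T (y ** v) in D D0.
(* A cube root, since the bivector of [x] and [hat (x ** x)] is homogeneous of degree 3 in [x]. *)
have k3 := @rootCK F 3 isT D^-1; set k := 3.-root D^-1 in k3.
exists (k *: ctr (plucker (hat e) v) y).
  rewrite memv_section ctr_plucker -/be -/al !jmulE !jtrE tr_hat tv -/be -/al.
  by apply/andP; split; apply/eqP; ring.
have -> : k *: ctr (plucker (hat e) v) y = (k * - al) *: hat e + (k * be) *: v.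
  by rewrite ctr_plucker -/be -/al; vec; ring.
rewrite (pair01_mul ie nv tv) plucker_comb -[LHS]scale1r; congr (_ *: _).
have kD : k ^+ 3 * D = 1 by rewrite k3 mulVf.
by apply: (eq_by_scaled (c := -1) kD); rewrite /D; field.
Qed.

(** A finite set of [y] suffices for the parametrization: [D] has degree at most 3 in each
    coordinate of [y], so it is nonzero somewhere on the grid with coordinates 0 to 3. *)
Lemma rank_cone0_leq n : rank_ge (cone_of (pair0 (J := J))) n -> (n <= 3 * ca_dim J + 1)%N.
Proof.
pose I := {ffun 'I_(\dim {:J}) -> 'I_4}.
pose y (b : I) : J := grid_vec (fun i => (b i)%:R).
(* The zero space is a default for those [y] whose section is too large; they are orthogonal to
   every [hat e] and are never selected. *)
pose W (b : I) : {vspace J} := if (\dim (section_space (y b)) <= 3 * ca_dim J + 1)%N then section_space (y b) else 0%VS.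
pose phi (b : I) (u : subvs_of (W b)) : 'M[F]_(\dim {:J}) := plucker (vsval u) (hat (vsval u ** vsval u)).
apply: (@rank_ge_leq _ _ _ _ _ I (fun b : I => subvs_of (W b)) phi) => [b|b|].
- have vP : polymap (fun u : subvs_of (W b) => vsval u) by apply: polymap_linear => a x1 x2; rewrite linearP.
  by apply: polymap_plucker => //; apply: polymap_hat; apply: polymap_jmul.
- by rewrite dimvf /dim /= /W; case: ifP => //; rewrite dimv0.
move=> _ [_ [v [[[e [ie -> nv v0]] vv] ->]]].
pose D t := T (grid_vec t ** hat e) *
  (2%:R^-1 * T (v ** v) * T (grid_vec t ** hat e) ^+ 2 - T (grid_vec t ** v) ^+ 2).
have Dd : deg_le 3 D.
  have h1 := deg_le_grid_tr (hat e); have h2 := deg_le_grid_tr v.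
  move=> i t; have [q sq qE] := deg_leM h1 (deg_leD (deg_leM (deg_leC 0 (2%:R^-1 * T (v ** v))) (deg_leX 2 h1))
    (deg_leM (deg_leC 0 (-1)) (deg_leX 2 h2))) i t.
  by exists q => // s; rewrite /D -mulN1r qE.
have [b Db] : exists b : I, D (fun i => (b i)%:R) != 0.
  (* [D] does not vanish identically: at y = [hat e] the pairing with [v] is 0, while T(hat(e)^2)
     and T(v^2) are nonzero. *)
  apply: contrapT => no; have : D (coords (hat e)) = 0.
    apply: (deg_le_grid _ Dd) => [t t' tt'|b].
      have -> : t = t' by apply: funext.
      by [].
    by apply/eqP/negPn/negP => h; apply: no; exists b.
  rewrite /D grid_vec_coords tr_hat_hat // tr_hat_null // expr0n subr0 => /eqP.
  by rewrite !mulf_eq0 !invr_eq0 (negPf vv) !pnatr_eq0.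
have [x xS wE] := cone0_param ie nv Db.
have xW : x \in W b.
  rewrite /W (@dim_section e) ?leqnn //; apply: contraNneq Db => h.
  by rewrite /D -/(y b) h mul0r.
by exists b, (vsproj (W b) x); rewrite /phi vsprojK.
Qed.

End UpperBound.

(** * Curves of automorphisms and tangent vectors to the orbits *)

Section Orbits.
Variables (F : numClosedFieldType) (J : cubicAlgebra F).
Implicit Types (u v x y z e f p X : J) (a c : F) (L : {vspace J}).
Local Notation "x ** y" := (ca_mul x y).
Local Notation T := (@ca_tr F J).

(** The factor [k] makes the set stable under scaling of the second vector, as [plucker_cone_of]
    requires. *)
Definition orbit_pair u v u' v' : Prop :=
  exists (g : 'End(J)) (k : F), [/\ automorph g, k != 0, u' = g u & v' = k *: g v].

Lemma orbit_pair_indep u v : indep2 u v -> forall u' v', orbit_pair u v u' v' -> indep2 u' v'.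
Proof.
move=> uv u' v' [g [k [ag k0 -> ->]]] a b e1; have [|a0 /eqP] := uv a (b * k).
  by apply: (aut_inj ag); rewrite linear0 linearD !linearZ /= -scalerA.
by rewrite mulf_eq0 (negPf k0) orbF => /eqP.
Qed.

Lemma cone_orbit u v : indep2 u v -> plucker_cone (lines_of (orbit_pair u v)) = cone_of (orbit_pair u v).
Proof.
move=> uv; apply: plucker_cone_of; first exact: orbit_pair_indep.
move=> k u' v' k0 [g [k' [ag k'0 -> ->]]]; exists g, (k * k'); split=> //; first by rewrite mulf_neq0.
by rewrite scalerA.
Qed.

Lemma aut_hat (g : 'End(J)) x : automorph g -> g (hat x) = hat (g x).
Proof. by move=> ag; rewrite !hatE linearB linearZ /= aut1 // aut_tr. Qed.

Lemma aut_null0 (g : 'End(J)) e x : automorph g -> null0 e x -> null0 (g e) (g x).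
Proof. by move=> ag [nx tx]; split; [apply: aut_null|rewrite aut_tr]. Qed.

Lemma aut_neq0 (g : 'End(J)) x : automorph g -> x != 0 -> g x != 0.
Proof. by move=> ag; apply: contraNneq; rewrite -[X in _ = X](linear0 g) => /(aut_inj ag)->. Qed.

Lemma aut_pair01 (g : 'End(J)) u v : automorph g -> pair01 u v -> pair01 (g u) (g v).
Proof.
move=> ag [e [ie -> nv v0]]; exists (g e); split; first exact: aut_idem1.
- exact: aut_hat.
- exact: aut_null0.
- exact: aut_neq0.
Qed.

Lemma aut_pair24 (g : 'End(J)) X p c : automorph g -> pair24 X p c -> pair24 (g X) (g p) c.
Proof.
move=> ag [e [ie nX [XX X0] hp [Xp pp p0]]]; exists (g e); split.
- exact: aut_idem1.
- exact: aut_null0.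
- by rewrite -autM // XX linear0; split=> //; apply: aut_neq0.
- exact: aut_half.
- by rewrite -!autM // Xp pp linear0 linearZ; split=> //; apply: aut_neq0.
Qed.

Lemma orbit_cone0 u v : pair0 u v -> cone_of (orbit_pair u v) `<=` cone_of (pair0 (J := J)).
Proof.
move=> [P vv] _ [u' [v' [[g [k [ag k0 -> ->]]] ->]]]; exists (g u), (k *: g v); split=> //; split.
  by apply: pair01_scale => //; apply: aut_pair01.
by rewrite !jmulE !jtrE -autM // aut_tr // !mulf_neq0.
Qed.

Lemma orbit_cone1 u v : pair1 u v -> cone_of (orbit_pair u v) `<=` cone_of (pair1 (J := J)).
Proof.
move=> [P vv] _ [u' [v' [[g [k [ag k0 -> ->]]] ->]]]; exists (g u), (k *: g v); split=> //; split.
  by apply: pair01_scale => //; apply: aut_pair01.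
by rewrite !jmulE !jtrE -autM // aut_tr // vv !mulr0.
Qed.

Lemma orbit_cone2 u v : pair2 u v -> cone_of (orbit_pair u v) `<=` cone_of (pair2 (J := J)).
Proof.
move=> [c c0 P] _ [u' [v' [[g [k [ag k0 -> ->]]] ->]]]; exists (g u), (k *: g v); split=> //.
exists (k ^+ 2 * c); first by rewrite mulf_neq0 ?expf_neq0.
by apply: pair24_scale => //; apply: aut_pair24.
Qed.

Lemma orbit_cone4 u v : pair4 u v -> cone_of (orbit_pair u v) `<=` cone_of (pair4 (J := J)).
Proof.
move=> P _ [u' [v' [[g [k [ag k0 -> ->]]] ->]]]; exists (g u), (k *: g v); split=> //.
by have := pair24_scale k0 (aut_pair24 ag P); rewrite mulr0.
Qed.

(* D is the derivative at 0 of a curve of multiples of automorphisms. *)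
Definition opcurve (D : J -> J) : Prop :=
  (forall a x y, D (a *: x + y) = a *: D x + D y) /\
  exists (R : F^o -> J -> J) (h : {poly F}),
  [/\ h != 0, forall gamma : F^o -> J, polymap gamma -> polymap (fun s => R s (gamma s))
    & forall s, h.[s] != 0 -> exists (g : 'End(J)) (k : F), [/\ automorph g, k != 0
        & forall x, x + s *: D x + s ^+ 2 *: R s x = k *: g x]].

Lemma polyfun_id : polyfun (fun s : F^o => s : F).
Proof. exact: polyfun_linear. Qed.

Lemma polyfun_exp n : polyfun (fun s : F^o => (s : F) ^+ n).
Proof. by apply: (polyfunX (f := fun s : F^o => s : F)); apply: polyfun_id. Qed.

Lemma polymap_of_linear (U : vectType F) (D : J -> J) (gamma : U -> J) :
  (forall a x y, D (a *: x + y) = a *: D x + D y) -> polymap gamma -> polymap (fun t => D (gamma t)).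
Proof. by move=> Dl; apply: (polymap_comp (psi := D)); apply: polymap_linear. Qed.

Ltac polym := repeat first [assumption | exact: polymapC | exact: polymap_id | exact: polyfun_id
  | exact: polyfun_exp | apply: polymapD | apply: polymapN
  | apply: polymapZ | apply: polymap_jmul | apply: polyfun_tr
  | apply: polyfunM | apply: polyfunD | apply: polyfunN | exact: polyfunC ].

(** For the composite of two such curves the first-order terms add, and everything else goes into
    the remainder. *)
Lemma opcurveD D D' : opcurve D -> opcurve D' -> opcurve (fun x => D x + D' x).
Proof.
move=> [Dl [R [h [h0 RP curve]]]] [Dl' [R' [h' [h'0 RP' curve']]]].
split=> [a x y|]; first by rewrite Dl Dl'; vec; ring.
exists (fun s x => D (D' x) + s *: D (R' s x) + R s (x + s *: D' x + s ^+ 2 *: R' s x) + R' s x), (h * h').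
split; first by rewrite mulf_neq0.
  move=> gamma gP; have gP' := polymap_of_linear Dl' gP; have RgP := RP' _ gP.
  apply: polymapD => //; apply: polymapD.
    apply: polymapD; first exact: polymap_of_linear.
    by apply: (polymapZ polyfun_id); apply: polymap_of_linear.
  apply: (RP (fun s => gamma s + s *: D' (gamma s) + s ^+ 2 *: R' s (gamma s))).
  apply: polymapD; last exact: (polymapZ (polyfun_exp 2)).
  by apply: polymapD => //; apply: (polymapZ polyfun_id).
move=> s; rewrite hornerM mulf_eq0 negb_or => /andP[/curve[g [k [ag k0 E1]]] /curve'[g' [k' [ag' k'0 E2]]]].
exists (g \o g')%VF, (k * k'); split; [exact: aut_comp|by rewrite mulf_neq0|move=> x].
have DD y z : D (y + z) = D y + D z by have := Dl 1 y z; rewrite !scale1r.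
have D0 : D 0 = 0 by have := Dl (-1) 0 0; rewrite scaler0 addr0 scaleN1r addNr.
have DZ c y : D (c *: y) = c *: D y by have := Dl c y 0; rewrite D0 !addr0.
have <- : k *: g (x + s *: D' x + s ^+ 2 *: R' s x) = (k * k') *: (g \o g')%VF x.
  by rewrite E2 comp_lfunE linearZ scalerA.
by rewrite -E1 !(DD, DZ); vec; ring.
Qed.

Lemma opcurve_scale c : opcurve (fun x => c *: x).
Proof.
split=> [a x y|]; first by vec; ring.
exists (fun _ _ => 0), (1 + c *: 'X); split=> [|gamma _|s hs].
- apply/eqP => /(congr1 (fun p : {poly F} => p`_0)).
  by rewrite coefD coef1 coefZ coefX mulr0 addr0 coef0 => /eqP; rewrite oner_eq0.
- exact: polymapC.
exists \1%VF, (1 + c *: 'X).[s]; split=> // [|x].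
  by split=> [|x y]; rewrite ?lker0_id // ?id_lfunE //; apply/eqP/lker0P => x y; rewrite !id_lfunE.
by rewrite id_lfunE hornerD hornerZ hornerX hornerC; vec; ring.
Qed.

(** This operator is -8 times the inner derivation [L_e, L_x], when [e] is an idempotent of trace 1
    and [x] lies in its 1/2-space. *)
Definition peirce_delta e x y : J := let z := reflection e y in
  (4%:R * T (x ** z)) *: e + (4%:R * T (e ** z)) *: x - 4%:R *: (x ** z).

Lemma peirce_delta_linear e x a y y' :
  peirce_delta e x (a *: y + y') = a *: peirce_delta e x y + peirce_delta e x y'.
Proof. by rewrite /peirce_delta !reflection_linear !jmulE !jtrE; vec; ring. Qed.

(* The composite of the reflection in e and of the one in the rank one element
   e + s x + O(s^2). *)
Lemma opcurve_peirce e x : idem1 e -> half e x -> opcurve (peirce_delta e x).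
Proof.
move=> ie hx; split; first exact: peirce_delta_linear.
pose q := 2%:R^-1 * T (x ** x); pose c := x ** x - q *: e.
pose R (s : F) y : J := let z := reflection e y in
  (2%:R * q + s ^+ 2 * q * q) *: z
  - 4%:R *: (c ** z + q *: ((e + s *: x + s ^+ 2 *: c) ** z))
  + (4%:R * T (e ** z)) *: c + (4%:R * T (x ** z)) *: (x + s *: c)
  + (4%:R * T (c ** z)) *: (e + s *: x + s ^+ 2 *: c).
exists R, (1 + q *: 'X^2); split.
- apply/eqP => /(congr1 (fun p : {poly F} => p`_0)).
  by rewrite coefD coef1 coefZ coefXn mulr0 addr0 coef0 => /eqP; rewrite oner_eq0.
- move=> gamma gP; have zP : polymap (fun s => reflection e (gamma s)).
    by apply: polymap_of_linear => // a y y'; apply: reflection_linear.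
  rewrite /R; clearbody c q; polym.
move=> s; rewrite hornerD hornerC hornerZ hornerXn => r0.
pose r := chart e (s *: x).
have rE : r = e + s *: x + s ^+ 2 *: c by rewrite /r /chart /c /q !jmulE !jtrE; vec; ring.
have rr : rank1 r by apply: chart_rank1 => //; apply: halfZ.
have tr : T r = 1 + q * s ^+ 2.
  by rewrite /r tr_chart //; [rewrite /q !jmulE !jtrE; ring|apply: halfZ].
clearbody r; have trn : T r != 0 by rewrite tr.
have i_f : idem1 ((T r)^-1 *: r).
  by split; [rewrite !jmulE rr; vec; field|rewrite jtrE mulVf].
have [g ag gE] := aut_reflection i_f; have [g' ag' gE'] := aut_reflection ie.
exists (g \o g')%VF, (T r ^+ 2); split; [exact: aut_comp|by rewrite expf_neq0|move=> y].
rewrite comp_lfunE gE' gE -{1}[y](reflectionK ie) /peirce_delta /R.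
move: (reflection e y) => z; rewrite {1}/reflection {1}/reflection !jmulE !jtrE.
have -> : T r ^+ 2 *: (z - 4%:R *: ((T r)^-1 *: (r ** z)) + (4%:R * ((T r)^-1 * T (r ** z))) *: ((T r)^-1 *: r))
   = T r ^+ 2 *: z - (4%:R * T r) *: (r ** z) + (4%:R * T (r ** z)) *: r by vec; field.
rewrite tr rE !jmulE !jtrE; clearbody c q.
by vec; ring.
Qed.

(** The first-order change of the bivector is given by the Leibniz rule, so its injectivity in [t]
    bounds the rank by the number of parameters. The scalar of the operator curve enters squared and
    is absorbed by the factor in [orbit_pair]. *)
Lemma rank_orbit_jets (U : vectType F) (Delta : U -> J -> J) u v :
  (forall a t t' x, Delta (a *: t + t') x = a *: Delta t x + Delta t' x) ->
  (forall t, opcurve (Delta t)) ->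
  (forall t, plucker (Delta t u) v + plucker u (Delta t v) = 0 -> t = 0) ->
  rank_ge (cone_of (orbit_pair u v)) (\dim {:U}).
Proof.
move=> Dl Dop Dinj.
apply: (@rank_ge_jets _ _ _ _ (plucker u v) (fun t => plucker (Delta t u) v + plucker u (Delta t v))) => //.
  by move=> a t t'; rewrite !Dl plucker_linearl plucker_linearr; vec; ring.
move=> t; have [Dlin [R [h [h0 RP curve]]]] := Dop t.
have PD x x' y : plucker (x + x') y = plucker x y + plucker x' y.
  by have := plucker_linearl 1 x x' y; rewrite !scale1r.
have PD' x y y' : plucker x (y + y') = plucker x y + plucker x y'.
  by have := plucker_linearr 1 x y y'; rewrite !scale1r.
have P0 y : plucker 0 y = 0 :> 'M[F]_(\dim {:J}).
  by have := plucker_linearl (-1) 0 0 y; rewrite scaler0 addr0 scaleN1r addNr.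
have P0' y : plucker y 0 = 0 :> 'M[F]_(\dim {:J}).
  by have := plucker_linearr (-1) y 0 0; rewrite scaler0 addr0 scaleN1r addNr.
have PZ a x y : plucker (a *: x) y = a *: plucker x y by have := plucker_linearl a x 0 y; rewrite P0 !addr0.
have PZ' a x y : plucker x (a *: y) = a *: plucker x y by have := plucker_linearr a x y 0; rewrite P0' !addr0.
exists h, (fun s => plucker (Delta t u) (Delta t v) + plucker (R s u) (v + s *: Delta t v + s ^+ 2 *: R s v)
   + plucker (u + s *: Delta t u) (R s v)); split=> //.
  have Ru := RP _ (polymapC _ u); have Rv := RP _ (polymapC _ v).
  apply: polymapD; first (apply: polymapD; first exact: polymapC).
    apply: polymap_plucker => //; apply: polymapD; last exact: (polymapZ (polyfun_exp 2)).
    by apply: polymapD; [exact: polymapC|apply: (polymapZ polyfun_id); exact: polymapC].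
  apply: polymap_plucker => //.
  by apply: polymapD; [exact: polymapC|apply: (polymapZ polyfun_id); exact: polymapC].
move=> s /curve[g [k [ag k0 E]]]; exists (g u), ((k * k) *: g v); split.
  by exists g, (k * k); split=> //; rewrite mulf_neq0.
transitivity (plucker (k *: g u) (k *: g v)); last by rewrite PZ !PZ' scalerA.
rewrite -!E !(PD, PD', PZ, PZ').
by vec; ring.
Qed.

End Orbits.

(** * Dimension of the orbits *)

Lemma dim_subvs (F : fieldType) (V : vectType F) (A : {vspace V}) : \dim {:subvs_of A} = \dim A.
Proof. by rewrite dimvf. Qed.

Lemma dim_prod (F : fieldType) (U V : vectType F) :
  \dim {:(U * V)%type} = (\dim {:U} + \dim {:V})%N.
Proof. by rewrite !dimvf. Qed.

Section LowerBound01.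
Variables (F : numClosedFieldType) (J : cubicAlgebra F).
Implicit Types (u v w x y z e f p X : J) (a c : F).
Local Notation "x ** y" := (ca_mul x y).
Local Notation T := (@ca_tr F J).
Local Notation "1j" := (ca_one J) (at level 0).

Lemma peirce_delta_linearl e a x x' y :
  peirce_delta e (a *: x + x') y = a *: peirce_delta e x y + peirce_delta e x' y.
Proof. by rewrite /peirce_delta !jmulE !jtrE; vec; ring. Qed.

Lemma null0_proj e y : idem1 e -> exists2 m, null0 e m & forall x, null0 e x -> T (m ** x) = T (y ** x).
Proof.
move=> ie; rewrite (peirce e y); move: (half_partP ie y) (null_partP ie y).
move: (T (e ** y)) (half_part e y) (null_part e y) => k h n hh nn.
exists (n - (2%:R^-1 * T n) *: (1j - e)).
  split; last by rewrite !jtrE ie.2; field.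
  by apply: nullD => //; rewrite -scaleNr; apply: nullZ; apply: null_unit.
move=> x [nx tx]; rewrite !jmulE !jtrE (nx : e ** x = 0) jtr0 tx (jtrC h) (tr_null_half nx hh).
by ring.
Qed.

(** One of [m], [v], [m + v] is neither isotropic nor orthogonal to [v]. The norm is set to 2
    because then the square of [b] is [1j - e]. *)
Lemma exists_unit_pairing e v : idem1 e -> null0 e v -> v != 0 ->
  exists b, [/\ null0 e b, T (b ** b) = 2%:R & T (b ** v) != 0].
Proof.
move=> ie nv v0; have [w nw [ww wv]] : exists2 w, null0 e w & T (w ** w) != 0 /\ T (w ** v) != 0.
  have [m nm tm] := null0_nondeg ie nv v0; rewrite jtrC in tm.
  have [mm|mm] := eqVneq (T (m ** m)) 0; last by exists m.
  have [vv|vv] := eqVneq (T (v ** v)) 0; last by exists v.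
  exists (m + v); first by case: nm nv => nm tm' [nv tv]; split; [apply: nullD|rewrite jtrD tm' tv addr0].
  by rewrite !jmulE !jtrE mm vv (jtrC v m) addr0 add0r -mulr2n mulrn_eq0.
pose s := sqrtC (2%:R / T (w ** w)); have s2 : s * s = 2%:R / T (w ** w) by rewrite -expr2 sqrtCK.
have s0 : s != 0 by apply/eqP => s0; move/eqP: s2; rewrite s0 mulr0 eq_sym mulf_eq0 invr_eq0 (negPf (n2 F)) (negPf ww).
exists (s *: w); case: nw => nw tw; split.
- by split; [apply: nullZ|rewrite jtrE tw mulr0].
- by rewrite !jmulE !jtrE mulrA s2 divfK.
- by rewrite !jmulE !jtrE mulf_neq0.
Qed.

Section UnitVector.
Variables (e b : J).
Hypotheses (ie : idem1 e) (nb : null0 e b) (bb : T (b ** b) = 2%:R).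

(** An element [b] of norm 2 splits [1j - e] into two orthogonal idempotents, and this is one of
    them. Traceless null elements orthogonal to [b] lie in its 1/2-space. *)
Definition unit_idem : J := locked (2%:R^-1 *: (1j - e + b)).
Local Notation f := unit_idem.

Lemma unit_idemE : f = 2%:R^-1 *: (1j - e + b).
Proof. by rewrite /unit_idem -lock. Qed.

Lemma null0_mulE x y : null0 e x -> null0 e y -> x ** y = (2%:R^-1 * T (x ** y)) *: (1j - e).
Proof. by case=> nx tx [ny ty]; have := null_mulE ie nx ny; rewrite tx ty => E; apply: (eq_byZ (c := 1) E); vec; ring. Qed.

Lemma unit_idem1 : idem1 f.
Proof.
split; last by rewrite unit_idemE !jtrE nb.2 ie.2; field.
rewrite unit_idemE !jmulE (null0_mulE nb nb) bb ie.1 (nb.1 : e ** b = 0) (null_mulC nb.1).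
by vec; field.
Qed.

Lemma unit_half_null x : null0 e x -> T (b ** x) = 0 -> half f x.
Proof.
move=> nx bx; rewrite /half unit_idemE !jmulE (nx.1 : e ** x = 0) (null0_mulE nb nx) bx.
by vec; ring.
Qed.

Lemma reflection_unit1 : reflection f 1j = 1j.
Proof. by rewrite /reflection !jmulE unit_idem1.2; vec; ring. Qed.

Lemma reflection_unit_e : reflection f e = e.
Proof. by apply: reflection_null; rewrite /null unit_idemE !jmulE ie.1 (null_mulC nb.1); vec; ring. Qed.

Lemma reflection_unit_null y : null0 e y -> reflection f y = - y + T (b ** y) *: b.
Proof.
move=> ny; rewrite /reflection unit_idemE !jmulE (ny.1 : e ** y = 0) (null0_mulE nb ny) !jtrE ny.2 ie.2.
by vec; field.
Qed.

Lemma reflection_unit_half y : half e y -> reflection f y = - 2%:R *: (b ** y).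
Proof.
move=> hy; rewrite /reflection unit_idemE !jmulE hy !jtrE (tr_half ie hy) (tr_null_half nb.1 hy).
by vec; field.
Qed.

Variable x : J.
Hypotheses (nx : null0 e x) (bx : T (b ** x) = 0).

Let fx : f ** x = 2%:R^-1 *: x. Proof. exact: unit_half_null. Qed.

Lemma delta_unit1 : peirce_delta f x 1j = 0.
Proof.
by rewrite /peirce_delta reflection_unit1 !jmulE nx.2 unit_idem1.2; vec; ring.
Qed.

Lemma delta_unit_e : peirce_delta f x e = 0.
Proof.
rewrite /peirce_delta reflection_unit_e (null_mulC nx.1) !jtrE.
have -> : f ** e = 0 by rewrite unit_idemE !jmulE ie.1 (null_mulC nb.1); vec; ring.
by rewrite jtr0; vec; ring.
Qed.

Lemma delta_unit_hat : peirce_delta f x (hat e) = 0.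
Proof.
rewrite hatE; have -> : e - (T e / 3%:R) *: 1j = (- (T e / 3%:R)) *: 1j + e by vec; ring.
by rewrite peirce_delta_linear delta_unit1 delta_unit_e scaler0 addr0.
Qed.

Lemma tr_unit_null w : null0 e w -> T (f ** w) = 2%:R^-1 * T (b ** w).
Proof.
by move=> nw; rewrite unit_idemE !jmulE !jtrE (nw.1 : e ** w = 0) jtr0 nw.2; ring.
Qed.

(** The operator is an infinitesimal rotation in the plane of [b] and [x]; [delta_unit_half] is its
    spin action on the 1/2-space. *)
Lemma delta_unit_null y : null0 e y ->
  peirce_delta f x y = (2%:R * T (b ** y)) *: x - (2%:R * T (x ** y)) *: b.
Proof.
move=> ny; rewrite /peirce_delta reflection_unit_null // !jmulE (null0_mulE nx ny).
have -> : x ** b = 0 by rewrite ca_mulC (null0_mulE nb nx) bx mulr0 scale0r.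
rewrite !jtrE !tr_unit_null // bb ie.2 unit_idemE.
by vec; field.
Qed.

Lemma delta_unit_half y : half e y -> peirce_delta f x y = 8%:R *: (x ** (b ** y)).
Proof.
move=> hy; have hby := null_half_mul ie nb.1 hy.
rewrite /peirce_delta reflection_unit_half // !jmulE !jtrE (tr_null_half nx.1 hby).
rewrite {2}unit_idemE !jmulE hby !jtrE (tr_half ie hby) (tr_null_half nb.1 hby).
by vec; ring.
Qed.

End UnitVector.

Lemma delta_hat e x : idem1 e -> half e x -> peirce_delta e x (hat e) = 2%:R *: x.
Proof.
move=> ie hx; have -> : hat e = (- (T e / 3%:R)) *: 1j + e by rewrite hatE; vec; ring.
rewrite peirce_delta_linear /peirce_delta reflection_e //.
have -> : reflection e 1j = 1j by rewrite /reflection !jmulE ie.2; vec; ring.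
by rewrite !jmulE (half_mulC hx) ie.1 !jtrE (tr_half ie hx) ie.2; vec; field.
Qed.

Lemma delta_null e x y : idem1 e -> half e x -> null e y -> peirce_delta e x y = - 4%:R *: (y ** x).
Proof.
move=> ie hx ny; rewrite /peirce_delta reflection_null // (ny : e ** y = 0) jtr0 jtrC (tr_null_half ny hx) (ca_mulC x).
by vec; ring.
Qed.

Lemma delta_half e x y : idem1 e -> half e x -> half e y ->
  peirce_delta e x y = 4%:R *: (x ** y) - (4%:R * T (x ** y)) *: e.
Proof.
move=> ie hx hy; rewrite /peirce_delta reflection_half // !jmulE hy !jtrE (tr_half ie hy).
by vec; ring.
Qed.

Lemma tr_half_null0_hat e x : idem1 e -> half e x -> T (x ** hat e) = 0.
Proof. by move=> ie hx; rewrite jtrC hatE !jmulE hx !jtrE (tr_half ie hx); ring. Qed.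

Definition unit_orth e b : {vspace J} := (null0_space e :&: kerv (fun x => T (b ** x) : F^o))%VS.

Lemma memv_unit_orth e b x : reflect (null0 e x /\ T (b ** x) = 0) (x \in unit_orth e b).
Proof.
rewrite memv_cap [X in _ && X]memv_kerv; last by move=> a y z; rewrite !jmulE !jtrE.
by apply: (iffP andP) => [[/memv_null0 ? /eqP ?]|[/memv_null0 ? /eqP ?]].
Qed.

Lemma dim_unit_orth e b : idem1 e -> null0 e b -> T (b ** b) = 2%:R -> \dim (unit_orth e b) = ca_dim J.
Proof.
move=> ie nb bb; have := dim_null0 ie.
rewrite (@dim_cap_functional _ _ _ (unit_orth e b) (fun x => T (b ** x))) => [[]//|a x y|x|].
- by rewrite !jmulE !jtrE.
- by apply/memv_unit_orth/andP => [[/memv_null0 ? /eqP ?]|[/memv_null0 ? /eqP ?]].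
by exists b; [apply/memv_null0|rewrite bb n2].
Qed.

Lemma plucker_sum_eq0 u v x y z : plucker x v + plucker u y = 0 ->
  T (z ** x) *: v - T (z ** v) *: x + (T (z ** u) *: y - T (z ** y) *: u) = 0.
Proof.
move=> e0; have := ctr_linearl 1 (plucker x v) (plucker u y) z.
rewrite !scale1r !ctr_plucker e0 => <-.
by rewrite /ctr big1 // => i _; rewrite big1 // => j _; rewrite mxE mul0r scale0r.
Qed.

(** The tangent vectors are 2a displacements of [e] along its 1/2-space, a rotations of [v] inside
    the traceless null space, and the scaling. Rotations preserve T(v^2), so the scaling is a new
    direction when [v] is not isotropic. *)
Lemma rank_orbit01 u v : pair01 u v ->
  rank_ge (cone_of (orbit_pair u v)) (3 * ca_dim J + (T (v ** v) != 0)%R)%N.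
Proof.
case=> e [ie -> nv v0]; have [b [nb bb bv]] := exists_unit_pairing ie nv v0.
pose f := unit_idem e b; have i_f : idem1 f := unit_idem1 ie nb bb.
(* The scaling parameter is present only when T(v^2) is nonzero. *)
pose S : {vspace F^o} := if T (v ** v) == 0 then 0%VS else fullv.
pose U : vectType F := ((subvs_of (half_space e) * subvs_of (unit_orth e b)) * subvs_of S)%type.
have dU : \dim {:U} = (3 * ca_dim J + (T (v ** v) != 0)%R)%N.
  rewrite !dim_prod !dim_subvs dim_half // dim_unit_orth // /S.
  have dF : \dim {:F^o} = 1%N by rewrite dimvf.
  by case: (T (v ** v) == 0); rewrite ?dimv0 ?dF /=; lia.
rewrite -dU; pose Delta (t : U) x : J :=
  peirce_delta e (vsval t.1.1) x + peirce_delta f (vsval t.1.2) x + (vsval t.2 : F) *: x.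
apply: (@rank_orbit_jets _ _ U Delta).
- move=> a t t' x; have c2 : (vsval (a *: t + t').2 : F) = a * (vsval t.2 : F) + (vsval t'.2 : F) by rewrite linearP.
  have c0 : vsval (a *: t + t').1.1 = a *: vsval t.1.1 + vsval t'.1.1 by rewrite linearP.
  have c1 : vsval (a *: t + t').1.2 = a *: vsval t.1.2 + vsval t'.1.2 by rewrite linearP.
  rewrite /Delta c0 c1 c2.
  by rewrite !peirce_delta_linearl; vec; ring.
- move=> t; apply: opcurveD; last exact: opcurve_scale.
  apply: opcurveD; apply: opcurve_peirce => //; first exact/memv_half/subvsP.
  by have /memv_unit_orth[n1 n2'] := subvsP t.1.2; apply: unit_half_null.
case=> [[tx tx'] tc]; rewrite /Delta /=.
have /memv_half hx := subvsP tx; have /memv_unit_orth[nx' bx'] := subvsP tx'.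
have cS := subvsP tc; set x := vsval tx in hx *; set x' := vsval tx' in nx' bx' *.
set c : F := vsval tc in cS *.
rewrite delta_hat // (delta_unit_hat ie nb bb nx') (delta_null ie hx nv.1).
rewrite (delta_unit_null ie nb bb nx' bx' nv) -/f.
set m := _ - _ *: b => E.
have mE : m = (2%:R * T (b ** v)) *: x' - (2%:R * T (x' ** v)) *: b by [].
clearbody m.
have nm : null0 e m.
  split; last by rewrite mE !jtrE nx'.2 nb.2; ring.
  by rewrite mE; apply: nullD; [apply: nullZ; case: nx'|rewrite -scaleNr; apply: nullZ; case: nb].
have mv : T (m ** v) = 0 by rewrite mE !jmulE !jtrE; ring.
have hvx := null_half_mul ie nv.1 hx.
have ind := pair01_indep (ex_intro _ e (And4 ie erefl nv v0)).
have x0 : x = 0.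
  apply/eqP/negPn/negP => x0; have [y hy txy] := half_nondeg ie hx x0.
  have := plucker_sum_eq0 y E; rewrite (tr_half_null0_hat ie hy) (jtrC y v) (tr_null_half nv.1 hy).
  rewrite !scale0r subr0 sub0r !jmulE !jtrE (tr_half_null0_hat ie hy) => e1.
  have [|_ /eqP] := ind (- T (y ** (- 4%:R *: (v ** x) + m + c *: v))) (2%:R * T (y ** x)).
    by rewrite -[RHS]e1 !jmulE !jtrE; vec; ring.
  by rewrite mulf_eq0 (negPf (n2 F)) jtrC (negPf txy).
move: E; rewrite x0 => E; have tvv : T (hat e ** v) = 0 by apply: tr_hat_null.
have tm : T (hat e ** m) = 0 by apply: tr_hat_null.
have := plucker_sum_eq0 (hat e) E; rewrite !jmulE !jtrE tr_hat_hat // tvv tm => e1.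
have mc : m = (- 2%:R * c) *: v by apply: (eq_byZ (c := 3%:R / 2%:R) e1); vec; field.
(* A rotation moves [v] orthogonally to itself, while [mc] makes this displacement -2c times [v];
   either T(v^2) is nonzero, or the scaling parameter was absent. *)
have c0 : c = 0.
  have := mv; rewrite mc jmulE jtrE => /eqP; rewrite !mulf_eq0 oppr_eq0 (negPf (n2 F)) /=.
  case/orP => [/eqP//|vv]; move: cS; rewrite /S vv memv0 => /eqP; exact.
have m0 : m = 0 by rewrite mc c0 mulr0 scale0r.
have tau0 : T (x' ** v) = 0.
  have := congr1 (fun y => T (b ** y)) m0; rewrite mE !jmulE !jtrE bx' bb => e2.
  by apply: (eq_by_scaled (c := - 4%:R^-1) e2); field.
have x'0 : x' = 0.
  move: m0; rewrite mE tau0 => e2; have : (2%:R * T (b ** v)) *: x' = 0 by rewrite -[RHS]e2; vec; ring.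
  by move/eqP; rewrite scaler_eq0 mulf_eq0 (negPf (n2 F)) (negPf bv) => /eqP.
have -> : tx = 0 by apply: val_inj; rewrite /= -/x x0.
have -> : tx' = 0 by apply: val_inj; rewrite /= -/x' x'0.
by have -> : tc = 0 by apply: val_inj; rewrite /= -/c c0.
Qed.

End LowerBound01.

(** * Tangent vectors to the orbits of type 2 *)

Section LowerBound2.
Variables (F : numClosedFieldType) (J : cubicAlgebra F).
Implicit Types (u v w x y z e f p X : J) (a c : F).
Local Notation "x ** y" := (ca_mul x y).
Local Notation T := (@ca_tr F J).

Definition ker_space e X : {vspace J} := (half_space e :&: kerv (fun x => X ** x))%VS.

Lemma memv_ker_space e X x : reflect (half e x /\ X ** x = 0) (x \in ker_space e X).
Proof.
rewrite memv_cap [X in _ && X]memv_kerv; last by move=> a y z; rewrite !jmulE.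
by apply: (iffP andP) => [[/memv_half ? /eqP ?]|[/memv_half ? /eqP ?]].
Qed.

Section Null.
Variables (e X : J).
Hypotheses (ie : idem1 e) (nX : null0 e X) (X0 : X != 0) (XX : X ** X = 0).

(** For an isotropic [Y] with T(X Y) nonzero, multiplication by [Y] embeds the kernel of [X] into
    that of [Y], and by the Clifford relation the two kernels meet in 0 inside a space of dimension
    2a. *)
Lemma dim_ker_leq : (\dim (ker_space e X) <= ca_dim J)%N.
Proof.
have [Y nY [YY tXY]] : exists2 Y, null0 e Y & Y ** Y = 0 /\ T (X ** Y) != 0.
  (* The constant makes m + c X isotropic, because T((m + c X)^2) = T(m^2) + 2c T(X m). *)
  have [m nm tm] := null0_nondeg ie nX X0; pose c := - T (m ** m) / (2%:R * T (X ** m)).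
  have nY : null0 e (m + c *: X).
    case: nm nX => nm tm' [nX' tX]; split; first by apply: nullD => //; apply: nullZ.
    by rewrite !jtrE tm' tX mulr0 addr0.
  exists (m + c *: X) => //; split.
    rewrite (null0_mulE ie nY nY) !jmulE !jtrE XX jtr0 (jtrC m X) /c.
    by vec; field.
  by rewrite !jmulE XX scaler0 addr0.
have cl z : half e z -> X ** (Y ** z) + Y ** (X ** z) = (4%:R^-1 * T (X ** Y)) *: z.
  by move=> hz; exact: (clifford ie nX.1 nY.1 nX.2 nY.2 hz).
have inter z : half e z -> X ** z = 0 -> Y ** z = 0 -> z = 0.
  move=> hz Xz Yz; have := cl z hz; rewrite Xz Yz !jmul0r addr0 => /esym/eqP.
  by rewrite scaler_eq0 mulf_eq0 invr_eq0 pnatr_eq0 (negPf tXY) => /eqP.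
have [g gE] := @linear_lfun _ _ _ (ca_mul Y) (fun a x y => etrans (jmulDr _ _ _) (congr1 (+%R^~ _) (jmulZr _ _ _))).
have d1 : \dim (g @: ker_space e X) = \dim (ker_space e X).
  apply: limg_dim_eq; apply/eqP; rewrite -subv0; apply/subvP => z; rewrite memv_cap memv_ker gE.
  by case/andP => /memv_ker_space[hz Xz] /eqP Yz; rewrite (inter z hz Xz Yz) mem0v.
have s1 : (g @: ker_space e X <= ker_space e Y)%VS.
  apply/subvP => _ /memv_imgP[z /memv_ker_space[hz Xz] ->]; rewrite gE; apply/memv_ker_space.
  by split; [apply: (null_half_mul ie nY.1 hz)|rewrite (clifford_sq ie nY.1 nY.2 hz) YY jtr0 mulr0 scale0r].
have d2 : (ker_space e X :&: ker_space e Y)%VS = 0%VS.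
  apply/eqP; rewrite -subv0; apply/subvP => z; rewrite memv_cap.
  by case/andP => /memv_ker_space[hz Xz] /memv_ker_space[_ Yz]; rewrite (inter z hz Xz Yz) mem0v.
have s2 : (ker_space e X + ker_space e Y <= half_space e)%VS.
  by rewrite subv_add !capvSl.
have := dimvS s2; rewrite dimv_disjoint_sum // dim_half //; have := dimvS s1; rewrite d1.
move: (\dim (ker_space e X)) (\dim (ker_space e Y)) => d d'; lia.
Qed.

Variables (p : J) (g : F).
Hypotheses (hp : half e p) (Xp : X ** p = 0) (pp : p ** p = g *: X) (g0 : g != 0).

Let p0 : p != 0.
Proof.
apply: contraNneq g0 => p0; move/eqP: pp; rewrite p0 jmul0l eq_sym scaler_eq0 (negPf X0) orbF.
by [].
Qed.

Lemma null_orth b : null0 e b -> T (b ** X) = 0 -> p ** (b ** p) = 0.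
Proof.
move=> nb bX; have hbp := null_half_mul ie nb.1 hp.
have Xb : X ** b = 0 by rewrite ca_mulC (null0_mulE ie nb nX) bX mulr0 scale0r.
have := jchar p p b; rewrite -(ca_trA p p b) pp (ca_mulC p b) (ca_mulC (b ** p) p) !jmulE Xb !jtrE.
rewrite (tr_half ie hp) nX.2 nb.2 (tr_half ie hbp) => E.
by apply: (eq_byZ (c := 2%:R^-1) E); vec; field.
Qed.

Section Rotation.
Variable b : J.
Hypotheses (nb : null0 e b) (bb : T (b ** b) = 2%:R).

Lemma unit_sq z : half e z -> b ** (b ** z) = 4%:R^-1 *: z.
Proof. by move=> hz; rewrite (clifford_sq ie nb.1 nb.2 hz) bb; vec; field. Qed.

Hypothesis bX : T (b ** X) = 0.

Let hbp : half e (b ** p). Proof. exact: (null_half_mul ie nb.1 hp). Qed.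

Let rot_orth : p ** (b ** p) = 0. Proof. exact: null_orth. Qed.

Lemma rot_square : (b ** p) ** (b ** p) = (- (4%:R^-1 * g)) *: X.
Proof.
have := jchar p b (b ** p); rewrite (ca_mulC p b) (ca_mulC (b ** p) p) rot_orth unit_sq // !jmulE pp.
rewrite !jtrE (tr_half ie hp) nb.2 (tr_half ie hbp) nX.2 => E.
by apply: (eq_byZ (c := 1) E); vec; field.
Qed.

(** Such a [w] is isotropic by the Clifford relation, and by [ker_mul] the square of [b ** p] is a
    multiple of [w]. By [rot_square] that square is also a nonzero multiple of [X]. *)
Lemma rot_injective w : null0 e w -> T (X ** w) = 0 -> w ** (b ** p) = 0 -> exists c, w = c *: X.
Proof.
move=> nw tXw wbp; have [->|w0] := eqVneq w 0; first by exists 0; rewrite scale0r.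
have bp0 : b ** p != 0.
  apply/eqP => bp0; have := unit_sq hp; rewrite bp0 jmul0r => /esym/eqP.
  by rewrite scaler_eq0 invr_eq0 pnatr_eq0 (negPf p0).
have tww : T (w ** w) = 0.
  have := clifford_sq ie nw.1 nw.2 hbp; rewrite wbp jmul0r => /esym/eqP.
  by rewrite scaler_eq0 (negPf bp0) orbF mulf_eq0 invr_eq0 pnatr_eq0 => /eqP.
have [z hz bpE] := ker_preimage ie nw w0 hbp wbp.
have := ker_mul ie nw hbp hz wbp; rewrite -bpE rot_square; set c := _ * T _ => E.
have c0 : c != 0.
  apply/eqP => c0; move: E; rewrite c0 scale0r => /eqP.
  by rewrite scaler_eq0 oppr_eq0 mulf_eq0 invr_eq0 pnatr_eq0 (negPf g0) (negPf X0).
by exists (c^-1 * - (4%:R^-1 * g)); rewrite -scalerA E scalerA mulVf // scale1r.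
Qed.

(** The sum and the difference of p(w(bp)) and (wp)(bp) vanish, by two different instances of the
    characteristic equation. *)
Lemma rot_tangent_orth w : null0 e w -> T (b ** w) = 0 -> T (w ** X) = 0 -> p ** (w ** (b ** p)) = 0.
Proof.
move=> nw bw wX; have hwp := null_half_mul ie nw.1 hp.
have hwbp := null_half_mul ie nw.1 hbp.
have anti : b ** (w ** p) = - (w ** (b ** p)).
  have := clifford ie nb.1 nw.1 nb.2 nw.2 hp; rewrite bw => E.
  by apply: (eq_byZ (c := 1) E); vec; ring.
have pwp := null_orth nw wX.
have z1 : T (p ** (w ** (b ** p))) = 0 by rewrite jtrCA rot_orth jmul0r jtr0.
have E1 : p ** (w ** (b ** p)) + (w ** p) ** (b ** p) = 0.
  have := jchar p (b ** p) w; rewrite (ca_mulC (b ** p) w) (ca_mulC (w ** (b ** p)) p) rot_orth !jmulE z1.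
  rewrite !jtrE (tr_half ie hp) (tr_half ie hbp) nw.2 (tr_half ie hwbp) (tr_half ie hwp) => E.
  by apply: (eq_byZ (c := 1) E); vec; ring.
have E2 : - (p ** (w ** (b ** p))) + (w ** p) ** (b ** p) = 0.
  have := jchar p (w ** p) b; rewrite pwp (ca_mulC (w ** p) b) anti (ca_mulC (b ** p) (w ** p)) !jmulE (ca_mulC (w ** (b ** p)) p).
  rewrite !jtrE z1 (tr_half ie hp) (tr_half ie hwp) nb.2 (tr_half ie hwbp) (tr_half ie hbp) => E.
  by apply: (eq_byZ (c := 1) E); vec; ring.
by apply: (eq_byZ (c := 2%:R^-1) (etrans E1 (esym E2))); vec; field.
Qed.

End Rotation.

(* The rotations of the plane of b and w fix X and move p in the kernel of X. *)
Definition moves_kernel (f : J) (W : {vspace J}) : Prop := idem1 f /\ forall w, w \in W ->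
  [/\ half f w, peirce_delta f w X = 0, half e (peirce_delta f w p),
      p ** peirce_delta f w p = 0 & peirce_delta f w p = 0 -> w = 0].

(** The orthogonals of [b] and of [X] have dimension a in the traceless null space of dimension a +
    1, so they meet in dimension at least a - 1; a complement of [X] costs one more, as [X] itself
    need not move [p]. For a = 1 the zero space is enough. *)
Lemma exists_moves_kernel : exists f W, moves_kernel f W /\ (ca_dim J - 2 <= \dim W)%N.
Proof.
have [b0 [nb0 bb0 _]] := exists_unit_pairing ie nX X0.
have [small|big] := leqP (ca_dim J) 1.
  exists (unit_idem e b0), 0%VS; split; last by rewrite dimv0; lia.
  split=> [|w]; first exact: unit_idem1.
  rewrite memv0 => /eqP->; have z y : peirce_delta (unit_idem e b0) 0 y = 0.
    by rewrite /peirce_delta !jmulE jtr0; vec; ring.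
  by rewrite !z; split; rewrite /half ?jmulE ?scaler0.
pose Xo := (null0_space e :&: kerv (fun x => T (X ** x) : F^o))%VS.
have memXo x : reflect (null0 e x /\ T (X ** x) = 0) (x \in Xo).
  rewrite memv_cap [X in _ && X]memv_kerv; last by move=> a y z; rewrite !jmulE !jtrE.
  by apply: (iffP andP) => [[/memv_null0 ? /eqP ?]|[/memv_null0 ? /eqP ?]].
have dXo : \dim Xo = ca_dim J.
  have := dim_null0 ie; rewrite (@dim_cap_functional _ _ _ Xo (fun x => T (X ** x))) => [[]//|a x y|x|].
  - by rewrite !jmulE !jtrE.
  - by apply/memXo/andP => [[/memv_null0 ? /eqP ?]|[/memv_null0 ? /eqP ?]].
  by have [y ny txy] := null0_nondeg ie nX X0; exists y => //; apply/memv_null0.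
have XXo : X \in Xo by apply/memXo; rewrite XX jtr0.
have [b [nb bb bX]] : exists b, [/\ null0 e b, T (b ** b) = 2%:R & T (b ** X) = 0].
  have [w1 w1Xo w1X] : exists2 w, w \in Xo & w \notin <[X]>%VS.
    apply: contrapT => no; have : (Xo <= <[X]>)%VS.
      by apply/subvP => x xXo; apply/negPn/negP => nx; apply: no; exists x.
    by move/dimvS; rewrite dXo dim_vline X0; lia.
  have /memXo[nw1 Xw1] := w1Xo.
  have ind : indep2 w1 X.
    move=> s t e1; have s0 : s = 0.
      apply/eqP/negPn/negP => s0; case/negP: w1X; apply/vlineP; exists (- (s^-1 * t)).
      by apply: (eq_byZ (c := s^-1) e1); vec; field.
    by move: e1; rewrite s0 scale0r add0r => /eqP; rewrite scaler_eq0 (negPf X0) orbF => /eqP.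
  have [y [yw1 yX]] := exists_pairing 1 0 ind; have [w2 nw2 w2E] := null0_proj y ie.
  have w2w1 : T (w2 ** w1) = 1 by rewrite w2E.
  have w2X : T (w2 ** X) = 0 by rewrite w2E.
  rewrite jtrC in Xw1; have [w nw [ww wX]] : exists2 w, null0 e w & T (w ** w) != 0 /\ T (w ** X) = 0.
    have [h1|h1] := eqVneq (T (w1 ** w1)) 0; last by exists w1.
    have [h2|h2] := eqVneq (T (w2 ** w2)) 0; last by exists w2.
    exists (w1 + w2); first by case: nw1 nw2 => n1 t1 [n2 t2]; split; [apply: nullD|rewrite jtrD t1 t2 addr0].
    rewrite !jmulE !jtrE h1 h2 (jtrC w1 w2) w2w1 Xw1 w2X addr0 add0r; split; last by rewrite addr0.
    by rewrite -[1 + 1](natrD _ 1 1) pnatr_eq0.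
  pose s := sqrtC (2%:R / T (w ** w)); have s2 : s * s = 2%:R / T (w ** w) by rewrite -expr2 sqrtCK.
  exists (s *: w); rewrite !jmulE !jtrE wX mulr0 mulrA s2 divfK //; split=> //.
  by case: nw => nw tw; split; [apply: nullZ|rewrite jtrE tw mulr0].
pose W0 := (unit_orth e b :&: Xo)%VS.
have dW0 : (ca_dim J - 1 <= \dim W0)%N.
  have := dimv_sum_cap (unit_orth e b) Xo; rewrite dim_unit_orth // dXo.
  have : (unit_orth e b + Xo <= null0_space e)%VS by rewrite subv_add !capvSl.
  by move/dimvS; rewrite dim_null0 // -/W0; lia.
exists (unit_idem e b), (W0 :\: <[X]>)%VS; split; last first.
  have := dimv_cap_compl W0 <[X]>%VS; have := dimvS (capvSr W0 <[X]>%VS).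
  by rewrite dim_vline X0; lia.
split=> [|w wW]; first exact: unit_idem1.
have wW0 : w \in W0 := subvP (diffvSl _ _) _ wW.
have [nw bw Xw] : [/\ null0 e w, T (b ** w) = 0 & T (X ** w) = 0].
  by move: wW0; rewrite memv_cap => /andP[/memv_unit_orth[? ?] /memXo[_ ?]].
have hbp := null_half_mul ie nb.1 hp; have hwbp := null_half_mul ie nw.1 hbp.
rewrite (delta_unit_null ie nb bb nw bw nX) bX (jtrC w X) Xw (delta_unit_half ie nb nw hp).
split; first exact: unit_half_null.
- by vec; ring.
- exact: halfZ.
- by rewrite jmulE rot_tangent_orth ?scaler0 // jtrC.
move/eqP; rewrite scaler_eq0 pnatr_eq0 /= => /eqP wbp.
have [c wE] := rot_injective nb bb bX nw Xw wbp.
have : w \in ((W0 :\: <[X]>) :&: <[X]>)%VS by rewrite memv_cap wW wE memvZ ?memv_line.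
by rewrite capv_diff memv0 => /eqP.
Qed.

(** At least a parameters move [X] into the 1/2-space, a rotations move it within the null space,
    and at least a - 2 fix [X] and move [p] inside the kernel of [X]. *)
Lemma rank_orbit_nil : exists2 n, (3 * ca_dim J - 2 <= n)%N & rank_ge (cone_of (orbit_pair X p)) n.
Proof.
have [f2 [W [[if2 WP] dW]]] := exists_moves_kernel.
have [b [nb bb bX]] := exists_unit_pairing ie nX X0.
pose f := unit_idem e b; have i_f : idem1 f := unit_idem1 ie nb bb.
pose K := (half_space e :\: ker_space e X)%VS.
pose U : vectType F := ((subvs_of K * subvs_of (unit_orth e b)) * subvs_of W)%type.
exists (\dim {:U}).
  rewrite !dim_prod !dim_subvs dim_unit_orth //.
  have := dimv_cap_compl (half_space e) (ker_space e X); rewrite -/K dim_half //.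
  have := dimvS (capvSr (half_space e) (ker_space e X)); have := dim_ker_leq.
  move: (\dim (_ :&: _)) (\dim (ker_space _ _)) (\dim K) (\dim W) dW => d1 d2 d3 d4; lia.
pose Delta (t : U) x : J :=
  peirce_delta e (vsval t.1.1) x + peirce_delta f (vsval t.1.2) x + peirce_delta f2 (vsval t.2) x.
apply: (@rank_orbit_jets _ _ U Delta).
- move=> a t t' x; have c2 : vsval (a *: t + t').2 = a *: vsval t.2 + vsval t'.2 by rewrite linearP.
  have c0 : vsval (a *: t + t').1.1 = a *: vsval t.1.1 + vsval t'.1.1 by rewrite linearP.
  have c1 : vsval (a *: t + t').1.2 = a *: vsval t.1.2 + vsval t'.1.2 by rewrite linearP.
  rewrite /Delta c0 c1 c2 !peirce_delta_linearl.
  by vec; ring.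
- move=> t; apply: opcurveD; last by apply: opcurve_peirce => //; case: (WP _ (subvsP t.2)).
  apply: opcurveD; apply: opcurve_peirce => //; first by apply/memv_half/(subvP (diffvSl _ _))/subvsP.
  by have /memv_unit_orth[n1 n2'] := subvsP t.1.2; apply: unit_half_null.
case=> [[tx tx'] tw]; rewrite /Delta /=.
have xK := subvsP tx; have /memv_half hx := subvP (diffvSl _ _) _ xK.
have /memv_unit_orth[nx' bx'] := subvsP tx'; have [_ wX hq pq q0] := WP _ (subvsP tw).
set x := vsval tx in xK hx *; set x' := vsval tx' in nx' bx' *; set w := vsval tw in wX hq pq q0 *.
rewrite wX addr0 (delta_null ie hx nX.1) (delta_unit_null ie nb bb nx' bx' nX) -/f.
rewrite (delta_half ie hx hp) (delta_unit_half ie nb nx' hp).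
set m := _ - _ *: b; have mE : m = (2%:R * T (b ** X)) *: x' - (2%:R * T (x' ** X)) *: b by [].
set q := peirce_delta f2 w p in hq pq q0 *; clearbody m q.
set A := _ + m; set B := _ + q => E.
have AE : A = - 4%:R *: (X ** x) + m by [].
have BE : B = 4%:R *: (x ** p) - (4%:R * T (x ** p)) *: e + 8%:R *: (x' ** (b ** p)) + q by [].
clearbody A B.
have nm : null0 e m.
  split; last by rewrite mE !jtrE nx'.2 nb.2; ring.
  by rewrite mE; apply: nullD; [apply: nullZ; case: nx'|rewrite -scaleNr; apply: nullZ; case: nb].
have ind : indep2 X p.
  apply: (@pair24_indep _ _ X p g); exists e; split=> //; split=> //.
have hXx := null_half_mul ie nX.1 hx; have hbp := null_half_mul ie nb.1 hp.
have hxbp := null_half_mul ie nx'.1 hbp.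
have [y1 [y1X y1p]] := exists_pairing 0 1 ind; have [y2 [y2X y2p]] := exists_pairing 1 0 ind.
(* Vanishing of the tangent bivector means that [X] goes to [A] and [p] to [B] under a traceless
   endomorphism of the plane, with matrix entries [la], [ka], [mu] and [- ka]. *)
have [la [ka AE2]] : exists la ka, A = la *: p + ka *: X.
  exists (T (y1 ** A)), (- T (y1 ** B)); have := plucker_sum_eq0 y1 E; rewrite y1X y1p => e1.
  by apply: (eq_byZ (c := -1) e1); vec; ring.
have [mu BE2] : exists mu, B = mu *: X - ka *: p.
  exists (T (y2 ** B)); have := plucker_sum_eq0 y2 E; rewrite y2X y2p AE2 !jmulE !jtrE y2X y2p => e1.
  by apply: (eq_byZ (c := 1) e1); vec; ring.
have eA : - 4%:R *: (X ** x) = la *: p.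
  have := congr1 (ca_mul e) (etrans (esym AE) AE2); rewrite !jmulE hXx hp nX.1 nm.1 => e1.
  by apply: (eq_byZ (c := 2%:R) e1); vec; field.
have mX : m = ka *: X.
  by have := etrans (esym AE) AE2; rewrite eA => e1; apply: (eq_byZ (c := 1) e1); vec; ring.
have eB := congr1 (ca_mul e) (etrans (esym BE) BE2).
rewrite !jmulE half_mulE // ie.1 hxbp hq nX.1 hp in eB.
have txp : T (x ** p) = 0.
  have := congr1 T eB; rewrite !jtrE ie.2 (tr_half ie hxbp) (tr_half ie hq) (tr_half ie hp) => e1.
  by apply: (eq_by_scaled (c := - 2%:R^-1) e1); field.
have qE : 8%:R *: (x' ** (b ** p)) + q = - ka *: p.
  by move: eB; rewrite txp => eB; apply: (eq_byZ (c := 2%:R) eB); vec; field.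
have xpE : 4%:R *: (x ** p) = mu *: X.
  have e1 := etrans (esym BE) BE2; rewrite txp -addrA qE in e1.
  by apply: (eq_byZ (c := 1) e1); vec; ring.
(* Since [x ** p] is a multiple of [X] and [X ** x] one of [p], the characteristic equation at [x],
   [p], [X] reduces to la g X = 0. *)
have la0 : la = 0.
  have xp : x ** p = (4%:R^-1 * mu) *: X by apply: (eq_byZ (c := 4%:R^-1) xpE); vec; field.
  have Xx : X ** x = (- (4%:R^-1 * la)) *: p by apply: (eq_byZ (c := - 4%:R^-1) eA); vec; field.
  have := jchar x p X; rewrite xp (ca_mulC p X) Xp Xx !jmulE XX pp !jtrE.
  rewrite (tr_half ie hx) (tr_half ie hp) nX.2 => e1.
  have : (la * g) *: X = 0 by apply: (eq_byZ (c := - 4%:R) e1); vec; field.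
  by move/eqP; rewrite scaler_eq0 (negPf X0) orbF mulf_eq0 (negPf g0) orbF => /eqP.
have x0 : x = 0.
  have : x \in (K :&: ker_space e X)%VS.
    rewrite memv_cap xK; apply/memv_ker_space; split=> //.
    by move: eA; rewrite la0 scale0r => /eqP; rewrite scaler_eq0 oppr_eq0 pnatr_eq0 => /eqP.
  by rewrite capv_diff memv0 => /eqP.
set be := T (b ** X) in bX mE; set ta := T (x' ** X) in mE.
have taE : 4%:R * ta = - (ka * be).
  have := congr1 (fun y => T (b ** y)) (etrans (esym mE) mX); rewrite !jmulE !jtrE bx' bb -/be => e1.
  by apply: (eq_by_scaled (c := -1) e1); ring.
have x'E : x' = (ka / (2%:R * be)) *: X - (4%:R^-1 * ka) *: b.
  have e1 := etrans (esym mE) mX; have tE : ta = - (4%:R^-1 * (ka * be)).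
    by apply: (eq_by_scaled (c := 4%:R^-1) taE); field.
  by rewrite tE in e1; apply: (eq_byZ (c := (2%:R * be)^-1) e1); vec; field.
have rot : x' ** (b ** p) = (ka / 16%:R) *: p.
  have cl := clifford ie nX.1 nb.1 nX.2 nb.2 hp; rewrite Xp jmul0r addr0 (jtrC X) -/be in cl.
  by rewrite x'E !jmulE cl (unit_sq nb bb hp); vec; field.
(* Multiplication by [p] kills [q]. The rotation contributes ka/2 p and the right side is -ka p,
   which leaves 3/2 ka g X = 0. *)
have ka0 : ka = 0.
  have := congr1 (ca_mul p) qE; rewrite rot !jmulE pq pp => e1.
  have : (ka * g) *: X = 0 by apply: (eq_byZ (c := 2%:R / 3%:R) e1); vec; field.
  by move/eqP; rewrite scaler_eq0 (negPf X0) orbF mulf_eq0 (negPf g0) orbF => /eqP.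
have x'0 : x' = 0 by rewrite x'E ka0; vec; ring.
have w0 : w = 0 by apply: q0; have := qE; rewrite rot ka0 => e1; apply: (eq_byZ (c := 1) e1); vec; ring.
have -> : tx = 0 by apply: val_inj; rewrite /= -/x x0.
have -> : tx' = 0 by apply: val_inj; rewrite /= -/x' x'0.
by have -> : tw = 0 by apply: val_inj; rewrite /= -/w w0.
Qed.

End Null.

Lemma rank_orbit2 X p : pair2 X p ->
  exists2 n, (3 * ca_dim J - 2 <= n)%N & rank_ge (cone_of (orbit_pair X p)) n.
Proof.
by case=> g g0 [e [ie nX [XX X0] hp [Xp pp _]]]; apply: (@rank_orbit_nil e X ie nX X0 XX p g).
Qed.

(** The kernel of [X] is then at most a line; it contains an element of square [X], so the nonzero
    [p] in it cannot have square 0. *)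
Lemma no_pair4 X p : ca_dim J = 1%N -> ~ pair4 X p.
Proof.
move=> a1 [e [ie nX [XX X0] hp [Xp pp p0]]]; have := dim_ker_leq ie nX X0 XX.
have [p' [hp' Xp' pp']] := exists_ker_square ie nX X0 XX; rewrite a1 => d1.
have pk : p \in ker_space e X by apply/memv_ker_space.
have : p' \in <[p]>%VS.
  have /eqP -> : (<[p]> == ker_space e X)%VS by rewrite eqEdim dim_vline p0 d1 -memvE pk.
  exact/memv_ker_space.
case/vlineP => c p'E; move: pp'; rewrite p'E !jmulE pp scale0r !scaler0 => /esym/eqP.
by rewrite (negPf X0).
Qed.

End LowerBound2.

(** * Simply 3-secant planes *)

Lemma card_set3 (T : Type) (a b c : T) : a <> b -> a <> c -> b <> c ->
  ([set a; b; c] #= `I_3)%card.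
Proof.
move=> ab ac bc; pose f (n : nat) := nth a [:: a; b; c] n.
have -> : [set a; b; c] = f @` `I_3.
  apply/seteqP; split.
    by move=> x /= [[->|->]|->]; [exists 0%N|exists 1%N|exists 2%N].
  by move=> _ [[|[|[|//]]] _ <-]; rewrite /f /=; [left; left|left; right|right].
apply: inj_card_eq => i j /set_mem hi /set_mem hj.
move: i j hi hj => [|[|[|//]]] [|[|[|//]]] _ _; rewrite /f /= => e //;
  first [by case: ab | by case: ac | by case: bc].
Qed.

Lemma card3_inv (T : Type) (A : set T) : (A #= `I_3)%card ->
  exists a b c, [/\ a <> b, a <> c, b <> c & A = [set a; b; c]].
Proof.
move/card_set_bijP => [f [fA finj fsurj]].
have [a Aa fa] : exists2 a, A a & f a = 0%N by apply: fsurj.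
have [b Ab fb] : exists2 a, A a & f a = 1%N by apply: fsurj.
have [c Ac fc] : exists2 a, A a & f a = 2%N by apply: fsurj.
exists a, b, c; split; [by move=> e; move: fb; rewrite -e fa|by move=> e; move: fc; rewrite -e fa
  |by move=> e; move: fc; rewrite -e fb|].
apply/seteqP; split=> [x Ax|x [[]|] -> //].
have := fA x Ax; rewrite /=; case e : (f x) => [|[|[|//]]] _.
- by left; left; apply: finj; rewrite ?inE // e fa.
- by left; right; apply: finj; rewrite ?inE // e fb.
- by right; apply: finj; rewrite ?inE // e fc.
Qed.

Section Tangent.
Variables (F : numFieldType) (V : vectType F).

Lemma meval_taylor n (p : {mpoly F[n]}) (x y : 'I_n -> F) :
  exists q : {poly F}, forall s, p.@[fun i => x i + s * y i]
    = p.@[x] + s * (\sum_i p^`M(i).@[x] * y i) + s ^+ 2 * q.[s].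
Proof.
pose Tay (p : {mpoly F[n]}) := exists q : {poly F}, forall s, p.@[fun i => x i + s * y i]
    = p.@[x] + s * (\sum_i p^`M(i).@[x] * y i) + s ^+ 2 * q.[s].
have TayC c : Tay c%:MP.
  exists 0 => s; rewrite !mevalC big1 ?horner0 ?mulr0 ?addr0 // => i _.
  by rewrite mderivC meval0 mul0r.
have TayD p1 p2 : Tay p1 -> Tay p2 -> Tay (p1 + p2).
  move=> [q1 e1] [q2 e2]; exists (q1 + q2) => s; rewrite !mevalD e1 e2 hornerD.
  have -> : \sum_i (p1 + p2)^`M(i).@[x] * y i = \sum_i p1^`M(i).@[x] * y i + \sum_i p2^`M(i).@[x] * y i.
    by rewrite -big_split; apply: eq_bigr => i _; rewrite mderivD mevalD mulrDl.
  by move: (\sum_i _) (\sum_i _) q1.[s] q2.[s] => d1 d2 r1 r2; ring.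
have TayM p1 p2 : Tay p1 -> Tay p2 -> Tay (p1 * p2).
  move=> [q1 e1] [q2 e2].
  pose d1 := \sum_i p1^`M(i).@[x] * y i; pose d2 := \sum_i p2^`M(i).@[x] * y i.
  exists ((d1 * d2)%:P + ((p1.@[x])%:P + d1 *: 'X) * q2 + ((p2.@[x])%:P + d2 *: 'X) * q1 + 'X ^+ 2 * q1 * q2) => s.
  rewrite !mevalM e1 e2 -/d1 -/d2.
  have -> : \sum_i (p1 * p2)^`M(i).@[x] * y i = d1 * p2.@[x] + p1.@[x] * d2.
    rewrite /d1 /d2 mulr_suml mulr_sumr -big_split; apply: eq_bigr => i _ /=.
    rewrite mderivM mevalD !mevalM.
    by move: (y i) p1.@[x] p2.@[x] p1^`M(i).@[x] p2^`M(i).@[x] => c1 c2 c3 c4 c5; ring.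
  rewrite !(hornerD, hornerM, hornerC, hornerZ, hornerX, hornerXn).
  by move: d1 d2 p1.@[x] p2.@[x] q1.[s] q2.[s] => c1 c2 c3 c4 c5 c6; ring.
have TayX i : Tay 'X_i.
  exists 0 => s; rewrite !mevalXU horner0 mulr0 addr0; congr (_ + s * _).
  rewrite (bigD1 i) //= mderivX mnm1E eqxx big1 ?addr0 => [|j ji].
    by rewrite mevalZ (_ : (U_(i) - U_(i) = 0)%MM) ?mpolyX0 ?meval1 ?mulr1 ?mul1r //; apply/mnmP => j; rewrite !mnmE subnn.
  by rewrite mderivX mnm1E eq_sym (negPf ji) scale0r meval0 mul0r.
elim/mpolyind: p => [|c m p _ _ Tp]; first by have := TayC 0; rewrite mpolyC0.
apply: (TayD _ _ _ Tp); rewrite -mul_mpolyC; apply: (TayM _ _ (TayC c)).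
rewrite mpolyXE_id; elim/big_ind: _ => [|p1 p2|i _]; [by have := TayC 1; rewrite mpolyC1|exact: TayM|].
elim: (m i) => [|k IH]; first by rewrite expr0; have := TayC 1; rewrite mpolyC1.
by rewrite exprS; apply: TayM.
Qed.

(** By the first-order Taylor formula the coefficient of [s] is the differential of polynomials
    vanishing on [K], and these kill tangent vectors. *)
Lemma tangent_polymap (W : vectType F) (K : set V) (f : V -> W) x y (b : W) (c : W) :
  polymap f -> (forall v, K v -> f v = 0) -> tangent_space K x y ->
  (forall s, f (x + s *: y) = f x + s *: b + s ^+ 2 *: c) -> b = 0.
Proof.
move=> fP fK txy fE; apply: coords_inj => i; rewrite [RHS]/coords linear0.
have [p pE] := fP i; have pK : vanishes_on p K.
  by move=> v /fK; rewrite -pE => ->; rewrite /coords linear0.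
have := txy p pK; have [q qE] := meval_taylor p (coords x) (coords y).
move: qE; set d := \sum_(_ < _) _ => qE d0.
have E s : s * coords b i + s ^+ 2 * coords c i = s ^+ 2 * q.[s].
  have e1 : coords (f (x + s *: y)) i = coords (f x) i + s ^+ 2 * q.[s].
    rewrite !pE /evalp -[RHS]addr0 -(mulr0 s) -d0 addrAC -qE; apply: meval_eq => j.
    by rewrite /coords linearD linearZ.
  by move: e1; rewrite fE /coords !linearD !linearZ /= => e1; apply: (eq_by e1); ring.
have b0 : (coords b i)%:P + 'X * ((coords c i)%:P - q) = 0.
  apply: (@poly_eq0_nz _ 'X) => [|s]; first by rewrite polyX_eq0.
  rewrite hornerX => s0; have := E s; rewrite hornerD hornerM hornerC hornerX hornerD hornerN hornerC.
  by move=> e1; apply: (mulfI s0); rewrite mulr0; apply: (eq_by e1); ring.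
by have := congr1 (horner^~ 0) b0; rewrite hornerD hornerM hornerC hornerX mul0r addr0 horner0.
Qed.

End Tangent.

Section Secant.
Variables (F : numClosedFieldType) (J : cubicAlgebra F).
Implicit Types (u v w x y z e f p X Y : J) (a c : F) (L P : {vspace J}).
Local Notation "x ** y" := (ca_mul x y).
Local Notation T := (@ca_tr F J).
Local Notation "1j" := (ca_one J) (at level 0).

Definition rank1_cone : set J := [set X | X != 0 /\ X ** X = T X *: X].

Definition rank1_points : set {vspace J} := [set <[X]>%VS | X in rank1_cone].

Lemma rank1_tangent X Y : rank1_cone X -> tangent_space rank1_cone X Y ->
  2%:R *: (X ** Y) = T X *: Y + T Y *: X.
Proof.
move=> [X0 XX] tXY; apply/eqP; rewrite -subr_eq0; apply/eqP.
pose f Z := Z ** Z - T Z *: Z.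
apply: (@tangent_polymap _ _ _ _ f X Y _ (Y ** Y - T Y *: Y) _ _ tXY).
- rewrite /f; apply: polymapD; first by apply: polymap_jmul; exact: polymap_id.
  by apply: polymapN; apply: polymapZ; [apply: polyfun_tr|]; exact: polymap_id.
- by move=> v [_ vv]; rewrite /f vv subrr.
- by move=> s; rewrite /f !jmulE !jtrE (ca_mulC Y X); vec; ring.
Qed.

Definition secant_plane P : Prop :=
  [/\ \dim P = 3%N, 1j \in P, ([set x | rank1_points x /\ (x <= P)%VS] #= `I_3)%card
    & forall X, rank1_cone X -> X \in P ->
        forall Y, Y \in P -> tangent_space rank1_cone X Y -> Y \in <[X]>%VS].

Definition hat_space P : {vspace J} := (linfun (@hat F J) @: P)%VS.

Lemma hat_lfunE x : linfun (@hat F J) x = hat x.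
Proof.
pose h : {linear J -> J} := HB.pack (@hat F J) (GRing.isLinear.Build _ _ _ _ (@hat F J) (@hat_linear F J)).
exact: (lfunE h).
Qed.

Lemma hat1 : hat 1j = 0 :> J.
Proof. by rewrite hatE ca_tr1 divff ?n3 // scale1r subrr. Qed.

Lemma hat_eq0 x : hat x = 0 -> x = (T x / 3%:R) *: 1j.
Proof. by rewrite hatE => /eqP; rewrite subr_eq0 => /eqP. Qed.

Lemma hatZ a x : hat (a *: x) = a *: hat x.
Proof. by rewrite !hatE jtrE; vec; field. Qed.

Lemma hat_traceless x : T x = 0 -> hat x = x.
Proof. by rewrite hatE => ->; rewrite mul0r scale0r subr0. Qed.

Lemma one_neq0 : 1j != 0 :> J.
Proof. by apply/eqP => e; have := ca_tr1 J; rewrite e jtr0 => /eqP; rewrite eq_sym (negPf (n3 F)). Qed.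

Lemma dim_hat_space P : 1j \in P -> \dim P = (\dim (hat_space P)).+1.
Proof.
move=> P1; rewrite -(limg_ker_dim (linfun (@hat F J)) P) /hat_space -add1n; congr (_ + _)%N.
have -> : (P :&: lker (linfun (@hat F J)) = <[1j : J]>)%VS; last by rewrite dim_vline one_neq0.
apply/vspaceP => x; rewrite memv_cap memv_ker hat_lfunE; apply/andP/vlineP => [[_ /eqP/hat_eq0 ->]|[k ->]].
  by exists (T x / 3%:R).
by rewrite memvZ // hatZ hat1 scaler0.
Qed.

(** The rank one equation of X = 1 - Y - Z puts 2 YZ in the span of Y, Z and the unit. Multiplying
    by Y and by Z shows that YZ is a multiple of each, hence 0 when they are independent. *)
Lemma rank1_orth X Y Z : rank1 X -> rank1 Y -> rank1 Z -> X + Y + Z = 1j ->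
  indep2 Y Z \/ Y = 0 \/ Z = 0 -> Y ** Z = 0.
Proof.
move=> rX rY rZ XYZ [ind|[->|->]]; rewrite ?jmulE //.
have XE : X = 1j - Y - Z by rewrite -XYZ; vec; ring.
have tX : T X = 3%:R - T Y - T Z by rewrite XE !jtrE.
move: (rX); rewrite /rank1 tX {1 2}XE !jmulE rY rZ (ca_mulC Z Y) XE => E.
have YYZ := rank1_mul Z rY; have ZYZ : Z ** (Y ** Z) = 2%:R^-1 *: (T Z *: (Y ** Z) + T (Y ** Z) *: Z).
  by rewrite (ca_mulC Y) rank1_mul // jtrC.
have yzE : 2%:R *: (Y ** Z) = (2%:R - (3%:R - T Z)) *: Y + (2%:R - (3%:R - T Y)) *: Z + (2%:R - T Y - T Z) *: 1j.
  by apply: (eq_byZ (c := 1) E); vec; ring.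
have [k1 e1] : exists k, Y ** Z = k *: Y.
  exists ((2%:R - (3%:R - T Z)) * T Y + (2%:R - T Y - T Z) - T (Y ** Z)).
  have := congr1 (ca_mul Y) yzE; rewrite !jmulE YYZ rY => e1.
  by apply: (eq_byZ (c := 1) e1); vec; field.
have [k2 e2] : exists k, Y ** Z = k *: Z.
  exists ((2%:R - (3%:R - T Y)) * T Z + (2%:R - T Y - T Z) - T (Y ** Z)).
  have := congr1 (ca_mul Z) yzE; rewrite !jmulE ZYZ rZ (ca_mulC Z Y) => e2.
  by apply: (eq_byZ (c := 1) e2); vec; field.
have [|k10 _] := ind k1 (- k2); first by rewrite -e1 scaleNr -e2 subrr.
by rewrite e1 k10 scale0r.
Qed.

Lemma line_eq X Y : X != 0 -> Y \in <[X]>%VS -> Y != 0 -> (<[Y]> = <[X]>)%VS.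
Proof. by move=> X0 YX Y0; apply/eqP; rewrite eqEdim !dim_vline X0 Y0 -memvE YX. Qed.

Lemma indep_lines X Y : X != 0 -> Y != 0 -> (<[X]> <> <[Y]>)%VS -> indep2 X Y.
Proof.
move=> X0 Y0 XY a c e1; have c0 : c = 0.
  apply/eqP/negPn/negP => c0; apply: XY; symmetry; apply: line_eq => //; apply/vlineP; exists (- (c^-1 * a)).
  by apply: (eq_byZ (c := c^-1) e1); vec; field.
by move: e1; rewrite c0 scale0r addr0 => /eqP; rewrite scaler_eq0 (negPf X0) orbF => /eqP.
Qed.

Lemma indep2_neq u v : indep2 u v -> u != 0 /\ (<[u]> <> <[v]>)%VS.
Proof.
move=> ind; split.
  apply/eqP => u0; have [|/eqP] := ind 1 0; first by rewrite u0 scaler0 scale0r addr0.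
  by rewrite oner_eq0.
move=> e; have /vlineP[k uk] : u \in <[v]>%VS by rewrite -e memv_line.
have [|/eqP] := ind 1 (- k); first by rewrite uk scale1r scaleNr subrr.
by rewrite oner_eq0.
Qed.

(** The three points span the plane, so the unit is a sum of three rank one elements, pairwise
    orthogonal by [rank1_orth]. Each is 0 or an idempotent of trace 1, and the total trace 3
    excludes 0. *)
Lemma secant_pair0 P : secant_plane P -> lines_of (pair0 (J := J)) (hat_space P).
Proof.
move=> [dP P1 /card3_inv[x0 [x1 [x2 [n01 n02 n12 SE]]]] _].
have inS (x : {vspace J}) : [set x | rank1_points x /\ (x <= P)%VS] x -> x = x0 \/ x = x1 \/ x = x2.
  by rewrite SE => -[[]|] ->; auto.
have pts (x : {vspace J}) : x = x0 \/ x = x1 \/ x = x2 -> exists2 X, rank1_cone X & x = <[X]>%VS /\ X \in P.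
  move=> h; have : [set x | rank1_points x /\ (x <= P)%VS] x by rewrite SE; case: h => [->|[->|->]]; [left; left|left; right|right].
  by case=> -[X rX <-] XP; exists X => //; split=> //; rewrite memvE.
have [X0 rX0 [e0 P0]] := pts x0 (or_introl erefl).
have [X1 rX1 [e1 P1']] := pts x1 (or_intror (or_introl erefl)).
have [X2 rX2 [e2 P2]] := pts x2 (or_intror (or_intror erefl)).
rewrite {}e0 {}e1 {}e2 in n01 n02 n12 inS.
have i01 := indep_lines rX0.1 rX1.1 n01; have i02 := indep_lines rX0.1 rX2.1 n02.
have i12 := indep_lines rX1.1 rX2.1 n12.
have n2' : X2 \notin <<[:: X0; X1]>>%VS.
  apply/negP => /mem_span2[a [b X2E]].
  have a0 : a != 0.
    apply/eqP => a0; have [|_ /eqP] := i12 b (-1); first by rewrite X2E a0; vec; ring.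
    by rewrite oppr_eq0 oner_eq0.
  have b0 : b != 0.
    apply/eqP => b0; have [|_ /eqP] := i02 a (-1); first by rewrite X2E b0; vec; ring.
    by rewrite oppr_eq0 oner_eq0.
  have X01 : 2%:R *: (X0 ** X1) = T X0 *: X1 + T X1 *: X0.
    have := rX2.2; rewrite X2E !jmulE !jtrE rX0.2 rX1.2 (ca_mulC X1 X0) => e.
    by apply: (eq_byZ (c := (a * b)^-1) e); vec; field; rewrite a0 b0.
  (* If the three points were collinear, every point of their line would have rank one; the values t
     = 1 and t = 2 then give distinct points that both have to be the third one. *)
  have rk t : t != 0 -> (<[X0 + t *: X1]> = <[X2]>)%VS.
    move=> t0; have ind : indep2 X0 (X0 + t *: X1).
      move=> c d e; have [|c0 /eqP] := i01 (c + d) (d * t); first by rewrite -e; vec; ring.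
      rewrite mulf_eq0 (negPf t0) orbF => /eqP d0; split=> //; move: c0; rewrite d0 addr0. by [].
    have ind' : indep2 X1 (X0 + t *: X1).
      move=> c d e; have [|d0 c0] := i01 d (c + d * t); first by rewrite -e; vec; ring.
      by split=> //; move: c0; rewrite d0 mul0r addr0.
    have [_ nn0] := indep2_neq ind; have [_ nn1] := indep2_neq ind'.
    have [|e|[e|e]] := inS <[X0 + t *: X1]>%VS; last by [].
    - split; last by rewrite -memvE memvD // memvZ.
      exists (X0 + t *: X1) => //; split.
        apply/eqP => e; have [|/eqP] := i01 1 t; first by rewrite scale1r.
        by rewrite oner_eq0.
      rewrite !jmulE !jtrE rX0.2 rX1.2 (ca_mulC X1 X0).
      have -> : X0 ** X1 = 2%:R^-1 *: (T X0 *: X1 + T X1 *: X0) by rewrite -X01; vec; field.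
      by vec; field.
    - by case: nn0.
    - by case: nn1.
  have [|_ nn] := indep2_neq (u := X0 + 1 *: X1) (v := X0 + 2%:R *: X1).
    move=> c d e; have [|h1 h2] := i01 (c + d) (c + d * 2%:R); first by rewrite -e; vec; ring.
    have d0 : d = 0 by apply: (eq_by (etrans h2 (esym h1))); ring.
    by split=> //; move: h1; rewrite d0 addr0.
  by apply: nn; rewrite !rk // ?oner_neq0 ?n2.
have PE : P = (<<[:: X0; X1]>> + <[X2]>)%VS.
  apply/eqP; rewrite eq_sym eqEdim; apply/andP; split.
    by rewrite subv_add -memvE P2 andbT; apply/span_subvP => x; rewrite !inE => /orP[] /eqP->.
  rewrite dimv_disjoint_sum ?dP; first by have /indep2P-> := i01; rewrite dim_vline rX2.1.
  apply/eqP; rewrite -subv0; apply/subvP => x; rewrite memv_cap => /andP[x01 /vlineP[k xk]].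
  have [k0|k0] := eqVneq k 0; first by rewrite xk k0 scale0r mem0v.
  by case/negP: n2'; rewrite -[X2]scale1r -(mulVf k0) -scalerA -xk memvZ.
move: (P1); rewrite {1}PE => /memv_addP[_ /mem_span2[a [b ->]] [_ /vlineP[c ->] E1]].
have rk (k : F) Z : rank1_cone Z -> rank1 (k *: Z).
  by case=> _ ZZ; rewrite /rank1 !jmulE jtrE ZZ; vec; ring.
have indZ (k k' : F) u v : indep2 u v -> indep2 (k *: u) (k' *: v) \/ k *: u = 0 \/ k' *: v = 0.
  move=> ind; have [->|k0] := eqVneq k 0; first by right; left; rewrite scale0r.
  have [->|k'0] := eqVneq k' 0; first by right; right; rewrite scale0r.
  left=> s t; rewrite !scalerA => /ind[/eqP + /eqP]; rewrite !mulf_eq0 (negPf k0) (negPf k'0) !orbF.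
  by move=> /eqP-> /eqP->.
set X := a *: X0 in E1; set Y := b *: X1 in E1; set Z := c *: X2 in E1.
have rX : rank1 X := rk a _ rX0; have rY : rank1 Y := rk b _ rX1; have rZ : rank1 Z := rk c _ rX2.
have YZ : Y ** Z = 0 by apply: (rank1_orth rX rY rZ) => //; apply: indZ.
have XZ : X ** Z = 0 by apply: (rank1_orth rY rX rZ); [rewrite E1; vec; ring|apply: indZ].
have XY : X ** Y = 0 by apply: (rank1_orth rZ rX rY); [rewrite E1; vec; ring|apply: indZ].
have XP : X \in P by rewrite memvZ. have YP : Y \in P by rewrite memvZ.
clearbody X Y Z.
have t01 W : rank1 W -> W ** 1j = W ** W -> exists2 k : nat, (k <= 1)%N & T W = k%:R /\ (k = 1%N -> idem1 W).
  rewrite /rank1 jmulr1 => rW WW; have [W0|W0] := eqVneq W 0; first by exists 0%N; rewrite // W0 jtr0.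
  have : (1 - T W) *: W = 0 by rewrite scalerBl scale1r -rW -WW subrr.
  move/eqP; rewrite scaler_eq0 (negPf W0) orbF subr_eq0 => /eqP tW.
  by exists 1%N => //; split=> // _; split; rewrite // -?WW.
have [kx kx1 [tX iX]] : exists2 k : nat, (k <= 1)%N & T X = k%:R /\ (k = 1%N -> idem1 X).
  by apply: t01 => //; rewrite E1 !jmulE XY XZ; vec; ring.
have [ky ky1 [tY iY]] : exists2 k : nat, (k <= 1)%N & T Y = k%:R /\ (k = 1%N -> idem1 Y).
  by apply: t01 => //; rewrite E1 !jmulE (ca_mulC Y X) XY YZ; vec; ring.
have [kz kz1 [tZ iZ]] : exists2 k : nat, (k <= 1)%N & T Z = k%:R /\ (k = 1%N -> idem1 Z).
  by apply: t01 => //; rewrite E1 !jmulE (ca_mulC Z X) (ca_mulC Z Y) XZ YZ; vec; ring.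
have : T (X + Y + Z) = 3%:R by rewrite -E1 ca_tr1.
rewrite !jtrE tX tY tZ -!natrD => /eqP; rewrite eqr_nat => /eqP k3.
have {}iX : idem1 X by apply: iX; lia.
have {}iY : idem1 Y by apply: iY; lia.
pose d := 2%:R *: Y - (1j - X).
have nd : null0 X d.
  by split; rewrite /null /d ?jmulE ?jtrE ?XY ?iX.1 ?iX.2 ?iY.2; [vec; ring|ring].
have dd : T (d ** d) = 2%:R.
  by rewrite /d !jmulE iX.1 iY.1 XY (ca_mulC Y X) XY !jtrE iX.2 iY.2; ring.
have d0 : d != 0 by apply/eqP => d0; move: dd; rewrite d0 jmul0l jtr0 => /eqP; rewrite eq_sym (negPf (n2 F)).
have p01 : pair01 (hat X) d by exists X.
exists (hat X), d; split; first by split=> //; rewrite dd n2.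
apply: line_basis.
- by have := dim_hat_space P1; rewrite dP => -[].
- by rewrite -hat_lfunE memv_img.
- rewrite -(hat_traceless nd.2) -hat_lfunE memv_img //.
  by rewrite memvB ?memvZ // memvB.
- exact: pair01_indep.
Qed.

End Secant.

(** * Points of the reduced lines *)

Section Points.
Variables (F : numClosedFieldType) (J : cubicAlgebra F).
Implicit Types (u v w x y z e f p X Y : J) (a c : F) (L P : {vspace J}).
Local Notation "x ** y" := (ca_mul x y).
Local Notation T := (@ca_tr F J).
Local Notation "1j" := (ca_one J) (at level 0).

Section Frame.
Variables e f : J.
Hypotheses (ie : idem1 e) (i_f : idem1 f) (ef : e ** f = 0).

Definition third : J := locked (1j - e - f).
Lemma thirdE : third = 1j - e - f. Proof. by rewrite /third -lock. Qed.

Lemma third_idem1 : idem1 third.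
Proof.
split; last by rewrite thirdE !jtrE ie.2 i_f.2; ring.
by rewrite thirdE !jmulE ie.1 i_f.1 (ca_mulC f e) ef; vec; ring.
Qed.

Lemma third_e : e ** third = 0.
Proof. by rewrite thirdE !jmulE ie.1 ef; vec; ring. Qed.

Lemma third_f : f ** third = 0.
Proof. by rewrite thirdE !jmulE i_f.1 (ca_mulC f e) ef; vec; ring. Qed.

Definition comb a b c : J := locked (a *: e + b *: f + c *: third).
Lemma combE a b c : comb a b c = a *: e + b *: f + c *: third.
Proof. by rewrite /comb -lock. Qed.

Lemma comb_tr a b c : T (comb a b c) = a + b + c.
Proof. by rewrite !combE !jtrE ie.2 i_f.2 third_idem1.2; ring. Qed.

Lemma comb_mule a b c : e ** comb a b c = a *: e.
Proof. by rewrite !combE !jmulE ie.1 ef third_e; vec; ring. Qed.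

Lemma comb_mulf a b c : f ** comb a b c = b *: f.
Proof. by rewrite !combE !jmulE i_f.1 (ca_mulC f e) ef third_f; vec; ring. Qed.

Lemma comb_mulg a b c : third ** comb a b c = c *: third.
Proof. by rewrite !combE !jmulE !(ca_mulC third) third_e third_f third_idem1.1; vec; ring. Qed.

Lemma comb_mul a b c a' b' c' : comb a b c ** comb a' b' c' = comb (a * a') (b * b') (c * c').
Proof. by rewrite {1}combE !jmulE comb_mule comb_mulf comb_mulg !combE; vec; ring. Qed.

Lemma comb_inj a b c a' b' c' : comb a b c = comb a' b' c' -> [/\ a = a', b = b' & c = c'].
Proof.
have inj (s t : F) z : idem1 z -> s *: z = t *: z -> s = t.
  by move=> [_ tz] /(congr1 T); rewrite !jtrE tz !mulr1.
move=> E; have E1 := congr1 (ca_mul e) E; have E2 := congr1 (ca_mul f) E; have E3 := congr1 (ca_mul third) E.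
rewrite !comb_mule in E1; rewrite !comb_mulf in E2; rewrite !comb_mulg in E3.
by rewrite (inj _ _ _ ie E1) (inj _ _ _ i_f E2) (inj _ _ _ third_idem1 E3).
Qed.

Lemma comb_scale k a b c : k *: comb a b c = comb (k * a) (k * b) (k * c).
Proof. by rewrite !combE; vec; ring. Qed.

Lemma comb_rank1 a b c : comb a b c != 0 -> comb a b c ** comb a b c = T (comb a b c) *: comb a b c ->
  exists2 k, k != 0 & comb a b c = k *: e \/ comb a b c = k *: f \/ comb a b c = k *: third.
Proof.
move=> n0; rewrite comb_mul comb_tr comb_scale => /comb_inj[ea eb ec].
have z (x : F) : x * x = (a + b + c) * x -> x = 0 \/ x = a + b + c.
  move=> h; have : x * (x - (a + b + c)) = 0 by rewrite mulrBr h; ring.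
  by move/eqP; rewrite mulf_eq0 subr_eq0 => /orP[] /eqP; auto.
have s0 : a + b + c != 0.
  apply: contraNneq n0 => s0; move: (z a ea) (z b eb) (z c ec); rewrite s0.
  by move=> [] -> [] -> [] ->; rewrite !combE !scale0r !addr0.
have dbl (s : F) (k : nat) : s = a + b + c -> s * k%:R = a + b + c -> (k != 1)%N -> False.
  move=> -> h k1; case/negP: k1; rewrite -(eqr_nat F); apply/eqP.
  by apply: (mulfI s0); rewrite h mulr1.
exists (a + b + c) => //; case: (z a ea) (z b eb) (z c ec) => ha [] hb [] hc.
- by case/eqP: s0; rewrite ha hb hc !addr0.
- by right; right; rewrite {1}combE ha hb; vec; ring.
- by right; left; rewrite {1}combE ha hc; vec; ring.
- by exfalso; apply: (dbl b 2%N) => //; rewrite ha; apply: (eq_by (etrans hb (esym hc))); ring.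
- by left; rewrite {1}combE hb hc; vec; ring.
- by exfalso; apply: (dbl a 2%N) => //; rewrite hb; apply: (eq_by (etrans ha (esym hc))); ring.
- by exfalso; apply: (dbl a 2%N) => //; rewrite hc; apply: (eq_by (etrans ha (esym hb))); ring.
exfalso; apply: (dbl a 3%N) => //; rewrite -(etrans ha (esym hb)) -(etrans ha (esym hc)); ring.
Qed.

End Frame.

Lemma lines_neq_idem e f : idem1 e -> idem1 f -> e ** f = 0 -> (<[e]> <> <[f]>)%VS.
Proof.
move=> ie i_f ef E; have /vlineP[k ek] : e \in <[f]>%VS by rewrite -E memv_line.
have := idem1_neq0 ie; rewrite -ie.1 {1}ek jmulE ca_mulC ef scaler0; by rewrite eqxx.
Qed.

(** Over an algebraically closed field [v] can be scaled to norm 2, and then it splits [1j - e] into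
    two orthogonal idempotents. *)
Lemma pair0_frame L : lines_of (pair0 (J := J)) L ->
  exists e f, [/\ idem1 e, idem1 f, e ** f = 0 & L = <<[:: hat e; hat f]>>%VS].
Proof.
move=> [u [v [[P vv] LE]]]; have ind := pair01_indep P; case: P LE ind => e [ie -> nv v0] LE ind.
pose s := sqrtC (2%:R / T (v ** v)); have s2 : s * s = 2%:R / T (v ** v) by rewrite -expr2 sqrtCK.
have nb : null0 e (s *: v) by case: nv => nv tv; split; [apply: nullZ|rewrite jtrE tv mulr0].
have bb : T ((s *: v) ** (s *: v)) = 2%:R by rewrite !jmulE !jtrE mulrA s2 divfK.
have i_f := unit_idem1 ie nb bb; have ef : e ** unit_idem e (s *: v) = 0.
  by rewrite unit_idemE !jmulE ie.1 (nv.1 : e ** v = 0); vec; ring.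
exists e, (unit_idem e (s *: v)); split=> //.
have fE : hat (unit_idem e (s *: v)) = (- 2%:R^-1) *: hat e + (2%:R^-1 * s) *: v.
  by rewrite !hatE i_f.2 ie.2 unit_idemE; vec; field.
have s0 : s != 0.
  by apply/eqP => s0; move/eqP: s2; rewrite s0 mulr0 eq_sym mulf_eq0 invr_eq0 (negPf (n2 F)) (negPf vv).
apply: line_basis.
- by rewrite LE; apply/indep2P.
- by rewrite LE; apply/mem_span2; exists 1, 0; rewrite scale1r scale0r addr0.
- by rewrite LE fE; apply/mem_span2; exists (- 2%:R^-1), (2%:R^-1 * s).
move=> a b; rewrite fE => E; have [|a0 b0] := ind (a - b * 2%:R^-1) (b * (2%:R^-1 * s)).
  by rewrite -E; vec; ring.
have {}b0 : b = 0.
  by move/eqP: b0; rewrite !mulf_eq0 invr_eq0 (negPf (n2 F)) (negPf s0) !orbF => /eqP.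
by move: a0; rewrite b0 mul0r subr0.
Qed.

Lemma hat_mem_frame e f X : idem1 e -> idem1 f -> hat X \in <<[:: hat e; hat f]>>%VS ->
  exists a b c, X = comb e f a b c.
Proof.
move=> ie i_f /mem_span2[s [t E]]; rewrite !hatE ie.2 i_f.2 in E.
pose k := (T X - s - t) / 3%:R; exists (s + k), (t + k), k.
by rewrite !combE thirdE /k; apply: (eq_byZ (c := 1) E); vec; field.
Qed.

Lemma rank1_idem e : idem1 e -> rank1_cone e.
Proof. by move=> ie; split; [apply: idem1_neq0|apply: idem1_rank1]. Qed.

(** The plane is that of the elements diagonal in the frame, whose rank one points are the three
    idempotents. Contact is simple because a diagonal solution of the equation in [rank1_tangent] is
    proportional to the idempotent. *)
Lemma pair0_secant L : lines_of (pair0 (J := J)) L -> exists2 P, secant_plane P & L = hat_space P.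
Proof.
move=> /[dup] L0 /pair0_frame[e [f [ie i_f ef LE]]]; set g := third e f.
have ig : idem1 g := third_idem1 ie i_f ef.
pose P : {vspace J} := <<[:: e; f; g]>>%VS.
have memP x : reflect (exists a b c, x = comb e f a b c) (x \in P).
  rewrite /P span_cons; apply: (iffP idP).
    case/memv_addP => _ /vlineP[a ->] [y /mem_span2[b [c ->]] ->].
    by exists a, b, c; rewrite !combE addrA.
  case=> a [b [c ->]]; rewrite !combE -addrA; apply: memv_add; first by rewrite memvZ ?memv_line.
  by apply/mem_span2; exists b, c.
have eP : e \in P by apply/memP; exists 1, 0, 0; rewrite !combE; vec; ring.
have fP : f \in P by apply/memP; exists 0, 1, 0; rewrite !combE; vec; ring.
have gP : g \in P by apply/memP; exists 0, 0, 1; rewrite !combE; vec; ring.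
have P1 : 1j \in P by apply/memP; exists 1, 1, 1; rewrite !combE thirdE; vec; ring.
have LP : L = hat_space P.
  apply/eqP; rewrite eqEsubv; apply/andP; split.
    rewrite LE; apply/span_subvP => x; rewrite !inE => /orP[] /eqP->; rewrite -hat_lfunE memv_img //.
  apply/subvP => _ /memv_imgP[x /memP[a [b [c ->]]] ->]; rewrite hat_lfunE LE; apply/mem_span2.
  exists (a - c), (b - c); rewrite !hatE comb_tr // ie.2 i_f.2 !combE thirdE.
  by vec; field.
exists P => //; split=> //.
- rewrite dim_hat_space // -LP; have [u [v [uv ->]]] := L0; case: uv => /pair01_indep/indep2P -> _.
  by [].
- have -> : [set x | rank1_points x /\ (x <= P)%VS] = [set <[e]>%VS; <[f]>%VS; <[g]>%VS].
    apply/seteqP; split=> [x [[X [X0 XX] <-] XP]|x [[]|] -> /=].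
    + move: XP; rewrite -memvE => /memP[a [b [c XE]]]; rewrite XE in X0 XX *.
      have [k k0 h] := comb_rank1 ie i_f ef X0 XX.
      have lk Y : (<[k *: Y]> = <[Y]>)%VS.
        apply/vspaceP => y; apply/vlineP/vlineP => -[t ->]; first by exists (t * k); rewrite scalerA.
        by exists (t / k); rewrite scalerA divfK.
      by case: h => [->|[->|->]]; rewrite lk; [left; left|left; right|right].
    + by split; [exists e => //; apply: rank1_idem|rewrite -memvE].
    + by split; [exists f => //; apply: rank1_idem|rewrite -memvE].
    + by split; [exists g => //; apply: rank1_idem|rewrite -memvE].
  apply: card_set3; apply: lines_neq_idem => //; [exact: third_e|exact: third_f].
move=> X rX /memP[a [b [c XE]]] Y /memP[a' [b' [c' YE]]] tXY.
have := rank1_tangent rX tXY; have [k k0 h] := comb_rank1 ie i_f ef (eq_ind _ (fun x => x != 0) rX.1 _ XE)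
   (eq_ind _ (fun x => x ** x = T x *: x) rX.2 _ XE).
have key i : idem1 i -> X = k *: i -> (exists t, i ** Y = t *: i) -> 2%:R *: (X ** Y) = T X *: Y + T Y *: X -> Y \in <[X]>%VS.
  move=> ii Xi [t it]; rewrite Xi !jmulE jtrE ii.2 it => E1; apply/vlineP; exists ((2%:R * t - T Y) / k).
  by apply: (eq_byZ (c := - k^-1) E1); vec; field.
rewrite XE in key *; case: h => [h|[h|h]]; [apply: (key e)|apply: (key f)|apply: (key g)] => //; rewrite YE.
- by exists a'; rewrite comb_mule.
- by exists b'; rewrite comb_mulf.
- by exists c'; rewrite comb_mulg.
Qed.

(** * Linear spaces through a line *)

Definition special_points : set {vspace J} := [set <[X]>%VS | X in rank1_cone (J := J) `&` [set X | T X = 0]].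
Definition general_points : set {vspace J} := [set <[hat X]>%VS | X in rank1_cone (J := J)] `\` special_points.

Lemma special_pointsP (x : {vspace J}) : special_points x <-> exists X, [/\ X != 0, X ** X = 0, T X = 0 & x = <[X]>%VS].
Proof.
split=> [[X [[X0 XX] tX] <-]|[X [X0 XX tX ->]]]; exists X => //.
  by split=> //; rewrite XX tX scale0r.
by split=> //; split; rewrite // XX (tX : T X = 0) scale0r.
Qed.

Lemma line_scale (k : F) Y : k != 0 -> (<[k *: Y]> = <[Y]>)%VS.
Proof.
move=> k0; apply/vspaceP => y; apply/vlineP/vlineP => -[t ->]; first by exists (t * k); rewrite scalerA.
by exists (t / k); rewrite scalerA divfK.
Qed.

(** A rank one element of nonzero trace is a multiple of an idempotent, and [hat e] is never special
    because the trace of its square is 2/3. *)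
Lemma general_pointsP (x : {vspace J}) : general_points x <-> exists2 e, idem1 e & x = <[hat e]>%VS.
Proof.
split=> [[[X [X0 XX] <-] ns]|[e ie ->]].
  have tX : T X != 0.
    by apply/eqP => tX; apply: ns; apply/special_pointsP; exists X; rewrite XX tX scale0r hat_traceless.
  exists ((T X)^-1 *: X); last by rewrite hatZ line_scale ?invr_eq0.
  by split; [rewrite !jmulE XX; vec; field|rewrite jtrE mulVf].
split; first by exists e => //; apply: rank1_idem.
case/special_pointsP => X [X0 XX tX] E; have /vlineP[k hk] : hat e \in <[X]>%VS by rewrite -E memv_line.
have := tr_hat_hat ie; rewrite hk !jmulE XX !scaler0 jtr0 => /eqP.
by rewrite eq_sym mulf_eq0 invr_eq0 (negPf (n2 F)) (negPf (n3 F)).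
Qed.

Definition der_orth (x : {vspace J}) : set J :=
  [set Y | T Y = 0 /\ forall D X, derivative D -> X \in x -> T (D X ** Y) = 0].

Definition linear_space (x : {vspace J}) : set {vspace J} :=
  [set L | [/\ \dim L = 2%N, (x <= L)%VS & [set` L] `<=` der_orth x]].

Definition spaces_through (pts : set {vspace J}) L : set (set {vspace J}) :=
  [set S | [set linear_space x | x in pts] S /\ S L].

Lemma linear_space_closed L (x : {vspace J}) : closed_line L -> linear_space x L <-> (x <= L)%VS.
Proof.
move=> [dL tL DL _ _]; split=> [[]//|xL]; split=> // Y /= YL; split; first exact: tL.
by move=> D X dD Xx; apply: DL => //; apply: (subvP xL).
Qed.

Lemma spaces_through_eq pts L : closed_line L ->
  spaces_through pts L = [set linear_space x | x in [set x | pts x /\ (x <= L)%VS]].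
Proof.
move=> cL; apply/seteqP; split=> [S [[x px <-] /(linear_space_closed _ cL) xL]|_ [x [px xL] <-]].
  by exists x.
by split; [exists x|apply/(linear_space_closed _ cL)].
Qed.

Lemma der_anti D x : derivative D -> T (D x ** x) = 0.
Proof.
move=> dD; have := derivative_tr_anti x x dD => e1; have : 2%:R * T (D x ** x) = 0 by apply: (eq_by e1); ring.
by move/eqP; rewrite mulf_eq0 (negPf (n2 F)) => /eqP.
Qed.

Lemma linear_space_span u v : indep2 u v -> T u = 0 -> T v = 0 ->
  (forall D, derivative D -> T (D u ** v) = 0) -> linear_space <[u]>%VS <<[:: u; v]>>%VS.
Proof.
move=> ind tu tv duv; split; first exact/indep2P.
  by rewrite -memvE; apply/mem_span2; exists 1, 0; rewrite scale1r scale0r addr0.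
move=> _ /= /mem_span2[a [b ->]]; split; first by rewrite !jtrE tu tv !mulr0 addr0.
move=> D _ dD /vlineP[k ->]; rewrite linearZ /= !jmulE !jtrE der_anti // duv //.
by ring.
Qed.

(** Different base points do not immediately give different spaces. A traceless null [h] orthogonal
    to [b] spans with [hat e] a line of the first space which misses [hat f]; it exists because a is
    positive. *)
Lemma linear_space_idem_neq e f : idem1 e -> idem1 f -> e ** f = 0 ->
  linear_space <[hat e]>%VS <> linear_space <[hat f]>%VS.
Proof.
move=> ie i_f ef E; pose b := 2%:R *: f - (1j - e).
have nb : null0 e b.
  by split; rewrite /null /b ?jmulE ?jtrE ?ie.1 ?ef ?ie.2 ?i_f.2; [vec; ring|ring].
have bb : T (b ** b) = 2%:R.
  by rewrite /b !jmulE ie.1 i_f.1 (ca_mulC f e) ef !jtrE ie.2 i_f.2; ring.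
have [h hU h0] : exists2 h, h \in unit_orth e b & h != 0.
  exists (vpick (unit_orth e b)); first exact: memv_pick.
  by rewrite vpick0 -dimv_eq0 dim_unit_orth // -lt0n ca_dim_gt0.
have /memv_unit_orth[nh bh] := hU.
have ind : indep2 (hat e) h by apply: pair01_indep; exists e.
have : linear_space <[hat e]>%VS <<[:: hat e; h]>>%VS.
  apply: linear_space_span => //; [exact: tr_hat|by case: nh|].
  by move=> D dD; apply: pair01_derivative dD => //; case: nh.
rewrite E => -[_ + _]; rewrite -memvE => /mem_span2[s [t hf]].
have fE : hat f = (- 2%:R^-1) *: hat e + 2%:R^-1 *: b.
  by rewrite !hatE i_f.2 ie.2 /b; vec; field.
clearbody b; have /eqP := congr1 (fun y => T (y ** b)) (etrans (esym fE) hf).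
rewrite !jmulE !jtrE bb (tr_hat_null nb) (jtrC h b) bh !mulr0 add0r mulVf ?n2 // addr0.
by rewrite oner_eq0.
Qed.

Lemma count_pair0 L : lines_of (pair0 (J := J)) L -> closed_line L ->
  (spaces_through general_points L #= `I_3)%card /\ (spaces_through special_points L #= `I_0)%card.
Proof.
move=> /pair0_frame[e [f [ie i_f ef LE]]] cL; rewrite !spaces_through_eq //.
have ig := third_idem1 ie i_f ef; set g := third e f in ig.
have mk i : idem1 i -> hat i \in L -> [set x | general_points x /\ (x <= L)%VS] <[hat i]>%VS.
  by move=> ii iL; split; [apply/general_pointsP; exists i|rewrite -memvE].
split; last first.
  have -> : [set x | special_points x /\ (x <= L)%VS] = set0.
    rewrite -subset0 => x [/special_pointsP[X [X0 XX tX ->]]]; rewrite -memvE LE => XL.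
    have [|a [b [c XE]]] := @hat_mem_frame e f X ie i_f; first by rewrite hat_traceless.
    have [||k k0 h] := @comb_rank1 e f ie i_f ef a b c; rewrite -?XE ?XX ?tX ?scale0r // in X0 *.
    case/eqP: k0; move: tX; rewrite XE; case: h => [->|[->|->]]; rewrite jtrE.
    - by rewrite ie.2 mulr1.
    - by rewrite i_f.2 mulr1.
    - by rewrite ig.2 mulr1.
  by rewrite image_set0 II0; apply: card_eq00.
have eL : hat e \in L by rewrite LE; apply/mem_span2; exists 1, 0; rewrite scale1r scale0r addr0.
have fL : hat f \in L by rewrite LE; apply/mem_span2; exists 0, 1; rewrite scale1r scale0r add0r.
have gL : hat g \in L.
  rewrite LE; apply/mem_span2; exists (-1), (-1); rewrite !hatE ig.2 ie.2 i_f.2 /g thirdE.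
  by vec; field.
have -> : [set linear_space x | x in [set x | general_points x /\ (x <= L)%VS]]
   = [set linear_space <[hat e]>%VS; linear_space <[hat f]>%VS; linear_space <[hat g]>%VS].
  apply/seteqP; split=> [_ [x [/general_pointsP[i ii ->] iL] <-]|S [[]|] -> /=].
  - move: iL; rewrite -memvE LE => /(hat_mem_frame ie i_f)[a [b [c iE]]].
    have [||k k0 h] := @comb_rank1 e f ie i_f ef a b c; rewrite -?iE ?ii.1 ?ii.2 ?scale1r //.
      exact: idem1_neq0.
    have ks z : idem1 z -> i = k *: z -> i = z.
      by move=> iz iz'; have := ii.2; rewrite iz' jtrE iz.2 mulr1 => ->; rewrite scale1r.
    rewrite -iE in h; case: h => [/ks ->|[/ks ->|/ks ->]] //; by [left; left|left; right|right].
  - by exists <[hat e]>%VS => //; apply: mk.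
  - by exists <[hat f]>%VS => //; apply: mk.
  - by exists <[hat g]>%VS => //; apply: mk.
apply: card_set3; apply: linear_space_idem_neq => //; [exact: third_e|exact: third_f].
Qed.

Lemma card_image1 (T1 T2 : Type) (h : T1 -> T2) (A : set T1) (x : T1) : A = [set x] -> (h @` A #= `I_1)%card.
Proof. by move=> ->; rewrite image_set1 card_set1. Qed.

Lemma card_image0 (T1 T2 : Type) (h : T1 -> T2) (A : set T1) : A = set0 -> (h @` A #= `I_0)%card.
Proof. by move=> ->; rewrite image_set0 II0; apply: card_eq00. Qed.

Lemma pair1_rank1 e n X : idem1 e -> null0 e n -> n != 0 -> T (n ** n) = 0 ->
  X ** X = T X *: X -> hat X \in <<[:: hat e; n]>>%VS ->
  exists a c, X = a *: e + c *: n /\ a * c = 0.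
Proof.
move=> ie [nn tn] n0 tnn XX /mem_span2[s [t E]]; have nnn : n ** n = 0 by rewrite (vv_null ie nn tn) tnn mulr0 scale0r.
pose b := (T X - s) / 3%:R; pose a := s + b.
have XE : X = a *: e + b *: (1j - e) + t *: n.
  by move: E; rewrite !hatE ie.2 => E; apply: (eq_byZ (c := 1) E); rewrite /a /b; vec; field.
clearbody a b; have tX : T X = a + 2%:R * b by rewrite XE !jtrE ie.2 tn; ring.
move: XX; rewrite tX XE !jmulE ie.1 (nn : e ** n = 0) (null_mulC nn) nnn => XX.
have ea := congr1 (fun y => T (e ** y)) XX; rewrite !jmulE ie.1 (nn : e ** n = 0) !jtrE ie.2 in ea.
have et := congr1 T XX; rewrite !jtrE ie.2 tn in et.
have ab : a * b = 0 by apply: (eq_by_scaled (c := - 2%:R^-1) ea); field.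
have b0 : b = 0.
  have : b * b = 0.
    have e1 : b * b = - 2%:R * (a * b) by apply: (eq_by_scaled (c := - 2%:R^-1) et); field.
    by rewrite e1 ab mulr0.
  by move/eqP; rewrite mulf_eq0 orbb => /eqP.
exists a, t; rewrite b0; split; first by vec; ring.
have : (a * t) *: n = 0 by move: XX; rewrite b0 => XX; apply: (eq_byZ (c := -1) XX); vec; ring.
by move/eqP; rewrite scaler_eq0 (negPf n0) orbF => /eqP.
Qed.

Lemma count_pair1 L : lines_of (pair1 (J := J)) L -> closed_line L ->
  (spaces_through general_points L #= `I_1)%card /\ (spaces_through special_points L #= `I_1)%card.
Proof.
move=> [_ [n [[[e [ie -> nn n0]] tnn] LE]]] cL; rewrite !spaces_through_eq //.
have nnn : n ** n = 0 by rewrite (vv_null ie nn.1 nn.2) tnn mulr0 scale0r.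
have eL : hat e \in L by rewrite LE; apply/mem_span2; exists 1, 0; rewrite scale1r scale0r addr0.
have nL : n \in L by rewrite LE; apply/mem_span2; exists 0, 1; rewrite scale1r scale0r add0r.
have cases X : X ** X = T X *: X -> hat X \in L -> exists a c, X = a *: e + c *: n /\ a * c = 0.
  by rewrite LE; apply: pair1_rank1.
split; [apply: (@card_image1 _ _ _ _ <[hat e]>%VS)|apply: (@card_image1 _ _ _ _ <[n]>%VS)]; apply/seteqP; split.
- move=> x [/general_pointsP[i ii ->]]; rewrite -memvE => iL.
  have [|a [c [iE ac]]] := cases i _ iL; first by rewrite ii.1 ii.2 scale1r.
  have a1 : a = 1 by have := ii.2; rewrite iE !jtrE ie.2 nn.2 => <-; ring.
  by rewrite iE a1; move: ac; rewrite a1 mul1r => ->; rewrite scale1r scale0r addr0.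
- by move=> x ->; split; [apply/general_pointsP; exists e|rewrite -memvE].
- move=> x [/special_pointsP[X [X0 XX tX ->]]]; rewrite -memvE => XL.
  have [||a [c [XE ac]]] := cases X; first by rewrite XX tX scale0r.
    by rewrite hat_traceless.
  have a0 : a = 0 by have := tX; rewrite XE !jtrE ie.2 nn.2 => <-; ring.
  rewrite XE a0 scale0r add0r /=; apply: line_scale.
  by apply: contraNneq X0 => c0; rewrite XE a0 c0 !scale0r addr0.
- move=> x ->; split; last by rewrite -memvE.
  by apply/special_pointsP; exists n; case: nn.
Qed.

Lemma pair24_rank1 X0 p g X : pair24 X0 p g -> X ** X = T X *: X -> hat X \in <<[:: X0; p]>>%VS ->
  exists s t, X = s *: X0 + t *: p /\ t ^+ 2 * g = 0.
Proof.
case=> e [ie [nX tX0] [XX0 Xn0] hp [Xp pp p0]] XX /mem_span2[s [t E]].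
pose b := T X / 3%:R; have XE : X = b *: 1j + (s *: X0 + t *: p).
  by move: E; rewrite hatE => E; apply: (eq_byZ (c := 1) E); rewrite /b; vec; field.
clearbody b; have tX : T X = 3%:R * b by rewrite XE !jtrE tX0 (tr_half ie hp); ring.
move: XX; rewrite tX XE !jmulE (ca_mulC p X0) XX0 Xp pp => XX.
have et := congr1 T XX; rewrite !jtrE tX0 (tr_half ie hp) in et.
have b0 : b = 0.
  have : b * b = 0 by apply: (eq_by_scaled (c := - 6%:R^-1) et); field.
  by move/eqP; rewrite mulf_eq0 orbb => /eqP.
exists s, t; rewrite b0; split; first by vec; ring.
have : (t ^+ 2 * g) *: X0 = 0 by move: XX; rewrite b0 => XX; apply: (eq_byZ (c := 1) XX); vec; ring.
by move/eqP; rewrite scaler_eq0 (negPf Xn0) orbF => /eqP.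
Qed.

Lemma pair24_no_general X0 p g L : pair24 X0 p g -> L = <<[:: X0; p]>>%VS ->
  [set x | general_points x /\ (x <= L)%VS] = set0.
Proof.
move=> P LE; rewrite -subset0 => x [/general_pointsP[i ii ->]]; rewrite -memvE LE => iL.
have [|s [t [iE _]]] := pair24_rank1 P _ iL; first by rewrite ii.1 ii.2 scale1r.
case: P => e [ie [nX tX0] _ hp _]; have := ii.2; rewrite iE !jtrE tX0 (tr_half ie hp) !mulr0 addr0 => /eqP.
by rewrite eq_sym oner_eq0.
Qed.

Lemma count_pair2 L : lines_of (pair2 (J := J)) L -> closed_line L ->
  (spaces_through general_points L #= `I_0)%card /\ (spaces_through special_points L #= `I_1)%card.
Proof.
move=> [X0 [p [[g g0 P] LE]]] cL; rewrite !spaces_through_eq //; split.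
  by apply: card_image0; apply: pair24_no_general P LE.
have X0L : X0 \in L by rewrite LE; apply/mem_span2; exists 1, 0; rewrite scale1r scale0r addr0.
apply: (@card_image1 _ _ _ _ <[X0]>%VS); apply/seteqP; split=> x.
  move=> [/special_pointsP[X [Xn0 XX tX ->]]]; rewrite -memvE => XL.
  have [||s [t [XE tg]]] := pair24_rank1 (X := X) P; first by rewrite XX tX scale0r.
    by rewrite hat_traceless // -LE.
  move/eqP: tg; rewrite mulf_eq0 (negPf g0) orbF expf_eq0 => /eqP t0.
  rewrite XE t0 scale0r addr0 /=; apply: line_scale.
  by apply: contraNneq Xn0 => s0; rewrite XE t0 s0 !scale0r addr0.
move=> ->; split; last by rewrite -memvE.
by case: P => e [ie [nX tX0] [XX0 Xn0] _ _]; apply/special_pointsP; exists X0.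
Qed.

Lemma pair4_square X0 p L : pair4 X0 p -> L = <<[:: X0; p]>>%VS -> forall X, X \in L -> X ** X = 0 /\ T X = 0.
Proof.
case=> e [ie [nX tX0] [XX0 Xn0] hp [Xp pp _]] -> X /mem_span2[s [t ->]].
rewrite !jmulE !jtrE (ca_mulC p X0) XX0 Xp pp tX0 (tr_half ie hp).
by split; [vec; ring|ring].
Qed.

(** For [N] with square [X] the line of [X] and [N] belongs to the space of [X]: differentiating the
    square gives T(D(X) N) = 2 T(D(N) X) = -2 T(D(X) N). On that line [X] is the only point of
    square 0. *)
Lemma linear_space_nil_neq X Y : X != 0 -> X ** X = 0 -> T X = 0 -> Y != 0 -> Y ** Y = 0 ->
  linear_space <[X]>%VS = linear_space <[Y]>%VS -> (<[X]> = <[Y]>)%VS.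
Proof.
move=> X0 XX tX Y0 YY E; have [e ie nX] := exists_idem1_null XX tX X0.
have [N [hN XN NN]] := exists_ker_square ie (conj nX tX) X0 XX.
have ind : indep2 X N.
  move=> a b e1; have := congr1 (ca_mul N) e1; rewrite !jmulE (ca_mulC N X) XN NN scaler0 add0r => /eqP.
  rewrite scaler_eq0 (negPf X0) orbF => /eqP b0; move: e1; rewrite b0 scale0r addr0 => /eqP.
  by rewrite scaler_eq0 (negPf X0) orbF => /eqP.
have : linear_space <[X]>%VS <<[:: X; N]>>%VS.
  apply: linear_space_span => //; first exact: (tr_half ie hN).
  move=> D dD; have e1 : T (D X ** N) = 2%:R * T (D N ** X).
    by rewrite -{1}NN dD (ca_mulC N) jmulDl jtrD ca_trA NN; ring.
  have e2 := derivative_tr_anti N X dD; rewrite e2 in e1.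
  by apply: (eq_by_scaled (c := 3%:R^-1) e1); field.
rewrite E => -[_ + _]; rewrite -memvE => /mem_span2[s [t YE]].
have t0 : t = 0.
  have : t ^+ 2 *: X = 0 by move: YY; rewrite YE !jmulE XX XN (ca_mulC N X) XN NN => YY; apply: (eq_byZ (c := 1) YY); vec; ring.
  by move/eqP; rewrite scaler_eq0 (negPf X0) orbF expf_eq0 => /eqP.
rewrite YE t0 scale0r addr0 line_scale //.
by apply: contraNneq Y0 => s0; rewrite YE t0 s0 !scale0r addr0.
Qed.

Lemma trdeg_line L : \dim L = 2%N -> coordinate_trdeg [set v | v != 0 /\ v \in L] 2.
Proof.
move=> dL; set K := [set v | _]; split.
  have [u uL u0] : exists2 u, u \in L & u != 0.
    by exists (vpick L); [exact: memv_pick|rewrite vpick0 -dimv_eq0 dL].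
  have [y tyu] := nondegW u0; rewrite -dL -dim_subvs.
  apply: (@rank_ge_jets _ _ _ K u (fun t : subvs_of L => vsval t)).
  - by move=> a t t'; rewrite linearP.
  - by move=> t t0; apply: val_inj.
  move=> t; exists ((T (u ** y))%:P + T (vsval t ** y) *: 'X), (fun=> 0); split.
  - apply/eqP => /(congr1 (fun q : {poly F} => q`_0)).
    by rewrite coefD coefC coefZ coefX mulr0 addr0 coef0 => /eqP; rewrite (negPf tyu).
  - exact: polymapC.
  move=> s; rewrite hornerD hornerC hornerZ hornerX scaler0 addr0 => hs; split.
    apply: contraNneq hs => e1; have := congr1 (fun z => T (z ** y)) e1.
    by rewrite !jmulE !jtrE mulrC => ->.
  by rewrite memvD // memvZ // subvsP.
move=> m f fK; have vP : polymap (fun t : subvs_of L => vsval t) by apply: polymap_linear => a x y; rewrite linearP.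
apply: (@rank_ge_leq _ _ K _ _ unit (fun _ => subvs_of L) (fun _ t => vsval t)) => //.
- by move=> _; rewrite dim_subvs dL.
- by move=> v [_ vL]; exists tt, (vsproj L v); rewrite vsprojK.
- by exists f.
Qed.

Lemma count_pair4 L : lines_of (pair4 (J := J)) L -> closed_line L ->
  [/\ (spaces_through general_points L #= `I_0)%card,
      points_dim [set x | special_points x /\ linear_space x L] 1
    & set_bij [set x | special_points x /\ linear_space x L] (spaces_through special_points L) linear_space].
Proof.
move=> [X0 [p [P LE]]] cL; have sq := pair4_square P LE; split.
- by rewrite spaces_through_eq //; apply: card_image0; apply: pair24_no_general P LE.
- rewrite /points_dim /proj_dim; have -> : cone_of_points [set x | special_points x /\ linear_space x L] = [set v | v != 0 /\ v \in L].
    apply/seteqP; split=> v [v0].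
      by case=> _ /(linear_space_closed _ cL); rewrite -memvE.
    move=> vL; have [vv tv] := sq v vL; split=> //; split; first by apply/special_pointsP; exists v.
    by apply/(linear_space_closed _ cL); rewrite -memvE.
  by apply: trdeg_line; case: cL.
split.
- by move=> x [sx xL]; split=> //; exists x.
- move=> x y; rewrite !inE => -[/special_pointsP[X [Xn0 XX tX ->]] _] [/special_pointsP[Y [Yn0 YY tY ->]] _].
  exact: linear_space_nil_neq.
- by move=> S [[x sx <-] xL]; exists x.
Qed.

End Points.

(** * Cayley-Dickson algebras *)

Section CayleyDicksonTheory.
Variable F : numClosedFieldType.
Local Notation A := (cd F).

Lemma cd_conj_linear k a (x y : A k) : cd_conj (a *: x + y) = a *: cd_conj x + cd_conj y.
Proof.
elim: k x y => [//|k IH] [x1 x2] [y1 y2] /=; rewrite IH; congr pair.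
by rewrite /=; vec; ring.
Qed.

Lemma cd_conjD k (x y : A k) : cd_conj (x + y) = cd_conj x + cd_conj y.
Proof. by have := cd_conj_linear 1 x y; rewrite !scale1r. Qed.
Lemma cd_conj0 k : cd_conj (0 : A k) = 0.
Proof. by have := cd_conj_linear (-1) (0 : A k) 0; rewrite scaler0 addr0 scaleN1r addNr. Qed.
Lemma cd_conjZ k a (x : A k) : cd_conj (a *: x) = a *: cd_conj x.
Proof. by have := cd_conj_linear a x 0; rewrite cd_conj0 !addr0. Qed.
Lemma cd_conjN k (x : A k) : cd_conj (- x) = - cd_conj x.
Proof. by rewrite -scaleN1r cd_conjZ scaleN1r. Qed.
Lemma cd_conjK k (x : A k) : cd_conj (cd_conj x) = x.
Proof. by elim: k x => [//|k IH] [x1 x2] /=; rewrite IH opprK. Qed.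

Lemma cd_mul_bilinear k : (forall a (x y z : A k), cd_mul (a *: x + y) z = a *: cd_mul x z + cd_mul y z) /\
  (forall a (x y z : A k), cd_mul z (a *: x + y) = a *: cd_mul z x + cd_mul z y).
Proof.
elim: k => [|k [IHl IHr]]; first by split=> a x y z /=; rewrite /GRing.scale /=; ring.
have p a (x y : A k * A k) : a *: x + y = (a *: x.1 + y.1, a *: x.2 + y.2) by case: x y => [? ?] [? ?].
by split=> a [x1 x2] [y1 y2] [z1 z2]; rewrite !p /= ?cd_conj_linear !(IHl, IHr); congr pair;
  rewrite /=; vec; ring.
Qed.

Lemma cd_mulDl k (x y z : A k) : cd_mul (x + y) z = cd_mul x z + cd_mul y z.
Proof. by have := (cd_mul_bilinear k).1 1 x y z; rewrite !scale1r. Qed.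
Lemma cd_mulDr k (x y z : A k) : cd_mul z (x + y) = cd_mul z x + cd_mul z y.
Proof. by have := (cd_mul_bilinear k).2 1 x y z; rewrite !scale1r. Qed.
Lemma cd_mul0l k (z : A k) : cd_mul 0 z = 0.
Proof. by have := (cd_mul_bilinear k).1 (-1) 0 0 z; rewrite scaler0 addr0 scaleN1r addNr. Qed.
Lemma cd_mul0r k (z : A k) : cd_mul z 0 = 0.
Proof. by have := (cd_mul_bilinear k).2 (-1) 0 0 z; rewrite scaler0 addr0 scaleN1r addNr. Qed.
Lemma cd_mulZl k a (x z : A k) : cd_mul (a *: x) z = a *: cd_mul x z.
Proof. by have := (cd_mul_bilinear k).1 a x 0 z; rewrite cd_mul0l !addr0. Qed.
Lemma cd_mulZr k a (x z : A k) : cd_mul z (a *: x) = a *: cd_mul z x.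
Proof. by have := (cd_mul_bilinear k).2 a x 0 z; rewrite cd_mul0r !addr0. Qed.
Lemma cd_mulNl k (x z : A k) : cd_mul (- x) z = - cd_mul x z.
Proof. by rewrite -scaleN1r cd_mulZl scaleN1r. Qed.
Lemma cd_mulNr k (x z : A k) : cd_mul z (- x) = - cd_mul z x.
Proof. by rewrite -scaleN1r cd_mulZr scaleN1r. Qed.

Lemma cd_scalar_linear k a (x y : A k) : cd_scalar (a *: x + y) = a * cd_scalar x + cd_scalar y.
Proof. by elim: k x y => [//|k IH] [x1 x2] [y1 y2] /=; rewrite IH. Qed.
Lemma cd_scalarD k (x y : A k) : cd_scalar (x + y) = cd_scalar x + cd_scalar y.
Proof. by have := cd_scalar_linear 1 x y; rewrite scale1r mul1r. Qed.
Lemma cd_scalar0 k : cd_scalar (0 : A k) = 0.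
Proof. by have := cd_scalar_linear (-1) (0 : A k) 0; rewrite scaler0 addr0 mulN1r addNr. Qed.
Lemma cd_scalarZ k a (x : A k) : cd_scalar (a *: x) = a * cd_scalar x.
Proof. by have := cd_scalar_linear a x 0; rewrite cd_scalar0 !addr0. Qed.
Lemma cd_scalarN k (x : A k) : cd_scalar (- x) = - cd_scalar x.
Proof. by rewrite -scaleN1r cd_scalarZ mulN1r. Qed.

Definition cdE := (cd_conjD, cd_conjZ, cd_conjN, cd_conj0, cd_conjK,
  cd_mulDl, cd_mulDr, cd_mulZl, cd_mulZr, cd_mulNl, cd_mulNr, cd_mul0l, cd_mul0r).
Definition cd_scalarE := (cd_scalarD, cd_scalarZ, cd_scalarN, cd_scalar0).

Lemma cd_scalar_conj k (x : A k) : cd_scalar (cd_conj x) = cd_scalar x.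
Proof. by elim: k x => [//|k IH] [x1 x2] /=. Qed.

Lemma cd_of_scalar_linear k a b c : @cd_of_scalar F k (a * b + c) = a *: @cd_of_scalar F k b + @cd_of_scalar F k c.
Proof. by elim: k => [//|k IH] /=; rewrite IH; congr pair; rewrite /= scaler0 addr0. Qed.

Definition cd_one k : A k := @cd_of_scalar F k 1.

Lemma cd_of_scalarE k c : @cd_of_scalar F k c = c *: cd_one k.
Proof.
have := cd_of_scalar_linear k c 1 0; rewrite mulr1 addr0 => ->.
have -> : @cd_of_scalar F k (0 : F) = 0.
  by have := cd_of_scalar_linear k (-1) 0 0; rewrite mulr0 addr0 scaleN1r addNr.
by rewrite addr0.
Qed.

Lemma cd_conj1 k : cd_conj (cd_one k) = cd_one k.
Proof. by elim: k => [//|k IH]; rewrite /cd_one /= oppr0 -/(cd_one k) IH. Qed.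

Lemma cd_scalar1 k : cd_scalar (cd_one k) = 1.
Proof. by elim: k => [//|k IH]. Qed.

Lemma cd_mul1 k (x : A k) : cd_mul (cd_one k) x = x /\ cd_mul x (cd_one k) = x.
Proof.
elim: k x => [x|k IH [x1 x2]]; first by rewrite /= mul1r mulr1.
rewrite /= -/(cd_one k) cd_conj1 (IH _).1 (IH _).2 (IH _).2 !cdE.
by rewrite !subr0 ?addr0 add0r.
Qed.

Lemma cd_conj_trace k (x : A k) : cd_conj x = (2%:R * cd_scalar x) *: cd_one k - x.
Proof.
elim: k x => [x|k IH [x1 x2]] /=.
  by rewrite /GRing.scale /= /cd_one /=; ring.
by rewrite IH; congr pair; rewrite /= scaler0 add0r.
Qed.

Lemma cd_conjM k (x y : A k) : cd_conj (cd_mul x y) = cd_mul (cd_conj y) (cd_conj x).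
Proof.
elim: k x y => [x y|k IH [x1 x2] [y1 y2]] /=; first by rewrite mulrC.
by rewrite !cdE !IH !cdE; congr pair; rewrite /=; vec; ring.
Qed.

Lemma cd_scalarC k (x y : A k) : cd_scalar (cd_mul x y) = cd_scalar (cd_mul y x).
Proof.
elim: k x y => [x y|k IH [x1 x2] [y1 y2]] /=; first by rewrite mulrC.
by rewrite !cd_scalarE IH -(cd_scalar_conj (cd_mul (cd_conj y2) x2)) cd_conjM cdE.
Qed.

Definition cd_form k (x y : A k) : F := cd_scalar (cd_mul x (cd_conj y)).

Lemma cd_formC k (x y : A k) : cd_form x y = cd_form y x.
Proof. by rewrite /cd_form -cd_scalar_conj cd_conjM cdE. Qed.

Lemma cd_form_pair k (x y : A k.+1) : cd_form x y = cd_form x.1 y.1 + cd_form x.2 y.2.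
Proof. by rewrite /cd_form /= !cdE opprK cd_scalarE; congr (_ + _); rewrite cd_scalarC. Qed.

Lemma cd_form_nondeg k (x : A k) : (forall y, cd_form x y = 0) -> x = 0.
Proof.
elim: k x => [x|k IH x] x0; first by have := x0 1; rewrite /cd_form /= mulr1.
rewrite [x]surjective_pairing; congr pair; apply: IH => y.
  by have := x0 (y, 0); rewrite cd_form_pair /= {2}/cd_form !cdE cd_scalar0 addr0.
by have := x0 (0, y); rewrite cd_form_pair /= {1}/cd_form !cdE cd_scalar0 add0r.
Qed.

Lemma cd_mul_conj k (x : A k) : cd_mul x (cd_conj x) = cd_form x x *: cd_one k.
Proof.
have h : cd_conj (cd_mul x (cd_conj x)) = cd_mul x (cd_conj x) by rewrite cd_conjM cdE.
have := cd_conj_trace (cd_mul x (cd_conj x)); rewrite h -/(cd_form x x) => e.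
by apply: (eq_byZ (c := 2%:R^-1) e); vec; field.
Qed.

Lemma cd_conj_mul k (x : A k) : cd_mul (cd_conj x) x = cd_form x x *: cd_one k.
Proof.
have := cd_mul_conj (cd_conj x); rewrite cdE => ->.
by rewrite /cd_form cdE cd_scalarC.
Qed.

Definition cd_assoc k := forall x y z : A k, cd_mul (cd_mul x y) z = cd_mul x (cd_mul y z).
Definition cd_comm k := forall x y : A k, cd_mul x y = cd_mul y x.

Lemma cd_assoc_succ k : cd_comm k -> cd_assoc k -> cd_assoc k.+1.
Proof.
move=> C Ass [x1 x2] [y1 y2] [z1 z2] /=; rewrite !cdE !cd_conjM !cdE.
have ac x y z : cd_mul x (cd_mul y z) = cd_mul y (cd_mul x z) :> A k by rewrite -!Ass (C x).
congr pair; rewrite /= !Ass.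
  rewrite (C y1 z1) (C x2 (cd_conj y1)) (C y2 x1) (C (cd_conj y2) (cd_mul _ _)) !Ass.
  rewrite (ac x2 z1) (C x2 (cd_conj y2)) (ac x1 (cd_conj z2)) (ac (cd_conj y1)).
  by vec; ring.
by rewrite (C y1 x1) !(C (cd_conj z1)) (C (cd_conj y2) x2) (C (cd_conj y2) z2) (ac z2 x2); vec; ring.
Qed.

Lemma cd_assoc_leq2 k : (k <= 2)%N -> cd_assoc k.
Proof.
have C0 : cd_comm 0 by move=> x y; rewrite /= mulrC.
have A0 : cd_assoc 0 by move=> x y z; rewrite /= mulrA.
have C1 : cd_comm 1.
  by move=> [x1 x2] [y1 y2]; congr pair; rewrite /=; ring.
case: k => [|[|[|//]]] _; [exact: A0| exact: cd_assoc_succ|].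
by apply: (cd_assoc_succ C1); apply: cd_assoc_succ.
Qed.

(** The bound k <= 3 comes from here: the law holds for a doubling of an associative algebra, and
    the doublings are associative up to k = 2. *)
Lemma cd_alternative k (x y : A k) : (k <= 3)%N ->
  cd_mul (cd_conj x) (cd_mul x y) = cd_form x x *: y.
Proof.
case: k x y => [x y _|k [x1 x2] [y1 y2] k2].
  by rewrite /cd_form /= mulrA.
have Ass : cd_assoc k by apply: cd_assoc_leq2.
rewrite cd_form_pair /= !(cdE, cd_conjM) ?Ass.
congr pair; rewrite /= -?(Ass (cd_conj x1) x1) -?(Ass x2) ?(cd_conj_mul, cd_mul_conj) !cdE;
  by rewrite ?(cd_mul1 _).1 ?(cd_mul1 _).2; vec; ring.
Qed.

(** The coefficient of the unit is associative and cyclic at every level of doubling, which yields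
    the associativity of the trace form. *)
Lemma cd_scalarA k (x y z : A k) :
  cd_scalar (cd_mul (cd_mul x y) z) = cd_scalar (cd_mul x (cd_mul y z)).
Proof.
elim: k x y z => [x y z|k IH [x1 x2] [y1 y2] [z1 z2]] /=; first by rewrite mulrA.
rewrite !(cdE, cd_conjM) !cd_scalarE !IH.
have cyc (a b c : A k) : cd_scalar (cd_mul a (cd_mul b c)) = cd_scalar (cd_mul b (cd_mul c a)) :> F.
  by rewrite cd_scalarC IH.
by rewrite (cyc x1 (cd_conj z2)) (cyc (cd_conj y1)) (cyc z1); ring.
Qed.

Lemma cd_alternativer k (x y : A k) : (k <= 3)%N ->
  cd_mul (cd_mul y x) (cd_conj x) = cd_form x x *: y.
Proof.
move=> k3; have := congr1 (@cd_conj F k) (cd_alternative (cd_conj x) (cd_conj y) k3).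
rewrite !(cdE, cd_conjM) /cd_form !cdE => ->.
by rewrite cd_scalarC.
Qed.

Lemma dim_cd k : \dim {:A k} = (2 ^ k)%N.
Proof.
rewrite dimvf; elim: k => [|k IH]; first by [].
by rewrite expnS mul2n -addnn -{1}IH -IH.
Qed.
End CayleyDicksonTheory.

(** * Hermitian matrices form a cubic Jordan algebra *)

Lemma ordS3K (i : 'I_3) : ordS (ordS (ordS i)) = i.
Proof. by apply: val_inj; case: i => [[|[|[|]]]]. Qed.

Lemma ordS3_neq (i : 'I_3) : (ordS i == i) = false.
Proof. by case: i => [[|[|[|]]]]. Qed.

Lemma ordSS3_neq (i : 'I_3) : (ordS (ordS i) == i) = false.
Proof. by case: i => [[|[|[|]]]]. Qed.

Lemma ord3_ind (P : 'I_3 -> Prop) i : P i -> P (ordS i) -> P (ordS (ordS i)) -> forall j, P j.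
Proof.
move=> p0 p1 p2 j.
have [->//|ne0] := eqVneq j i; have [->//|ne1] := eqVneq j (ordS i).
suff -> : j = ordS (ordS i) by [].
by apply: val_inj; move: ne0 ne1; rewrite -!val_eqE; clear; case: i j => [[|[|[|]]] // ?] [[|[|[|]]]].
Qed.

Lemma sum_ord3 (V : nmodType) (f : 'I_3 -> V) i : \sum_l f l = f i + f (ordS i) + f (ordS (ordS i)).
Proof.
rewrite (bigD1 i) // (bigD1 (ordS i)) ?ordS3_neq //= (bigD1 (ordS (ordS i))) /=; last first.
  by rewrite ordSS3_neq ordS3_neq.
rewrite big1 ?addr0 ?addrA // => j /andP[/andP[n0 n1] n2]; exfalso.
by move: j n0 n1 n2; apply: (ord3_ind (i := i)); rewrite eqxx.
Qed.

Section HermitianMatrices.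
Variables (F : numClosedFieldType) (k : nat) (hk : (k <= 3)%N).
Local Notation A := (cd F k).
Local Notation J := (J3 F k).
Implicit Types X Y Z : J.

Lemma J3_ext X Y : (forall i, X.1 i = Y.1 i) -> (forall i, X.2 i = Y.2 i) -> X = Y.
Proof. by case: X Y => [X1 X2] [Y1 Y2] /= e1 e2; congr pair; apply/ffunP. Qed.

Lemma J3_linear1 a X Y i : (a *: X + Y).1 i = a * X.1 i + Y.1 i.
Proof. by rewrite /= !ffunE. Qed.

Lemma J3_linear2 a X Y i : (a *: X + Y).2 i = a *: X.2 i + Y.2 i.
Proof. by rewrite /= !ffunE. Qed.

Lemma entry_diag X i : entry X i i = X.1 i *: cd_one F k.
Proof. by rewrite /entry eqxx cd_of_scalarE. Qed.

Lemma entry_next X i : entry X i (ordS i) = X.2 i.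
Proof. by rewrite /entry eq_sym ordS3_neq eqxx. Qed.

Lemma entry_prev X i : entry X (ordS i) i = cd_conj (X.2 i).
Proof.
by rewrite /entry ordS3_neq -{1}(ordS3K i) ordS3_neq.
Qed.

Lemma jordan_mul_diag X Y i : (jordan_mul X Y).1 i =
  X.1 i * Y.1 i + cd_form (X.2 i) (Y.2 i)
  + cd_form (X.2 (ordS (ordS i))) (Y.2 (ordS (ordS i))).
Proof.
have h Z Z' : cd_scalar (mat_mul (entry Z) (entry Z') i i) =
    Z.1 i * Z'.1 i + cd_form (Z.2 i) (Z'.2 i)
    + cd_form (Z.2 (ordS (ordS i))) (Z'.2 (ordS (ordS i))).
  have e (W : J) : entry W i (ordS (ordS i)) = cd_conj (W.2 (ordS (ordS i))).
    by have := entry_prev W (ordS (ordS i)); rewrite ordS3K.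
  have e' (W : J) : entry W (ordS (ordS i)) i = W.2 (ordS (ordS i)).
    by have := entry_next W (ordS (ordS i)); rewrite ordS3K.
  rewrite /mat_mul (sum_ord3 _ i) !entry_diag entry_next entry_prev e e'.
  rewrite !cdE (cd_mul1 _).1 !cd_scalarE cd_scalar1 mulr1; congr (_ + _ + _).
  by rewrite cd_formC /cd_form cd_scalarC.
rewrite /= ffunE cd_scalarE cd_scalarD !h !(cd_formC (Y.2 _)).
by field.
Qed.

Lemma jordan_mul_off X Y i : (jordan_mul X Y).2 i =
  2%:R^-1 *: ((X.1 i + X.1 (ordS i)) *: Y.2 i + (Y.1 i + Y.1 (ordS i)) *: X.2 i
    + cd_mul (cd_conj (X.2 (ordS (ordS i)))) (cd_conj (Y.2 (ordS i)))
    + cd_mul (cd_conj (Y.2 (ordS (ordS i)))) (cd_conj (X.2 (ordS i)))).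
Proof.
have h Z Z' : mat_mul (entry Z) (entry Z') i (ordS i) =
    Z.1 i *: Z'.2 i + Z'.1 (ordS i) *: Z.2 i
    + cd_mul (cd_conj (Z.2 (ordS (ordS i)))) (cd_conj (Z'.2 (ordS i))).
  have e : entry Z i (ordS (ordS i)) = cd_conj (Z.2 (ordS (ordS i))).
    by have := entry_prev Z (ordS (ordS i)); rewrite ordS3K.
  rewrite /mat_mul (sum_ord3 _ i) !entry_diag !entry_next entry_prev e.
  by rewrite !cdE (cd_mul1 _).1 (cd_mul1 _).2.
by rewrite /= ffunE !h; vec; ring.
Qed.

Lemma jordan_mulC X Y : jordan_mul X Y = jordan_mul Y X.
Proof.
apply: J3_ext => i; first by rewrite !jordan_mul_diag mulrC cd_formC (cd_formC (X.2 (ordS _))).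
by rewrite !jordan_mul_off; vec; ring.
Qed.

Lemma cd_form_linear a (x y z : A) : cd_form (a *: x + y) z = a * cd_form x z + cd_form y z.
Proof. by rewrite /cd_form !cdE !cd_scalarE. Qed.

Lemma jordan_mul_linear a X Y Z : jordan_mul (a *: X + Y) Z = a *: jordan_mul X Z + jordan_mul Y Z.
Proof.
apply: J3_ext => i.
  by rewrite J3_linear1 !jordan_mul_diag !J3_linear1 !J3_linear2 !cd_form_linear; ring.
by rewrite J3_linear2 !jordan_mul_off !J3_linear1 !J3_linear2 !cdE; vec; ring.
Qed.

Lemma jordan_mul_one X : jordan_mul (jordan_one F k) X = X.
Proof.
apply: J3_ext => i.
  by rewrite jordan_mul_diag /= !ffunE /cd_form !cdE cd_scalar0; ring.
by rewrite jordan_mul_off /= !ffunE !cdE; vec; field.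
Qed.

Lemma trace_linear a X Y : trace (a *: X + Y) = a * trace X + trace Y.
Proof. by rewrite /trace !(sum_ord3 _ ord0) !J3_linear1; ring. Qed.

Lemma trace_one : trace (jordan_one F k) = 3%:R.
Proof. by rewrite /trace !(sum_ord3 _ ord0) /= !ffunE; ring. Qed.

Lemma trace_mul X Y i : trace (jordan_mul X Y) = X.1 i * Y.1 i + X.1 (ordS i) * Y.1 (ordS i)
  + X.1 (ordS (ordS i)) * Y.1 (ordS (ordS i)) + 2%:R * (cd_form (X.2 i) (Y.2 i)
  + cd_form (X.2 (ordS i)) (Y.2 (ordS i)) + cd_form (X.2 (ordS (ordS i))) (Y.2 (ordS (ordS i)))).
Proof. by rewrite /trace (sum_ord3 _ i) !jordan_mul_diag !ordS3K; ring. Qed.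

Definition cd_triple (x y z : A) : F := cd_scalar (cd_mul x (cd_mul y z)).

Lemma cd_tripleC x y z : cd_triple x y z = cd_triple y z x.
Proof. by rewrite /cd_triple cd_scalarC cd_scalarA. Qed.

Lemma cd_form_conjM (x y z : A) : cd_form (cd_mul (cd_conj x) (cd_conj y)) z = cd_triple z y x.
Proof.
by rewrite cd_formC /cd_form cd_conjM !cdE.
Qed.

Lemma trace_mulA X Y Z :
  trace (jordan_mul (jordan_mul X Y) Z) = trace (jordan_mul X (jordan_mul Y Z)).
Proof.
rewrite [in RHS]jordan_mulC !(trace_mul _ _ ord0) !jordan_mul_diag !jordan_mul_off !ordS3K.
have fD (x y z : A) : cd_form (x + y) z = cd_form x z + cd_form y z.
  by have := cd_form_linear 1 x y z; rewrite scale1r mul1r.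
have fZ a (x z : A) : cd_form (a *: x) z = a * cd_form x z.
  by rewrite /cd_form !cdE cd_scalarE.
rewrite !(fD, fZ, cd_form_conjM) !(cd_formC (Y.2 _)) !(cd_formC (X.2 _) (Z.2 _)) !(cd_formC (X.2 _) (Y.2 _)).
rewrite !(cd_tripleC (X.2 _) (Y.2 _)) !(cd_tripleC (Y.2 _)) !(cd_tripleC (X.2 _)).
repeat match goal with |- context [cd_triple ?x ?y ?z] => move: (cd_triple x y z) => ? end.
repeat match goal with |- context [cd_form ?x ?y] => move: (cd_form x y) => ? end.
repeat match goal with |- context [X.1 ?i] => move: (X.1 i) => ? end.
repeat match goal with |- context [Y.1 ?i] => move: (Y.1 i) => ? end.
repeat match goal with |- context [Z.1 ?i] => move: (Z.1 i) => ? end.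
by field.
Qed.

Definition diag_unit i : J := ([ffun l => (l == i)%:R], 0).
Definition off_unit i (x : A) : J := (0, [ffun l => if l == i then x else 0]).

Lemma trace_nondeg X : (forall Y, trace (jordan_mul X Y) = 0) -> X = 0.
Proof.
have f0 (x : A) : cd_form x 0 = 0 by rewrite /cd_form !cdE cd_scalar0.
move=> X0; apply: J3_ext => i.
  have := X0 (diag_unit i); rewrite (trace_mul _ _ i) /= !ffunE !f0 eqxx ordS3_neq ordSS3_neq.
  move=> e; suff -> : X.1 i = 0 by [].
  by rewrite -{}e /=; ring.
suff -> : X.2 i = 0 by rewrite ffunE.
apply: cd_form_nondeg => y; have := X0 (off_unit i y).
rewrite (trace_mul _ _ i) /= !ffunE eqxx ordS3_neq ordSS3_neq !f0 => e.
by apply: (eq_by_scaled (c := 2%:R^-1) e); field.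
Qed.

(** The determinant of the Hermitian matrix, written from an arbitrary starting index [i] so that
    every entry of a matrix equation can be treated as the first one. *)
Definition cubic_norm X i := X.1 i * X.1 (ordS i) * X.1 (ordS (ordS i))
  - (X.1 (ordS (ordS i)) * cd_form (X.2 i) (X.2 i) + X.1 i * cd_form (X.2 (ordS i)) (X.2 (ordS i))
     + X.1 (ordS i) * cd_form (X.2 (ordS (ordS i))) (X.2 (ordS (ordS i))))
  + 2%:R * cd_triple (X.2 i) (X.2 (ordS i)) (X.2 (ordS (ordS i))).

Lemma cubic_norm_cycle X i j : cubic_norm X i = cubic_norm X j.
Proof.
have h l : cubic_norm X (ordS l) = cubic_norm X l.
  by rewrite /cubic_norm !ordS3K -(cd_tripleC (X.2 l)); ring.
by move: j; apply: (ord3_ind (i := i)); rewrite ?h.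
Qed.

Lemma jordan_char X : jordan_mul (jordan_mul X X) X - trace X *: jordan_mul X X
  + (2%:R^-1 * (trace X ^+ 2 - trace (jordan_mul X X))) *: X = cubic_norm X ord0 *: jordan_one F k.
Proof.
have fD (x y z : A) : cd_form (x + y) z = cd_form x z + cd_form y z.
  by have := cd_form_linear 1 x y z; rewrite scale1r mul1r.
have fZ a (x z : A) : cd_form (a *: x) z = a * cd_form x z.
  by rewrite /cd_form !cdE cd_scalarE.
have E (a b : F) Y Z W : (Y - a *: Z + b *: W).1 =1 (fun i => Y.1 i - a * Z.1 i + b * W.1 i) /\
   (Y - a *: Z + b *: W).2 =1 (fun i => Y.2 i - a *: Z.2 i + b *: W.2 i).
  by split=> i; rewrite /= !ffunE.
have R1 c i : (c *: jordan_one F k).1 i = c by rewrite /= !ffunE [LHS]mulr1.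
have R2 c i : (c *: jordan_one F k).2 i = 0 by rewrite /= !ffunE scaler0.
apply: J3_ext => i.
  rewrite (E _ _ _ _ _).1 R1 (cubic_norm_cycle X _ i).
  rewrite (trace_mul _ _ i) /trace !(sum_ord3 _ i) !jordan_mul_diag !jordan_mul_off !ordS3K.
  rewrite !(fD, fZ, cd_form_conjM) !(cd_tripleC (X.2 (ordS (ordS i)))) /cubic_norm.
  repeat match goal with |- context [cd_triple ?x ?y ?z] => move: (cd_triple x y z) => ? end.
  repeat match goal with |- context [cd_form ?x ?y] => move: (cd_form x y) => ? end.
  repeat match goal with |- context [X.1 ?i] => move: (X.1 i) => ? end.
  by field.
rewrite (E _ _ _ _ _).2 R2.
rewrite (trace_mul _ _ i) /trace !(sum_ord3 _ i) !(jordan_mul_off, jordan_mul_diag) !ordS3K.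
rewrite !(cdE, cd_conjM).
(* Off the diagonal the cube contains products of three octonions, which the alternative laws reduce
   to multiples of an entry. *)
rewrite (cd_alternative _ _ hk) (cd_alternativer _ _ hk); vec.
repeat match goal with |- context [cd_form ?x ?y] => move: (cd_form x y) => ? end.
repeat match goal with |- context [l ?x] => move: (l x) => ? end.
repeat match goal with |- context [X.1 ?i] => move: (X.1 i) => ? end.
by field.
Qed.

(** Inclusion and exclusion over the partial sums of [X], [Y], [Z] extracts the trilinear part of
    [jordan_char]; the constant is the polarized norm. *)
Lemma jordan_char_polar X Y Z : exists nu,
  jordan_mul (jordan_mul X Y) Z + jordan_mul (jordan_mul Y Z) X + jordan_mul (jordan_mul Z X) Y
    - (trace X *: jordan_mul Y Z + trace Y *: jordan_mul Z X + trace Z *: jordan_mul X Y)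
    + 2%:R^-1 *: ((trace X * trace Y - trace (jordan_mul X Y)) *: Z
      + (trace Y * trace Z - trace (jordan_mul Y Z)) *: X
      + (trace Z * trace X - trace (jordan_mul Z X)) *: Y) = nu *: jordan_one F k.
Proof.
have [N E] : exists N, forall V, N V *: jordan_one F k = jordan_mul (jordan_mul V V) V
    - trace V *: jordan_mul V V + (2%:R^-1 * (trace V ^+ 2 - trace (jordan_mul V V))) *: V.
  by exists (fun V => cubic_norm V ord0) => V; rewrite jordan_char.
exists (2%:R^-1 * (N (X + Y + Z) - N (X + Y) - N (Y + Z) - N (X + Z) + N X + N Y + N Z)).
rewrite -scalerA !scalerDl !scaleNr !E.
have mDl (U V W : J) : jordan_mul (U + V) W = jordan_mul U W + jordan_mul V W.
  by have := jordan_mul_linear 1 U V W; rewrite !scale1r.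
have mDr (U V W : J) : jordan_mul W (U + V) = jordan_mul W U + jordan_mul W V.
  by rewrite jordan_mulC mDl !(jordan_mulC _ W).
have tD (U V : J) : trace (U + V) = trace U + trace V.
  by have := trace_linear 1 U V; rewrite scale1r mul1r.
rewrite !(mDl, mDr, tD) !(jordan_mulC Z X) !(jordan_mulC Y X) !(jordan_mulC Z Y).
repeat match goal with |- context [jordan_mul (jordan_mul ?x ?y) ?z] =>
  move: (jordan_mul (jordan_mul x y) z) => ? end.
repeat match goal with |- context [jordan_mul ?x ?y] => move: (jordan_mul x y) => ? end.
repeat match goal with |- context [trace ?x] => move: (trace x) => ? end.
vec.
repeat match goal with |- context [l ?x] => move: (l x) => ? end.
by field.
Qed.

Lemma diag_unit_mul i X : jordan_mul (diag_unit i) X =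
  ([ffun l => (l == i)%:R * X.1 i],
   [ffun l => 2%:R^-1 *: (((l == i)%:R + (ordS l == i)%:R) *: X.2 l)]).
Proof.
apply: J3_ext => l.
  rewrite jordan_mul_diag /= !ffunE /cd_form !cdE cd_scalar0 !addr0.
  by case: eqP => [->|] //; rewrite !mul0r.
by rewrite jordan_mul_off /= !ffunE !cdE; vec; ring.
Qed.

Lemma diag_unit_mul_diag i : jordan_mul (diag_unit i) (diag_unit i) = diag_unit i.
Proof.
rewrite diag_unit_mul; congr pair; apply/ffunP => l; rewrite !ffunE.
  by rewrite eqxx mulr1.
by rewrite !scaler0.
Qed.

Lemma diag_unit_orth i j : i != j -> jordan_mul (diag_unit i) (diag_unit j) = 0.
Proof.
move=> ij; rewrite diag_unit_mul; congr pair; apply/ffunP => l; rewrite !ffunE.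
  by rewrite (negPf ij) mulr0.
by rewrite !scaler0.
Qed.

Lemma trace_diag_unit i : trace (diag_unit i) = 1.
Proof.
rewrite /trace (sum_ord3 _ i) /= !ffunE eqxx ordS3_neq ordSS3_neq.
by rewrite !addr0.
Qed.

Lemma sum_diag_unit : \sum_i diag_unit i = jordan_one F k.
Proof.
rewrite (sum_ord3 _ ord0); apply: J3_ext => i; last by rewrite /= !ffunE !addr0.
rewrite /= !ffunE.
by move: i; apply: (ord3_ind (i := ord0)); rewrite /= ?addr0 ?add0r.
Qed.

Lemma dim_J3 : \dim {:J} = (3 * 2 ^ k + 3)%N.
Proof.
rewrite dimvf /=.
have <- : dim (cd F k) = (2 ^ k)%N by rewrite -dimvf dim_cd.
rewrite addnC; congr addn; [change (#|'I_3| * 1 = 3)%N|change (#|'I_3| * dim (cd F k) = 3 * dim (cd F k))%N];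
  by rewrite card_ord.
Qed.

Definition off_pair i (p : (A * A)%type) : J :=
  (0, [ffun l => if l == i then p.1 else if l == ordS (ordS i) then p.2 else 0]).

Lemma off_pair_linear i : linear (off_pair i).
Proof.
move=> a p q; apply: J3_ext => l; first by rewrite /= !ffunE [RHS]addr0 [RHS]mulr0.
by rewrite J3_linear2 /= !ffunE; case: ifP => // _; case: ifP => //; rewrite scaler0 addr0.
Qed.

HB.instance Definition _ i := GRing.isLinear.Build F (A * A)%type J *:%R (off_pair i) (off_pair_linear i).

Lemma dim_half_space i (U : {vspace J}) :
  (forall x, (x \in U) = (jordan_mul (diag_unit i) x == 2%:R^-1 *: x)) -> \dim U = (2 * 2 ^ k)%N.
Proof.
move=> hU; set f : 'Hom((A * A)%type, J) := linfun (off_pair i).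
have fE p : f p = off_pair i p by rewrite lfunE.
have ns : (i == ordS (ordS i)) = false by rewrite eq_sym ordSS3_neq.
have f0 : lker f = 0%VS.
  apply/eqP/lker0P => p q; rewrite !fE => e.
  have e2 l := congr1 (fun X : J => X.2 l) e; have := e2 i; have := e2 (ordS (ordS i)).
  by rewrite /= !ffunE !eqxx ordSS3_neq; case: p q {e e2} => [? ?] [? ?] /= -> ->.
suff -> : U = limg f.
  rewrite limg_dim_eq ?f0 ?capv0 // dimvf mul2n -addnn.
  by rewrite -(dim_cd F k) dimvf.
have h0 : 2%:R^-1 != 0 :> F by rewrite invr_eq0 pnatr_eq0.
apply/vspaceP => x; rewrite hU; apply/eqP/memv_imgP => [e|[p _ ->]].
  have e1 l : (l == i)%:R * x.1 i = 2%:R^-1 * x.1 l.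
    by have := congr1 (fun X : J => X.1 l) e; rewrite diag_unit_mul /= !ffunE.
  have e2 l : 2%:R^-1 *: (((l == i)%:R + (ordS l == i)%:R) *: x.2 l) = 2%:R^-1 *: x.2 l.
    by have := congr1 (fun X : J => X.2 l) e; rewrite diag_unit_mul /= !ffunE.
  have xi : x.1 i = 0.
    by have := e1 i; rewrite eqxx mul1r => h; apply: (eq_by_scaled (c := 2%:R) h); field.
  exists (x.2 i, x.2 (ordS (ordS i))); first exact: memvf.
  rewrite fE; apply: J3_ext => l.
    have := e1 l; rewrite xi mulr0 => /esym/eqP; rewrite mulf_eq0 (negPf h0) /= => /eqP ->.
    by rewrite /= ffunE.
  move: l; apply: (ord3_ind (i := i)); rewrite /= ffunE ?eqxx ?ordS3_neq ?ordSS3_neq //.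
  have := e2 (ordS i); rewrite ordS3_neq ordSS3_neq addr0 scale0r scaler0 => /esym/eqP.
  rewrite scaler_eq0 (negPf h0) /= => /eqP ->.
  by rewrite eq_sym ordS3_neq.
rewrite fE diag_unit_mul; apply: J3_ext => l; first by rewrite /= !ffunE mulr0 scaler0.
rewrite /= !ffunE; move: l; apply: (ord3_ind (i := i)).
- by rewrite eqxx ordS3_neq addr0 scale1r.
- by rewrite ordS3_neq ordSS3_neq (eq_sym (ordS i)) ordS3_neq !scaler0.
- by rewrite ordSS3_neq ordS3K !eqxx add0r scale1r.
Qed.

Definition J3_cubic : cubicAlgebra F :=
  CubicAlgebra jordan_mulC jordan_mul_linear jordan_mul_one trace_linear trace_one trace_mulA
    trace_nondeg jordan_char_polar diag_unit_mul_diag trace_diag_unit diag_unit_orth sum_diag_unit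
    (expn_gt0 2 k) dim_J3 dim_half_space.

End HermitianMatrices.

(** * Codimensions of the orbits *)

Section Codimension.
Variables (F : numClosedFieldType) (J : cubicAlgebra F).
Local Notation pair0 := (pair0 (J := J)).
Local Notation pair1 := (pair1 (J := J)).
Local Notation pair2 := (pair2 (J := J)).
Local Notation pair4 := (pair4 (J := J)).
Local Notation a := (ca_dim J).
Local Notation "x ** y" := (@ca_mul F J x y).
Local Notation T := (@ca_tr F J).
Local Notation E := (@ca_frame F J).
Implicit Types (L : {vspace J}) (u v : J).

Definition closed_lines : set {vspace J} := lines_closure (lines_of pair0).
Definition line_orbit L : set {vspace J} := [set (g @: L)%VS | g in automorph (J := J)].

Lemma secant_lines : [set L | exists P, secant_plane P /\ L = hat_space P] = lines_of pair0.
Proof.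
apply/seteqP; split=> L; first by case=> P [sP ->]; apply: secant_pair0.
by move=> /pair0_secant[P sP LE]; exists P.
Qed.

Lemma closed_lines_reduced L u v : closed_lines L -> indep2 u v -> L = <<[:: u; v]>>%VS -> reduced u v.
Proof.
move=> [_ cl] uv LE; split=> //; rewrite -cone_pair0; apply: cl.
by exists u, v; split=> //; apply/indep2P.
Qed.

Lemma line_span L : \dim L = 2%N -> exists u v, indep2 u v /\ L = <<[:: u; v]>>%VS.
Proof.
move=> dL; have := span_basis (vbasisP L); have := etrans (size_tuple (vbasis L)) dL.
case: (tval (vbasis L)) => [|u [|v [|//]]] // _ LE; exists u, v; split=> //.
by apply/indep2P; rewrite LE.
Qed.

Lemma closed_lines_closed L : closed_lines L -> closed_line L.
Proof.
move=> cL; have [u [v [uv LE]]] := line_span cL.1.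
by rewrite LE; apply: reduced_closed; apply: closed_lines_reduced LE => //.
Qed.

Lemma lines_of_line_orbit u v : indep2 u v -> line_orbit <<[:: u; v]>>%VS = lines_of (orbit_pair u v).
Proof.
move=> uv; apply/seteqP; split=> L.
  case=> g ag <-; exists (g u), (g v); split; last by rewrite limg_span.
  by exists g, 1; rewrite scale1r; split=> //; exact: oner_neq0.
case=> _ [_ [[g [k [ag k0 -> ->]]] ->]]; exists g => //; rewrite limg_span /=.
apply/vspaceP => x; apply/idP/idP => /mem_span2[b [c ->]]; apply/mem_span2.
  by exists b, (c / k); rewrite scalerA divfK.
by exists b, (c * k); rewrite scalerA.
Qed.

Lemma lines_of_indep2 (P : J -> J -> Prop) L : (forall u v, P u v -> indep2 u v) -> lines_of P L ->
  exists u v, [/\ P u v, indep2 u v, L = <<[:: u; v]>>%VS & plucker_cone (line_orbit L) = cone_of (orbit_pair u v)].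
Proof.
move=> Pi [u [v [Puv ->]]]; exists u, v; have uv := Pi _ _ Puv.
by split=> //; rewrite lines_of_line_orbit // cone_orbit.
Qed.

Lemma coordinate_trdeg_leq (V : vectType F) (K : set V) n m : coordinate_trdeg K n -> rank_ge K m -> (m <= n)%N.
Proof. by case=> _ h [f /h]. Qed.

Lemma closed_lines_cone : plucker_cone closed_lines `<=` zariski_closure (cone_of pair0).
Proof.
by move=> _ [u [v [duv cL ->]]]; have [|_] := closed_lines_reduced cL _ erefl; first exact/indep2P.
Qed.

Lemma cone0_closed_lines : cone_of pair0 `<=` plucker_cone closed_lines.
Proof.
move=> w; rewrite -cone_pair0 => -[u [v [duv S0 ->]]]; exists u, v; split=> //; split=> //.
move=> _ [u' [v' [duv' LE ->]]]; apply: sub_zariski_closure; exists u', v'.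
by split=> //; rewrite LE.
Qed.

(* A type 4 orbit is only bounded from above, which suffices: among the
   codimensions 0, 1, 2, 4 no other one is left for it. *)
Lemma line_orbit_codim L i : closed_lines L -> lines_codim (line_orbit L) closed_lines i ->
  [\/ i = 0%N /\ lines_of pair0 L, i = 1%N /\ lines_of pair1 L,
      (2 <= i <= 3)%N /\ lines_of pair2 L | (3 <= i)%N /\ lines_of pair4 L].
Proof.
move=> cL [d []]; rewrite /lines_dim /proj_dim => dL dY.
have a0 := ca_dim_gt0 J.
have ub : (d + i <= 3 * a)%N.
  have [[f fY] _] := dY.
  have : rank_ge (cone_of pair0) (d + i).+1.
    by apply: rank_ge_closure closed_lines_cone _; exists f.
  by move/rank_cone0_leq; rewrite addn1 ltnS.
have lb : (3 * a <= d + i)%N.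
  (* The frame itself gives a pair of type 0, whose orbit cone has rank at least 3a + 1. *)
  have [u [v P]] : exists u v, pair0 u v.
    exists (hat (E ord0)), (E (ordS ord0) - E (ordS (ordS ord0))).
    have n0 j l : j != l -> E j ** E l = 0 by exact: ca_frame_orth.
    have vv : T ((E (ordS ord0) - E (ordS (ordS ord0))) ** (E (ordS ord0) - E (ordS (ordS ord0)))) = 2%:R.
      have : ordS ord0 != ordS (ordS ord0) :> 'I_3 by [].
      move: (ordS ord0) (ordS (ordS ord0)) => j l jl.
      rewrite !jmulE (n0 _ _ jl) (n0 l j) 1?eq_sym // !ca_frame_idem !jtrE !ca_frame_tr; ring.
    split; last by rewrite vv pnatr_eq0.
    exists (E ord0); split=> //.
    - exact: frame_idem1.
    - split; first by rewrite /null !jmulE !n0 // subr0.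
      by rewrite !jtrE !ca_frame_tr subrr.
    by apply: contraPneq vv => ->; rewrite !jmulE !jtrE => /esym/eqP; rewrite pnatr_eq0.
  have : rank_ge (plucker_cone closed_lines) (3 * a + 1).
      have := rank_orbit01 P.1; rewrite P.2; apply: rank_ge_sub => w ww.
      by apply: cone0_closed_lines; apply: orbit_cone0 ww.
  by move/(coordinate_trdeg_leq dY); rewrite addn1.
have lower n : rank_ge (plucker_cone (line_orbit L)) n -> (n <= d.+1)%N by apply: coordinate_trdeg_leq dL.
have upper : rank_ge (plucker_cone (line_orbit L)) d.+1 := dL.1.
have di : (d + i = 3 * a)%N by apply/eqP; rewrite eqn_leq ub lb.
case: (closed_line_types (closed_lines_closed cL)) => LP.
- have [u [v [P uv _ cE]]] := lines_of_indep2 (fun u v (P : pair0 u v) => pair01_indep P.1) LP.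
  move: lower; rewrite cE => lower; constructor 1; split=> //.
  (* The tangent vectors give 3a + 1 <= d + 1, hence i = 0. *)
  by have := lower _ (rank_orbit01 P.1); rewrite P.2; lia.
- have [u [v [P uv _ cE]]] := lines_of_indep2 (fun u v (P : pair1 u v) => pair01_indep P.1) LP.
  move: lower upper; rewrite cE => lower upper; constructor 2; split=> //.
  (* From above d + 2 <= 3a + 1, from below 3a <= d + 1, so i = 1. *)
  have := rank_cone0_leq (rank_cone1 (rank_ge_sub (orbit_cone1 P) upper)).
  by have := lower _ (rank_orbit01 P.1); lia.
- have Pi u v (P : pair2 u v) : indep2 u v by case: P => g _ /pair24_indep.
  have [u [v [P uv _ cE]]] := lines_of_indep2 Pi LP.
  move: lower upper; rewrite cE => lower upper; constructor 3; split=> //.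
  (* Two specializations give i >= 2, and the 3a - 2 tangent vectors give i <= 3. *)
  have := rank_cone0_leq (rank_cone1 (rank_cone2 (rank_ge_sub (orbit_cone2 P) upper))).
  by have [n] := rank_orbit2 P => nle /lower; lia.
have [u [v [P uv _ cE]]] := lines_of_indep2 (fun u v (P : pair4 u v) => pair24_indep P) LP.
move: upper; rewrite cE => upper; constructor 4; split=> //.
have := rank_cone0_leq (rank_cone1 (rank_cone2 (rank_cone4 (rank_ge_sub (orbit_cone4 P) upper)))).
by lia.
Qed.

End Codimension.

(** * Translation to the notions of the statement *)

Section Bridge.
Variables (F : numClosedFieldType) (k : nat) (hk : (k <= 3)%N).
Local Notation J := (J3_cubic F hk).

Lemma proj_one_hat : @proj_one F k = @hat F J :> (J3 F k -> J3 F k).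
Proof. by apply/funext => X; rewrite [RHS]hatE. Qed.

Lemma hat_space_proj_one (P : {vspace J3 F k}) : hat_space (J := J) P = (linfun (@proj_one F k) @: P)%VS.
Proof. by rewrite proj_one_hat. Qed.

Lemma reductions_closed_lines : @reductions F k = @closed_lines F J.
Proof.
rewrite /reductions /closed_lines -secant_lines; congr lines_closure; apply/seteqP; split=> L.
  by case=> P [dP P1 [cP sP] ->]; exists P; split; [split|rewrite hat_space_proj_one].
by case=> P [[dP P1 cP sP] ->]; exists P; split=> //; rewrite hat_space_proj_one.
Qed.

Lemma general_through_points L : general_through L = spaces_through (@general_points F J) L.
Proof.
by rewrite /general_through /general_spaces /severi_bar proj_one_hat.
Qed.

Lemma special_through_points L : special_through L = spaces_through (@special_points F J) L.
Proof. by []. Qed.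

Lemma reductions_orbit_type i (L : {vspace J3 F k}) : reductions_orbit i L -> closed_line (J := J) L /\
  [\/ i = 0%N /\ lines_of (pair0 (J := J)) L, i = 1%N /\ lines_of (pair1 (J := J)) L,
      (2 <= i <= 3)%N /\ lines_of (pair2 (J := J)) L | (3 <= i)%N /\ lines_of (pair4 (J := J)) L].
Proof.
case; rewrite reductions_closed_lines => cL codim; split; first exact: closed_lines_closed.
exact: line_orbit_codim.
Qed.

End Bridge.

Local Open Scope card_scope.

(* The composition algebra is cd R[i] k, of dimension a = 2 ^ k. *)
Theorem proposition3p15 (R : realType) (k : nat) (hk : (k <= 3)%N) :
  [/\ forall L : {vspace J3 R[i] k}, reductions_orbit 0 L ->
        general_through L #= `I_3 /\ special_through L #= `I_0,
      forall L : {vspace J3 R[i] k}, reductions_orbit 1 L ->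
        general_through L #= `I_1 /\ special_through L #= `I_1,
      forall L : {vspace J3 R[i] k}, reductions_orbit 2 L ->
        general_through L #= `I_0 /\ special_through L #= `I_1,
      forall L : {vspace J3 R[i] k}, reductions_orbit 4 L ->
        general_through L #= `I_0 /\ one_parameter_special_through L &
      k = 0%N -> @reductions_orbit R[i] k 4 = set0].
Proof.
have types i (L : {vspace J3 R[i] k}) := @reductions_orbit_type R[i] k hk i L.
split.
- move=> L /types[cL] [[_ LP]|[]//|[]//|[]//].
  by rewrite (general_through_points hk) (special_through_points hk); exact: count_pair0 LP cL.
- move=> L /types[cL] [[]//|[_ LP]|[]//|[]//].
  by rewrite (general_through_points hk) (special_through_points hk); exact: count_pair1 LP cL.
- move=> L /types[cL] [[]//|[]//|[_ LP]|[]//].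
  by rewrite (general_through_points hk) (special_through_points hk); exact: count_pair2 LP cL.
- move=> L /types[cL] [[]//|[]//|[]//|[_ LP]].
  have [gen dim1 bij] := count_pair4 LP cL.
  by rewrite (general_through_points hk).
move=> k0; apply/seteqP; split=> // L /types[cL] [[]//|[]//|[]//|[_ [u [v [P _]]]]].
by apply: no_pair4 P; rewrite /= k0.
Qed.
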